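(* Let $\theta_0,\sigma_0^2>0$ be fixed, let $Y$ be a centered Gaussian process on $[0,1]$ with covariance function $\sigma_0^2e^{-\theta_0|t_1-t_2|}$, let $f_1,\dots,f_p:[0,1]\to\mathbb R$ be known functions, let $\beta_0=(\beta_{01},\dots,\beta_{0p})'\in\mathbb R^p$ be fixed, and let $Z(t)=\sum_{k=1}^p\beta_{0k}f_k(t)+Y(t)$. For each $n$ let $0=s_1<\dots<s_n=1$ be a design (depending on $n$) with $\Delta_i=s_i-s_{i-1}$ for $i=2,\dots,n$. Let $0<a\le A<\infty$, $0<b\le B<\infty$ be fixed and $J=[a,A]\times[b,B]$. Let $\bar S_n(\theta,\sigma^2)$ be the leave-one-out logarithmic score with estimated mean defined in the context, and let $(\check\theta,\check\sigma^2)$ denote a minimizer of it over $J$: $$(\check\theta,\check\sigma^2)\in\operatorname*{argmin}_{(\theta,\sigma^2)\in J}\bar S_n(\theta,\sigma^2).$$ Assume that $\limsup_{n\to\infty}\max_{i=2,\dots,n}\Delta_i=0$ and that there exists $(\tilde\theta,\tilde\sigma^2)\in J$ with $\tilde\theta\tilde\sigma^2=\theta_0\sigma_0^2$. Assume also that $f_1,\dots,f_p$ are twice continuously differentiable and are linearly independent on $[0,1]$. Then $(\check\theta,\check\sigma^2)$ exists and $$\check\theta\check\sigma^2\to\theta_0\sigma_0^2\quad\text{almost surely as } n\to\infty.$$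
   Context: The design points and spacings form triangular arrays (dependence on $n$ not written). The observations are $z_i=Z(s_i)$, $i=1,\dots,n$. Let $R_\theta=[e^{-\theta|s_i-s_j|}]_{1\le i,j\le n}$ and let $F=[f_j(s_i)]_{i=1,\dots,n,\,j=1,\dots,p}$. For each $i$: $R_{\theta,-i}$ is $R_\theta$ with row and column $i$ removed, $F_{-i}$ is $F$ with row $i$ removed, $z_{-i}=(z_j)_{j\ne i}$, $r_{\theta,-i}=(e^{-\theta|s_i-s_j|})_{j\ne i}$, and $\mathbf f_i=(f_1(s_i),\dots,f_p(s_i))'$. Set $$\hat\beta_{-i}=(F_{-i}'R_{\theta,-i}^{-1}F_{-i})^{-1}F_{-i}'R_{\theta,-i}^{-1}z_{-i},\qquad \hat Z_{\theta,-i}(s_i)=\mathbf f_i'\hat\beta_{-i}+r_{\theta,-i}'R_{\theta,-i}^{-1}(z_{-i}-F_{-i}\hat\beta_{-i}),$$ $$\check\sigma^2_{\theta,\sigma^2,-i}(s_i)=\mathbb E_{\theta,\sigma^2}\bigl([\hat Z_{\theta,-i}(s_i)-Z(s_i)]^2\bigr),$$ where $\mathbb E_{\theta,\sigma^2}$ is expectation computed as if $Y$ were centered with covariance function $\sigma^2e^{-\theta|t_1-t_2|}$. Finally $$\bar S_n(\theta,\sigma^2)=\sum_{i=1}^n\left[\log\bigl(\check\sigma^2_{\theta,\sigma^2,-i}(s_i)\bigr)+\frac{(z_i-\hat Z_{\theta,-i}(s_i))^2}{\check\sigma^2_{\theta,\sigma^2,-i}(s_i)}\right].$$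
   Formalization: Existence of the minimizer is stated for all sufficiently large n, together with the score being well defined on J, because for small n (for instance n at most p) the leave-one-out estimated mean, and hence the score, is undefined. *)

(* Defs.v *)
From HB Require Import structures.
From mathcomp Require Import all_boot all_order all_algebra.
From mathcomp Require Import all_classical all_reals all_analysis.

Set Implicit Arguments.
Unset Strict Implicit.
Unset Printing Implicit Defensive.

Import Order.TTheory GRing.Theory Num.Theory.
Import numFieldNormedType.Exports.

Local Open Scope classical_set_scope.
Local Open Scope ring_scope.

Section Functions.
Context {R : realType}.

(* [g'] is the derivative of [g] on the closed interval [0, 1], one-sided at
   the endpoints; values of [g] outside [0, 1] are irrelevant. *)
Definition derivative01 (g g' : R -> R) : Prop :=
  forall x : R, x \in `[0, 1] ->
    (g y - g x) / (y - x) @[y --> within `[0, 1] x^'] --> g' x.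

Definition twice_continuously_differentiable01 (g : R -> R) : Prop :=
  exists g1 g2 : R -> R,
    [/\ derivative01 g g1, derivative01 g1 g2
      & {within `[0, 1], continuous g2}].

Definition linearly_independent01 (p : nat) (f : 'I_p -> R -> R) : Prop :=
  forall c : 'I_p -> R,
    (forall t : R, t \in `[0, 1] -> \sum_(k < p) c k * f k t = 0) ->
    forall k, c k = 0.

End Functions.

Section Processes.
Context {R : realType}.

Definition exp_cov (theta sigma2 t u : R) : R :=
  sigma2 * expR (- theta * `|t - u|).

Definition centered_with_cov01 (d : measure_display) (T : measurableType d)
    (P : probability T R) (Y : R -> {RV P >-> R}) (C : R -> R -> R) : Prop :=
  (forall t : R, t \in `[0, 1] -> ('E_P[Y t] = 0%R%:E)%E) /\
  (forall t u : R, t \in `[0, 1] -> u \in `[0, 1] ->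
     covariance P (Y t) (Y u) = (C t u)%:E).

(* [s] is the standard deviation. The degenerate case is treated apart because
   [normal_prob m 0] is not a Dirac mass. *)
Definition gaussian_law (m s : R) (A : set R) : \bar R :=
  if s == 0 then \d_m A else normal_prob m s A.

Definition gaussian_process01 (d : measure_display) (T : measurableType d)
    (P : probability T R) (Y : R -> {RV P >-> R}) : Prop :=
  forall (k : nat) (t c : 'I_k -> R), (forall j, t j \in `[0, 1]) ->
  exists m s : R, forall A : set R, measurable A ->
    P ((fun w => \sum_(j < k) c j * Y (t j) w) @^-1` A) = gaussian_law m s A.

(* [v] is the expectation of [g Y] computed as if [Y] were centered with
   covariance function [exp_cov theta sigma2], on whatever probability space.
   Only meaningful when [g Y] is a quadratic function of finitely many values
   of [Y], so that its expectation is determined by the covariance function. *)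
Definition is_model_expectation (theta sigma2 : R) (g : (R -> R) -> R) (v : R)
    : Prop :=
  forall (d : measure_display) (T : measurableType d) (P : probability T R)
    (Y : R -> {RV P >-> R}),
    centered_with_cov01 Y (exp_cov theta sigma2) ->
    ('E_P[fun w => g (fun t => Y t w)] = v%:E)%E.

Definition model_expectation (theta sigma2 : R) (g : (R -> R) -> R) : R :=
  xget 0 [set v | is_model_expectation theta sigma2 g v].

End Processes.

Section Designs.
Context {R : realType} {n : nat}.
Implicit Types s : 'I_n -> R.

(* Design points are numbered from 0 to n - 1. *)
Definition is_design s : Prop :=
  [/\ forall i : 'I_n, i = 0%N :> nat -> s i = 0,
      forall i : 'I_n, i = n.-1 :> nat -> s i = 1
    & forall i j : 'I_n, (i < j)%N -> s i < s j].

(* For [0 < i], [ord_pred i] is the index [i - 1]. *)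
Definition spacing s (i : 'I_n) : R := s i - s (ord_pred i).

Definition max_spacing s : R :=
  \big[Num.max/0]_(i < n | (0 < i)%N) spacing s i.

End Designs.

Section LeaveOneOut.
Context {R : realType} {p n : nat}.
Variables (f : 'I_p -> R -> R) (s : 'I_n -> R).

Definition corr_mx (theta : R) : 'M[R]_n :=
  \matrix_(i, j) expR (- theta * `|s i - s j|).

Definition design_mx : 'M[R]_(n, p) := \matrix_(i, j) f j (s i).

Definition loo_corr_mx theta (i : 'I_n) : 'M[R]_n.-1 :=
  row' i (col' i (corr_mx theta)).

Definition loo_design_mx (i : 'I_n) : 'M[R]_(n.-1, p) := row' i design_mx.

Definition loo_corr_vec theta (i : 'I_n) : 'cV[R]_n.-1 :=
  \col_j expR (- theta * `|s i - s (lift i j)|).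

Definition loo_gram_mx theta (i : 'I_n) : 'M[R]_p :=
  (loo_design_mx i)^T *m invmx (loo_corr_mx theta i) *m loo_design_mx i.

Definition loo_beta theta (i : 'I_n) (z : 'cV[R]_n) : 'cV[R]_p :=
  invmx (loo_gram_mx theta i) *m (loo_design_mx i)^T
    *m invmx (loo_corr_mx theta i) *m row' i z.

Definition loo_pred theta (i : 'I_n) (z : 'cV[R]_n) : R :=
  let b := loo_beta theta i z in
  (row i design_mx *m b
   + (loo_corr_vec theta i)^T *m invmx (loo_corr_mx theta i)
       *m (row' i z - loo_design_mx i *m b)) 0 0.

Definition observations (beta : 'cV[R]_p) (y : R -> R) : 'cV[R]_n :=
  \col_i (\sum_(k < p) beta k 0 * f k (s i) + y (s i)).

Definition loo_mse beta theta sigma2 (i : 'I_n) : R :=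
  model_expectation theta sigma2 (fun y =>
    let z := observations beta y in (loo_pred theta i z - z i 0) ^+ 2).

Definition loo_log_score beta (z : 'cV[R]_n) theta sigma2 : R :=
  \sum_(i < n) (ln (loo_mse beta theta sigma2 i)
    + (z i 0 - loo_pred theta i z) ^+ 2 / loo_mse beta theta sigma2 i).

(* The inverses, logarithm and quotient in [loo_log_score] are genuine ones. *)
Definition loo_well_defined beta theta sigma2 : Prop :=
  forall i : 'I_n,
    [/\ loo_corr_mx theta i \in unitmx, loo_gram_mx theta i \in unitmx
      & 0 < loo_mse beta theta sigma2 i].

End LeaveOneOut.

Definition is_argmin {R : realType} (J : set (R * R)) (S : R -> R -> R)
    (x : R * R) : Prop :=
  J x /\ forall y, J y -> S x.1 x.2 <= S y.1 y.2.

(* Main.v *)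
(* For known mean, the Markov property reduces leave-one-out prediction to the two
   neighbours: with [h] the largest spacing, the normalized variance at [s_i] is
   [2 theta tau_i (1 + O(h))], where [tau_i] does not depend on [theta], and the
   prediction error at [theta] differs from the one at [theta0] by
   [O(om_i ||y||)], where [sum_i om_i^2 / tau_i = O(h)] and [||y||], the norm of
   the data in the reproducing kernel Hilbert space of [theta0], satisfies
   [||y||^2 = O(n)]. The same orders hold for the effect of estimating the mean,
   since [C^2] functions are interpolated up to [O(om_i)] and the generalized
   least squares Gram matrices are uniformly bounded below, by linear
   independence. Writing [x] for [theta sigma2] and [V] for the sum of the
   normalized squared errors at [theta0], the score is therefore
   [sum_i ln (2 tau_i) + n ln x + theta0 V / x + o(n)] uniformly on [J]. Fourth
   moment bounds of order [1 / n^2], which are summable, give [V / n --> sigma02]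
   almost surely, so that [x0 / x - 1 - ln (x0 / x)], where [x0] is
   [theta0 sigma02], is [o(1)] at a minimizer. *)

Require Import Defs.
From HB Require Import structures.
From mathcomp Require Import all_boot all_order all_algebra.
From mathcomp Require Import all_classical all_reals all_analysis.
From mathcomp Require Import measurable_realfun ring lra zify.

Set Implicit Arguments.
Unset Strict Implicit.
Unset Printing Implicit Defensive.

Import Order.TTheory GRing.Theory Num.Theory.
Import numFieldNormedType.Exports.

Local Open Scope classical_set_scope.
Local Open Scope ring_scope.

(** * Quadratic forms *)

Section QuadraticForms.
Context {R : realType}.

(** The Gaussian hypothesis only gives the law of each linear combination, so independence of the
    normalized errors is never formed: everything goes through joint moment generating functions.
    Squares enter by writing [expR (l * x ^+ 2)] as a Gaussian average of exponentials of multiples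
    of [x]. The variable whose fourth moment is bounded is [expR U - 1], with [U] the centered sum
    divided by [n], because that moment is a combination of values of the moment generating function
    at [0, ..., 4]. Uniformity on [J] needs no chaining: the bounds hold path by path and see the
    path only through [V] and the squared norm, so one almost sure event serves for all parameters.
    Comparing squared prediction errors produces cross terms; Young's inequality with weight
    [sqrt h] splits them, whence a remainder of order [n sqrt h]. The expectation under the model
    quantifies over all probability spaces, so a concrete process has to be built for it to be a
    single number. *)

Definition quad n (K : 'M[R]_n) (x : 'cV[R]_n) : R := (x^T *m K *m x) 0 0.

Definition psd n (K : 'M[R]_n) := K^T = K /\ forall x, 0 <= quad K x.

Lemma discriminant_le (a b c : R) :
  (forall t, 0 <= a + 2 * t * b + t ^+ 2 * c) -> b ^+ 2 <= a * c.
Proof.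
move=> H; have c0 : 0 <= c.
  case: (leP 0 c) => // c0.
  have a0 : 0 <= a by have := H 0; rewrite mulr0 mul0r expr0n /= mul0r !addr0.
  have cn : c != 0 by rewrite lt_eqF.
  (* [H t] and [H (- t)] add up to [2 * (a + t ^+ 2 * c)]. With [t >= 1] and [t * c = c - (a + 1)],
     [a + t ^+ 2 * c] is at most [c - 1 < 0]. *)
  set t := (a + 1) / (- c) + 1.
  have tE : t * c = c - (a + 1) by rewrite /t; field.
  have t1 : 1 <= t by rewrite lerDr divr_ge0// ?oppr_ge0 ?(ltW c0)//; lra.
  have : 0 <= a + t * (t * c) by have := H t; have := H (- t); lra.
  by rewrite tE; nra.
have [c_eq0|cN0] := eqVneq c 0.
  have [->|bN0] := eqVneq b 0; first by rewrite expr0n c_eq0 mulr0.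
  have := H (- (a + 1) / (2 * b)); rewrite c_eq0 mulr0 addr0.
  have -> : 2 * (- (a + 1) / (2 * b)) * b = - (a + 1) by field.
  by lra.
have {}c0 : 0 < c by rewrite lt_def cN0.
have := H (- b / c).
have -> : a + 2 * (- b / c) * b + (- b / c) ^+ 2 * c = (a * c - b ^+ 2) / c.
  by field.
by rewrite pmulr_lge0 ?invr_gt0// subr_ge0.
Qed.

Lemma psd_cauchy_schwarz n (K : 'M[R]_n) (x y : 'cV[R]_n) : psd K ->
  ((x^T *m K *m y) 0 0) ^+ 2 <= quad K x * quad K y.
Proof.
move=> [symK posK]; apply: discriminant_le => t.
have := posK (x + t *: y); rewrite /quad.
have -> : (x + t *: y)^T = x^T + t *: y^T by rewrite linearD linearZ.
rewrite !mulmxDl !mulmxDr -!scalemxAl -!scalemxAr.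
have yxE : (y^T *m K *m x) 0 0 = (x^T *m K *m y) 0 0.
  have -> : y^T *m K *m x = (x^T *m K *m y)^T.
    by rewrite !trmx_mul trmxK symK mulmxA.
  by rewrite mxE.
have D (u v : 'M[R]_1) : (u + v) 0 0 = u 0 0 + v 0 0 by rewrite mxE.
have Z c (u : 'M[R]_1) : (c *: u) 0 0 = c * u 0 0 by rewrite mxE.
rewrite !(D, Z) yxE.
by rewrite /quad; lra.
Qed.

Lemma tr_psd n (K : 'M[R]_n) : psd K -> K^T = K. Proof. by case. Qed.

Lemma tr_invmx_psd n (K : 'M[R]_n) : psd K -> (invmx K)^T = invmx K.
Proof. by move=> Kpsd; rewrite trmx_inv tr_psd. Qed.

Lemma quad_invmx n (K : 'M[R]_n) (x : 'cV[R]_n) : psd K -> K \in unitmx ->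
  quad (invmx K) x = quad K (invmx K *m x).
Proof.
move=> Kpsd Kunit; rewrite /quad trmx_mul tr_invmx_psd//.
by rewrite -!mulmxA (mulmxA K) mulmxV// mul1mx !mulmxA.
Qed.

Lemma psd_invmx n (K : 'M[R]_n) : psd K -> K \in unitmx -> psd (invmx K).
Proof.
move=> Kpsd Kunit; split=> [|x]; first exact: tr_invmx_psd.
by rewrite quad_invmx//; case: Kpsd.
Qed.

(** For a covariance matrix [K], a linear form is bounded by its standard deviation times the
    reproducing kernel norm of its argument. All bounds of values by [rkhs] come from here. *)
Lemma cauchy_schwarz_invmx n (K : 'M[R]_n) (x y : 'cV[R]_n) :
  psd K -> K \in unitmx ->
  ((x^T *m y) 0 0) ^+ 2 <= quad K x * quad (invmx K) y.
Proof.
move=> Kpsd Kunit; rewrite quad_invmx//.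
have := psd_cauchy_schwarz x (invmx K *m y) Kpsd.
by rewrite -mulmxA mulKVmx.
Qed.

(* [x^T K^-1 x] is the supremum of [(a^T x)^2 / (a^T K a)]; deleting an index
   restricts the supremum to the [a] vanishing there. *)
Lemma quad_invmx_row' n (K : 'M[R]_n) (i : 'I_n) (x : 'cV[R]_n) :
  psd K -> K \in unitmx -> row' i (col' i K) \in unitmx ->
  psd (row' i (col' i K)) ->
  quad (invmx (row' i (col' i K))) (row' i x) <= quad (invmx K) x.
Proof.
move=> Kpsd Kunit; set K' := row' i _ => K'unit K'psd.
set y := row' i x; set a := invmx K' *m y.
pose J : 'M[R]_(n.-1, n) := row' i 1%:M.
have JK : J *m K *m J^T = K'.
  rewrite /J mul_rowsub_mx mul1mx.
  by apply/matrixP => j k; rewrite !mxE (bigD1 (lift i k))//= big1 ?addr0 => [|l lk];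
    rewrite !mxE ?eqxx ?mulr1// eq_sym (negPf lk) mulr0.
have Jx : J *m x = y by rewrite /J mul_rowsub_mx mul1mx.
(* [J^T *m a] extends [a] by zero at [i]. With [q] the left-hand side of the goal, this reads
   [q ^+ 2 <= q * quad (invmx K) x], to be divided by [q]. *)
have := cauchy_schwarz_invmx (J^T *m a) x Kpsd Kunit.
have -> : quad K (J^T *m a) = quad (invmx K') y.
  by rewrite quad_invmx// -/a /quad trmx_mul trmxK -!mulmxA (mulmxA J) (mulmxA (J *m K)) JK !mulmxA.
have -> : (J^T *m a)^T *m x = y^T *m invmx K' *m y.
  by rewrite /a trmx_mul trmxK trmx_mul tr_invmx_psd// -!mulmxA Jx mulmxA.
rewrite -/(quad (invmx K') y).
have [q0|qN0] := eqVneq (quad (invmx K') y) 0.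
  by rewrite q0 => _; case: (psd_invmx Kpsd Kunit) => _; exact.
have q_gt0 : 0 < quad (invmx K') y.
  by rewrite lt_def qN0/=; case: (psd_invmx K'psd K'unit) => _; exact.
by rewrite expr2 ler_pM2l.
Qed.

Lemma psd_factor n (L : 'M[R]_n) (m : 'rV[R]_n) : (forall i, 0 <= m 0 i) ->
  psd (L *m diag_mx m *m L^T).
Proof.
move=> m_ge0; split=> [|x].
  by rewrite !trmx_mul trmxK tr_diag_mx mulmxA.
have -> : quad (L *m diag_mx m *m L^T) x = quad (diag_mx m) (L^T *m x).
  by rewrite /quad trmx_mul trmxK !mulmxA.
rewrite /quad mul_mx_diag mxE.
by apply: sumr_ge0 => j _; rewrite !mxE mulrAC mulr_ge0// -expr2 sqr_ge0.
Qed.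

End QuadraticForms.

(** * The exponential kernel *)

Lemma quad_factor_inv (R : realType) n (L : 'M[R]_n) (m : 'rV[R]_n)
    (e : 'cV[R]_n) : L \in unitmx -> (forall i, 0 < m 0 i) ->
  quad (invmx (L *m diag_mx m *m L^T)) (L *m e) = \sum_i e i 0 ^+ 2 / m 0 i.
Proof.
move=> Lu m_gt0; set K := L *m _ *m _.
have Du : diag_mx m \in unitmx.
  rewrite unitmxE det_diag unitfE; apply/prodf_neq0 => i _.
  by rewrite gt_eqF ?m_gt0.
have Ku : K \in unitmx by rewrite !unitmx_mul Lu Du unitmx_tr Lu.
have Kpsd : psd K by apply: psd_factor => i; rewrite ltW.
pose D' := diag_mx (\row_i (m 0 i)^-1).
have D'E : diag_mx m *m D' = 1%:M.
  rewrite mulmx_diag; apply/matrixP => i j; rewrite !mxE.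
  by case: eqVneq => //= ->; rewrite mulfV ?gt_eqF ?m_gt0.
pose y := (invmx L)^T *m D' *m e.
have LT : L^T *m (invmx L)^T = 1%:M by rewrite -trmx_mul mulVmx// trmx1.
have KyE : K *m y = L *m e.
  rewrite /K /y -!mulmxA (mulmxA L^T) LT mul1mx (mulmxA (diag_mx m)) D'E.
  by rewrite mul1mx.
have -> : quad (invmx K) (L *m e) = (e^T *m D' *m e) 0 0.
  rewrite /quad -KyE -[_ *m (K *m y)]mulmxA mulKmx// KyE trmx_mul /y.
  by rewrite -!mulmxA (mulmxA L^T) LT mul1mx.
rewrite mul_mx_diag mxE; apply: eq_bigr => i _.
by rewrite !mxE expr2 mulrAC.
Qed.

Section ExponentialKernel.
Context {R : realType} (n : nat) (t : nat -> R) (theta : R).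

(** Correlation with the previous point. The value [0] at [l = 0] says that there is none: then
    [innov x 0 = x 0] and [ivar 0 = 1], although [0.-1] is [0]. *)
Definition rho (l : nat) : R :=
  if l is l'.+1 then expR (- theta * (t l - t l')) else 0.

Definition innov (x : nat -> R) (l : nat) : R := x l - rho l * x l.-1.

Definition ivar (l : nat) : R := 1 - rho l ^+ 2.

Definition kmx : 'M[R]_n := corr_mx (fun i : 'I_n => t i) theta.

Definition vecn m (x : nat -> R) : 'cV[R]_m := \col_i x i.

Definition rkhs (x : nat -> R) : R := \sum_(l < n) innov x l ^+ 2 / ivar l.

(** Unrolls the recursion [x l = innov x l + rho l * x l.-1]: the entry at [(j, l)] is the product
    of the correlations between [l] and [j]. It is unit lower triangular. *)
Let L : 'M[R]_n :=
  \matrix_(j, l) if (l <= j)%N then expR (- theta * (t j - t l)) else 0.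

Let D : 'rV[R]_n := \row_l ivar l.

(** Multiplying the process by [expR (theta * t)] makes its increments uncorrelated, so the weighted
    sum telescopes; the same holds for [sum_innov]. *)
Lemma sum_ivar k :
  \sum_(l < k.+1) expR (2 * theta * t l) * ivar l = expR (2 * theta * t k).
Proof.
elim: k => [|k IH]; first by rewrite big_ord1 /ivar /= expr0n subr0 mulr1.
rewrite big_ord_recr/= IH /ivar /= mulrBr mulr1 -expRM_natl -expRD.
by rewrite addrC -addrA [X in _ + X](_ : _ = 0) ?addr0//; apply/eqP;
  rewrite addrC subr_eq0; apply/eqP; congr expR; ring.
Qed.

Lemma sum_innov x k :
  \sum_(l < k.+1) expR (theta * t l) * innov x l = expR (theta * t k) * x k.
Proof.
elim: k => [|k IH]; first by rewrite big_ord1 /innov /= mul0r subr0.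
rewrite big_ord_recr/= IH /innov /= mulrBr mulrA -expRD.
have -> : theta * t k.+1 + - theta * (t k.+1 - t k) = theta * t k by ring.
by ring.
Qed.

Lemma sum_ord_le (F : nat -> R) (k : 'I_n) :
  \sum_(l < n) (if (l <= k)%N then F l else 0) = \sum_(l < k.+1) F l.
Proof. by rewrite -big_mkcond/= (big_ord_widen_cond n xpredT F)//. Qed.

Lemma kmx_factor : (forall k l, (k <= l)%N -> (l < n)%N -> t k <= t l) ->
  kmx = L *m diag_mx D *m L^T.
Proof.
move=> t_le; have symK : kmx^T = kmx.
  by apply/matrixP => i j; rewrite !mxE distrC.
have symF : (L *m diag_mx D *m L^T)^T = L *m diag_mx D *m L^T.
  by rewrite !trmx_mul trmxK tr_diag_mx mulmxA.
suff H (i j : 'I_n) : (j <= i)%N -> kmx i j = (L *m diag_mx D *m L^T) i j.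
  apply/matrixP => i j; have [|/ltnW ij] := leqP j i; first exact: H.
  by rewrite -symK -symF [LHS]mxE [RHS]mxE; exact: H.
move=> ji; rewrite mul_mx_diag !mxE.
transitivity (\sum_(l < n) (if (l <= j)%N then
   expR (- theta * (t i + t j)) * (expR (2 * theta * t l) * ivar l) else 0)).
  rewrite (sum_ord_le (fun l => expR (- theta * (t i + t j)) *
    (expR (2 * theta * t l) * ivar l))) -mulr_sumr sum_ivar -expRD.
  rewrite ger0_norm ?subr_ge0 ?t_le//; congr expR; ring.
apply: eq_bigr => l _; rewrite !mxE; case: ifP => lj; last by rewrite mulr0.
rewrite (leq_trans lj ji) mulrA -expRD [RHS]mulrAC -expRD.
by congr (expR _ * _); ring.
Qed.

Lemma vecn_innov x : vecn n x = L *m vecn n (innov x).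
Proof.
apply/matrixP => j u; rewrite !mxE.
transitivity (\sum_(l < n) (if (l <= j)%N then
   expR (- theta * t j) * (expR (theta * t l) * innov x l) else 0)).
  rewrite (sum_ord_le (fun l => expR (- theta * t j) *
    (expR (theta * t l) * innov x l))) -mulr_sumr sum_innov mulrA -expRD.
  by rewrite mulNr addNr expR0 mul1r.
apply: eq_bigr => l _; rewrite !mxE; case: ifP => lj; last by rewrite mul0r.
by rewrite mulrA -expRD; congr (expR _ * _); ring.
Qed.

Let L_unit : L \in unitmx.
Proof.
rewrite unitmxE det_trig; last first.
  by apply/is_trig_mxP => i j ij; rewrite mxE leqNgt ij.
rewrite unitfE; apply/prodf_neq0 => i _.
by rewrite mxE leqnn gt_eqF// expR_gt0.
Qed.

Hypothesis theta_gt0 : 0 < theta.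
Hypothesis t_lt : forall k l, (k < l)%N -> (l < n)%N -> t k < t l.

Let t_le k l : (k <= l)%N -> (l < n)%N -> t k <= t l.
Proof. by rewrite leq_eqVlt => /predU1P[->//|kl ln]; rewrite ltW// t_lt. Qed.

Lemma rho_ge0 l : 0 <= rho l.
Proof. by case: l => //= l; exact: expR_ge0. Qed.

Lemma rho_lt1 l : (l < n)%N -> rho l < 1.
Proof.
case: l => //= l ln; rewrite -expR0 ltr_expR mulNr oppr_lt0 mulr_gt0//.
by rewrite subr_gt0 t_lt.
Qed.

Lemma ivar_gt0 l : (l < n)%N -> 0 < ivar l.
Proof.
move=> ln; have := rho_ge0 l; have := rho_lt1 ln; rewrite /ivar; nra.
Qed.

Lemma kmx_psd : psd kmx.
Proof.
by rewrite kmx_factor//; apply: psd_factor => i; rewrite mxE ltW// ivar_gt0.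
Qed.

Lemma kmx_unit : kmx \in unitmx.
Proof.
rewrite kmx_factor// !unitmx_mul L_unit unitmx_tr L_unit andbT/=.
rewrite unitmxE det_diag unitfE; apply/prodf_neq0 => i _.
by rewrite mxE gt_eqF// ivar_gt0.
Qed.

Lemma quad_kmx x : quad (invmx kmx) (vecn n x) = rkhs x.
Proof.
rewrite kmx_factor// vecn_innov quad_factor_inv//.
  by apply: eq_bigr => i _; rewrite !mxE.
by move=> i; rewrite mxE ivar_gt0.
Qed.

(** Exports the inverse of the local [L], which decorrelates the data; the law of large numbers for
    [rkhs] uses it. *)
Lemma innov_mx : exists U : 'M[R]_n,
  (forall x, U *m vecn n x = vecn n (innov x)) /\ U *m kmx *m U^T = diag_mx D.
Proof.
exists (invmx L); split=> [x|]; first by rewrite vecn_innov mulKmx.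
by rewrite kmx_factor// !mulmxA mulVmx// mul1mx -mulmxA -trmx_mul mulVmx// trmx1 mulmx1.
Qed.

Lemma rkhs_ge0 x : 0 <= rkhs x.
Proof.
by apply: sumr_ge0 => l _; rewrite divr_ge0 ?sqr_ge0// ltW// ivar_gt0.
Qed.

(** Reproducing property: the kernel has unit diagonal, so evaluation at a point has norm 1. *)
Lemma sqr_entry_le (v : 'cV[R]_n) k : v k 0 ^+ 2 <= quad (invmx kmx) v.
Proof.
have := cauchy_schwarz_invmx (delta_mx k 0) v kmx_psd kmx_unit.
rewrite /quad trmx_delta -!rowE -colE !mxE subrr normr0 mulr0 expR0 mul1r.
done.
Qed.

Lemma sqr_le_rkhs x k : (k < n)%N -> x k ^+ 2 <= rkhs x.
Proof.
by move=> kn; have := sqr_entry_le (vecn n x) (Ordinal kn); rewrite quad_kmx mxE.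
Qed.

End ExponentialKernel.

Arguments rho : simpl never.

(** * Leave-one-out prediction *)

Section Kriging.
Context {R : realType} (n : nat) (t : nat -> R) (theta : R).
Local Notation rho := (rho t theta).
Local Notation Kn := (kmx n t theta).

(* By the Markov property, the best prediction of [x i] from all the other values
   only involves the two neighbours, with weights [wl i] and [wr i]. *)
Definition rhor (i : nat) : R := if (i.+1 < n)%N then rho i.+1 else 0.

Definition kden i : R := 1 - rho i ^+ 2 * rhor i ^+ 2.

Definition wl i : R := rho i * (1 - rhor i ^+ 2) / kden i.

Definition wr i : R := rhor i * (1 - rho i ^+ 2) / kden i.

Definition kvar i : R := (1 - rho i ^+ 2) * (1 - rhor i ^+ 2) / kden i.

(** At an end point, the value read at [i.-1] or [i.+1] in place of the missing neighbour has weight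
    [0]. *)
Definition krig_err (x : nat -> R) (i : nat) : R :=
  x i - wl i * x i.-1 - wr i * x i.+1.

Definition wvec (i : nat) : 'rV[R]_n :=
  \row_k ((k.+1 == i)%:R * wl i + (k == i.+1 :> nat)%:R * wr i).

Definition kvec (i : 'I_n) : 'rV[R]_n := delta_mx 0 i - wvec i.

Lemma wvec_mul (i : nat) (x : 'cV[R]_n) (y : nat -> R) :
  (i < n)%N -> (forall k : 'I_n, x k 0 = y k) ->
  (wvec i *m x) 0 0 = wl i * y i.-1 + wr i * y i.+1.
Proof.
move=> i_lt xy; rewrite mxE.
under eq_bigr => k _ do rewrite mxE xy mulrDl.
rewrite big_split/=; congr (_ + _).
  case: i i_lt => [|i] i_lt /=.
    by rewrite {2}/wl /rho !mul0r big1// => k _; rewrite !mul0r.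
  rewrite (bigD1 (Ordinal (ltnW i_lt)))//= eqxx mul1r big1 ?addr0// => k.
  by rewrite -val_eqE /= eqSS => /negPf ->; rewrite !mul0r.
have [iSn|iSn] := ltnP i.+1 n.
  rewrite (bigD1 (Ordinal iSn))//= eqxx mul1r big1 ?addr0// => k.
  by rewrite -val_eqE /= => /negPf ->; rewrite !mul0r.
rewrite {2}/wr /rhor ltnNge iSn/= !mul0r big1// => k _.
by rewrite /wr /rhor ltnNge iSn/= !mul0r mulr0 mul0r.
Qed.

Lemma kvec_mul (i : 'I_n) (x : 'cV[R]_n) (y : nat -> R) :
  (forall k : 'I_n, x k 0 = y k) -> (kvec i *m x) 0 0 = krig_err y i.
Proof.
move=> xy; rewrite /kvec mulmxBl -rowE mxE [X in X + _]mxE [X in _ + X]mxE.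
by rewrite (wvec_mul _ xy)// xy /krig_err opprD addrA.
Qed.

Lemma wvec_diag (i : 'I_n) : wvec i 0 i = 0.
Proof. by rewrite mxE eqn_leq ltnn/= ltn_eqF// !mul0r addr0. Qed.

Hypothesis theta_gt0 : 0 < theta.
Hypothesis t_lt : forall k l, (k < l)%N -> (l < n)%N -> t k < t l.

Let t_le k l : (k <= l)%N -> (l < n)%N -> t k <= t l.
Proof. by rewrite leq_eqVlt => /predU1P[->//|kl ln]; rewrite ltW// t_lt. Qed.

Lemma rhor_ge0 i : 0 <= rhor i.
Proof. by rewrite /rhor; case: ifP => // _; exact: rho_ge0. Qed.

Lemma rhor_lt1 i : rhor i < 1.
Proof. by rewrite /rhor; case: ifP => // iSn; exact: (rho_lt1 theta_gt0 t_lt). Qed.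

Lemma kden_gt0 i : (i < n)%N -> 0 < kden i.
Proof.
move=> i_lt; rewrite /kden.
have := rho_ge0 t theta i; have := rho_lt1 theta_gt0 t_lt i_lt.
have := rhor_ge0 i; have := rhor_lt1 i.
set x := rho i; set y := rhor i => *.
have : x ^+ 2 < 1 by nra.
have : 0 <= x ^+ 2 by nra.
have : y ^+ 2 < 1 by nra.
have : 0 <= y ^+ 2 by nra.
nra.
Qed.

Lemma kvar_gt0 i : (i < n)%N -> 0 < kvar i.
Proof.
move=> i_lt; rewrite /kvar divr_gt0 ?kden_gt0// mulr_gt0 ?(ivar_gt0 theta_gt0 t_lt)//.
have := rhor_ge0 i; have := rhor_lt1 i; nra.
Qed.

(** The error at [i] is uncorrelated with every other value, which characterizes the best linear
    prediction. Seen from a point on one side, the kernel at the three points involved is geometric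
    with ratios [rho] and [rhor], and the claim becomes a rational identity. *)
Lemma krig_err_kernel i k : (i < n)%N -> (k < n)%N ->
  krig_err (fun j => expR (- theta * `|t j - t k|)) i = (i == k)%:R * kvar i.
Proof.
move=> i_lt k_lt; have kdenN0 : kden i != 0 by rewrite gt_eqF// kden_gt0.
move: (kdenN0); rewrite /krig_err /wl /wr /kvar.
have [ki|ik|->{k_lt}] := ltngtP k i.
- rewrite mul0r; case: i ki i_lt kdenN0 => // i; rewrite ltnS => ki i_lt _ /=.
  set E := expR (- theta * `|t i - t k|).
  have le1 : t k <= t i by apply: t_le; lia.
  have le2 : t k <= t i.+1 by apply: t_le; lia.
  have -> : expR (- theta * `|t i.+1 - t k|) = rho i.+1 * E.
    by rewrite /E /rho /= -expRD !ger0_norm ?subr_ge0//; congr expR; ring.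
  (* The weight is kept in the equation: at the right end there is no further point and only the
     zero weight makes the equation true. *)
  have -> : rhor i.+1 * (1 - rho i.+1 ^+ 2) / kden i.+1
      * expR (- theta * `|t i.+2 - t k|)
     = rhor i.+1 * (1 - rho i.+1 ^+ 2) / kden i.+1
      * (rhor i.+1 * rho i.+1 * E).
    rewrite /rhor; case: ifP => [iSn|]; last by rewrite !mul0r.
    have le3 : t k <= t i.+2 by apply: t_le; lia.
    congr (_ * _); rewrite /E /rho /= -!expRD !ger0_norm ?subr_ge0//.
    by congr expR; ring.
  rewrite /kden; set x := rho i.+1; set y := rhor i.+1 => dN0.
  by field; rewrite exprMn.
- rewrite mul0r.
  have iSn : (i.+1 < n)%N by exact: leq_ltn_trans ik k_lt.
  set E := expR (- theta * `|t i.+1 - t k|).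
  have le1 : t i <= t k by apply: t_le; lia.
  have le2 : t i.+1 <= t k by apply: t_le; lia.
  have -> : expR (- theta * `|t i - t k|) = rhor i * E.
    rewrite /E /rhor iSn /rho -expRD !ler0_norm ?subr_le0//.
    by congr expR; ring.
  have -> : rho i * (1 - rhor i ^+ 2) / kden i
      * expR (- theta * `|t i.-1 - t k|)
     = rho i * (1 - rhor i ^+ 2) / kden i * (rho i * rhor i * E).
    rewrite /rhor iSn; case: i ik i_lt iSn @E kdenN0 le1 le2
      => [|i] ik i_lt iSn E _ le1 le2 /=; first by rewrite /rho !mul0r.
    have le3 : t i <= t k by apply: t_le; lia.
    congr (_ * _); rewrite /E /rho /= -!expRD !ler0_norm ?subr_le0//.
    by congr expR; ring.
  rewrite /kden; set x := rho i; set y := rhor i => dN0.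
  by field; rewrite exprMn.
- rewrite subrr normr0 mulr0 expR0 mul1r.
  have -> : rho i * (1 - rhor i ^+ 2) / kden i
      * expR (- theta * `|t i.-1 - t i|)
     = rho i * (1 - rhor i ^+ 2) / kden i * rho i.
    case: i i_lt kdenN0 => [|i] i_lt _ /=; first by rewrite /rho !mul0r.
    by congr (_ * _); rewrite /rho ler0_norm ?subr_le0 ?t_le// opprB.
  have -> : rhor i * (1 - rho i ^+ 2) / kden i
      * expR (- theta * `|t i.+1 - t i|)
     = rhor i * (1 - rho i ^+ 2) / kden i * rhor i.
    rewrite /rhor; case: ifP => [iSn|]; last by rewrite !mul0r.
    by congr (_ * _); rewrite /rho ger0_norm ?subr_ge0 ?t_le.
  rewrite /kden; set x := rho i; set y := rhor i => dN0.
  by field; rewrite exprMn.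
Qed.

Lemma kvec_kmx (i : 'I_n) : kvec i *m Kn = kvar i *: delta_mx 0 i.
Proof.
apply/rowP => k; rewrite [RHS]mxE [delta_mx _ _ _ _]mxE eqxx mxE /=.
have -> : \sum_j kvec i 0 j * Kn j k = (kvec i *m col k Kn) 0 0.
  by rewrite mxE; apply: eq_bigr => j _; rewrite [col _ _ _ _]mxE.
rewrite (@kvec_mul _ _ (fun j => expR (- theta * `|t j - t k|))); last first.
  by move=> j; rewrite !mxE.
by rewrite krig_err_kernel// mulrC -val_eqE/= eq_sym.
Qed.

Lemma wvec_kmx (i : 'I_n) : wvec i *m Kn = row i Kn - kvar i *: delta_mx 0 i.
Proof. by rewrite -kvec_kmx mulmxBl -rowE opprB addrC subrK. Qed.

(** [kvec i *m Kn] is concentrated at [i], where [kvec j] vanishes unless [i] is [j] or one of its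
    neighbours. Equal parity excludes neighbours. *)
Lemma kvec_cov (i j : 'I_n) : odd i = odd j ->
  (kvec i *m Kn *m (kvec j)^T) 0 0 = (i == j)%:R * kvar i.
Proof.
move=> ij; rewrite kvec_kmx -scalemxAl -rowE mxE !mxE !eqxx/= eq_sym.
have -> : (i.+1 == j :> nat) = false.
  by apply/eqP => ji; move: ij; rewrite -ji /=; case: (odd i).
have -> : (i == j.+1 :> nat) = false.
  by apply/eqP => ji; move: ij; rewrite ji /=; case: (odd j).
by rewrite !mul0r; ring.
Qed.

Lemma loo_kmx (i : 'I_n) :
  row' i (col' i Kn) = kmx n.-1 (fun k => t (bump i k)) theta.
Proof. by apply/matrixP => j k; rewrite !mxE. Qed.

Lemma bump_lt (i : 'I_n) k l : (k < l)%N -> (l < n.-1)%N ->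
  t (bump i k) < t (bump i l).
Proof.
move=> kl ln; apply: t_lt; first by rewrite /bump; lia.
by case: n i ln => [[]//|m] i /= ln; rewrite /bump; lia.
Qed.

(** The normal equations: they identify the two-neighbour weights with the full vector [r' R^-1] of
    the leave-one-out predictor. *)
Lemma wvec_loo (i : 'I_n) :
  col' i (wvec i) *m row' i (col' i Kn) = col' i (row i Kn).
Proof.
have -> : col' i (row i Kn) = col' i (wvec i *m Kn).
  rewrite wvec_kmx; apply/rowP => k; rewrite !mxE.
  by rewrite eqxx /= eq_sym (negPf (neq_lift _ _)) mulr0 subr0.
apply/rowP => k; rewrite !mxE (bigD1_ord i)//= wvec_diag mul0r add0r.
by apply: eq_bigr => j _; rewrite !mxE.
Qed.

End Kriging.

Section LeaveOneOutError.
Context {R : realType} (p n : nat) (f : 'I_p -> R -> R) (t : nat -> R).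
Variables (theta : R) (i : 'I_n).
Local Notation s := (fun i : 'I_n => t i).
Local Notation Kn := (kmx n t theta).
Local Notation F := (design_mx f s).
Local Notation Fi := (loo_design_mx f s i).
Local Notation Ki := (loo_corr_mx s theta i).
Local Notation G := (loo_gram_mx f s theta i).

Let J : 'M[R]_(n.-1, n) := row' i 1%:M.

(** Errors made at [t i] when each regression function is predicted from its two neighbours. *)
Definition gvec : 'rV[R]_p := kvec t theta i *m F.

(* [gam] is the part of the normalized mean square error due to estimating the
   mean, see [ecoef_var]. *)
Definition gam : R := quad (invmx G) gvec^T.

Definition bmx : 'M[R]_(p, n) := invmx G *m Fi^T *m invmx Ki *m J.

(** Coefficients of the leave-one-out error as a linear form in all the data, see [loo_predE]: the
    known-mean error, corrected for the estimated mean. *)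
Definition ecoef : 'rV[R]_n := kvec t theta i - gvec *m bmx.

Hypothesis theta_gt0 : 0 < theta.
Hypothesis t_lt : forall k l, (k < l)%N -> (l < n)%N -> t k < t l.
Hypothesis G_unit : G \in unitmx.

Let Kpsd : psd Kn. Proof. exact: kmx_psd. Qed.
Let Kunit : Kn \in unitmx. Proof. exact: kmx_unit. Qed.

Let KiE : Ki = kmx n.-1 (fun k => t (bump i k)) theta.
Proof. by rewrite /loo_corr_mx -loo_kmx. Qed.

Lemma loo_corr_psd : psd Ki.
Proof. by rewrite KiE; apply: kmx_psd => // k l; exact: bump_lt. Qed.

Lemma loo_corr_unit : Ki \in unitmx.
Proof. by rewrite KiE; apply: kmx_unit => // k l; exact: bump_lt. Qed.

Lemma loo_gram_psd : psd G.
Proof.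
split=> [|x].
  by rewrite /loo_gram_mx !trmx_mul trmxK tr_invmx_psd ?mulmxA//; exact: loo_corr_psd.
have -> : quad G x = quad (invmx Ki) (Fi *m x).
  by rewrite /quad trmx_mul !mulmxA.
by case: (psd_invmx loo_corr_psd loo_corr_unit) => _; exact.
Qed.

Let Jmul m (x : 'M[R]_(n, m)) : J *m x = row' i x.
Proof. by rewrite /J mul_rowsub_mx mul1mx. Qed.

Let wJ : wvec n t theta i = col' i (wvec n t theta i) *m J.
Proof.
apply/rowP => k; rewrite [RHS]mxE.
have [j ->|->] := unliftP i k; last first.
  rewrite wvec_diag big1// => j _; rewrite !mxE [lift _ _ == _]eq_sym (negPf (neq_lift _ _)).
  by rewrite mulr0.
rewrite (bigD1 j)//= big1 ?addr0 => [|l lj]; rewrite !mxE.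
  by rewrite eqxx mulr1.
by rewrite (inj_eq lift_inj) (negPf lj) mulr0.
Qed.

Let JKJ : J *m Kn *m J^T = Ki.
Proof.
rewrite Jmul; apply/matrixP => j k; rewrite !mxE (bigD1 (lift i k))//=.
rewrite big1 ?addr0 => [|l lk]; rewrite !mxE ?eqxx ?mulr1//.
by rewrite eq_sym (negPf lk) mulr0.
Qed.

Lemma loo_predE (z : 'cV[R]_n) :
  loo_pred f s theta i z - z i 0 = - (ecoef *m z) 0 0.
Proof.
rewrite /loo_pred; set b := loo_beta _ _ _ _ _.
have -> : (loo_corr_vec s theta i)^T *m invmx Ki = col' i (wvec n t theta i).
  have -> : (loo_corr_vec s theta i)^T = col' i (row i Kn).
    by apply/rowP => k; rewrite !mxE.
  by rewrite -wvec_loo// mulmxK// ?loo_corr_unit.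
have bE : b = bmx *m z by rewrite /b /loo_beta /bmx -[RHS]mulmxA Jmul.
clearbody b.
have FiE : Fi = J *m F by rewrite Jmul.
rewrite mulmxBr -Jmul FiE !mulmxA -!wJ.
rewrite /ecoef mulmxBl -(mulmxA gvec) -bE /gvec /kvec !mulmxBl -!rowE.
have D (u v : 'M[R]_1) : (u + v) 0 0 = u 0 0 + v 0 0 by rewrite mxE.
have N (u : 'M[R]_1) : (- u) 0 0 = - u 0 0 by rewrite mxE.
have zE : row i z 0 0 = z i 0 by rewrite mxE.
by rewrite !(D, N) zE; ring.
Qed.

(** Unbiasedness: generalized least squares recovers exactly the coefficients of noiseless data.
    This removes [beta] from the error. *)
Lemma ecoef_design : ecoef *m F = 0.
Proof.
have FiE : Fi = J *m F by rewrite Jmul.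
have bF : bmx *m F = 1%:M.
  rewrite /bmx -[LHS]mulmxA -FiE -!(mulmxA (invmx G)).
  by rewrite -[_ *m Fi]/G mulVmx.
by rewrite /ecoef mulmxBl -mulmxA bF mulmx1 subrr.
Qed.

Lemma loo_pred_observations (beta : 'cV[R]_p) (y : R -> R) :
  let z := observations f s beta y in
  loo_pred f s theta i z - z i 0 = - (ecoef *m vecn n (y \o t)) 0 0.
Proof.
move=> z; rewrite loo_predE.
have -> : z = F *m beta + vecn n (y \o t).
  apply/colP => j; rewrite !mxE; congr (_ + _).
  by apply: eq_bigr => k _; rewrite mxE mulrC.
by rewrite mulmxDr mulmxA ecoef_design mul0mx add0r.
Qed.

(** The known-mean error is uncorrelated with the data other than [i], and [bmx] only uses those, so
    the cross terms vanish. The estimated coefficients have covariance [invmx G]. *)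
Lemma ecoef_var : (ecoef *m Kn *m ecoef^T) 0 0 = kvar n t theta i + gam.
Proof.
have kvJ : J *m (delta_mx i 0 : 'cV[R]_n) = 0.
  rewrite Jmul; apply/colP => k; rewrite !mxE eq_sym.
  by rewrite (negPf (neq_lift _ _)).
have kK := kvec_kmx theta_gt0 t_lt i.
have bk : bmx *m Kn *m (kvec t theta i)^T = 0.
  have -> : bmx *m Kn *m (kvec t theta i)^T =
            bmx *m (kvec t theta i *m Kn)^T.
    by rewrite trmx_mul (tr_psd Kpsd) mulmxA.
  rewrite kK linearZ/= trmx_delta -scalemxAr /bmx.
  by rewrite -[_ *m J *m _]mulmxA kvJ mulmx0 scaler0.
have bb : bmx *m Kn *m bmx^T = invmx G.
  rewrite /bmx !trmx_mul trmxK (tr_invmx_psd loo_corr_psd).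
  rewrite (tr_invmx_psd loo_gram_psd) -!mulmxA (mulmxA J) (mulmxA (J *m _)).
  rewrite JKJ (mulmxA (invmx Ki) Ki) mulVmx ?loo_corr_unit// mul1mx.
  by rewrite (mulmxA (invmx Ki)) (mulmxA Fi^T) (mulmxA Fi^T) -/G mulmxV ?mulmx1.
have -> : gam = (gvec *m invmx G *m gvec^T) 0 0 by rewrite /gam /quad trmxK.
have kk : (kvec t theta i *m Kn *m (kvec t theta i)^T) 0 0 = kvar n t theta i.
  by rewrite kvec_cov// eqxx mul1r.
rewrite /ecoef; move: bk bb kk; move: bmx gvec (kvec t theta i) => b g k bk bb kk.
rewrite linearB/= mulmxBl mulmxBl mulmxBr mulmxBr.
have -> : g *m b *m Kn *m k^T = 0 by rewrite -!mulmxA (mulmxA b) bk mulmx0.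
have -> : k *m Kn *m (g *m b)^T = 0.
  apply: trmx_inj; rewrite !trmx_mul !trmxK (tr_psd Kpsd) trmx0.
  by rewrite -!mulmxA (mulmxA b) bk mulmx0.
have -> : g *m b *m Kn *m (g *m b)^T = g *m invmx G *m g^T.
  by rewrite trmx_mul -!mulmxA (mulmxA b) (mulmxA (b *m Kn)) bb.
by rewrite subr0 sub0r opprK [LHS]mxE kk.
Qed.

Lemma gam_ge0 : 0 <= gam.
Proof. by case: (psd_invmx loo_gram_psd G_unit) => _; exact. Qed.

(* [F_i b] is the orthogonal projection of [y] for the inner product given by
   [K_i^-1], so its norm is at most that of [y]. *)
Lemma mean_correction_le (y : nat -> R) :
  ((gvec *m bmx *m vecn n y) 0 0) ^+ 2 <= gam * rkhs n t theta y.
Proof.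
set yi : 'cV[R]_n.-1 := row' i (vecn n y).
pose b := invmx G *m Fi^T *m invmx Ki *m yi.
have bE : bmx *m vecn n y = b by rewrite /bmx -[LHS]mulmxA Jmul.
have Gb : G *m b = Fi^T *m invmx Ki *m yi.
  by rewrite /b -!(mulmxA (invmx G)) mulKVmx.
clearbody b.
have -> : gvec *m bmx *m vecn n y = (b^T *m gvec^T)^T.
  by rewrite trmx_mul !trmxK -mulmxA bE.
rewrite mxE; apply: le_trans (cauchy_schwarz_invmx _ _ loo_gram_psd G_unit) _.
rewrite mulrC ler_wpM2l ?gam_ge0//.
have Kipsd := loo_corr_psd; have Kiu := loo_corr_unit.
apply: (@le_trans _ _ (quad (invmx Ki) yi)); last first.
  rewrite -quad_kmx//.
  exact: (@quad_invmx_row' _ _ _ i (vecn n y) Kpsd Kunit Kiu Kipsd).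
have GE : quad G b = quad (invmx Ki) (Fi *m b).
  by rewrite /quad trmx_mul !mulmxA.
have := psd_cauchy_schwarz (Fi *m b) yi (psd_invmx Kipsd Kiu).
have -> : ((Fi *m b)^T *m invmx Ki *m yi) 0 0 = quad G b.
  by rewrite /quad -[b^T *m G *m b]mulmxA Gb trmx_mul !mulmxA.
rewrite -GE.
have [->|bN0] := eqVneq (quad G b) 0.
  by move=> _; case: (psd_invmx Kipsd Kiu) => _; exact.
have b_gt0 : 0 < quad G b by rewrite lt_def bN0; case: loo_gram_psd => _; exact.
by rewrite expr2 ler_pM2l.
Qed.

(** With [a = G^-1 g], [gam] is both [g . a] and [quad G a >= kappa |a|^2]. Hence [2 kappa gam <=
    |g|^2 + kappa^2 |a|^2 <= |g|^2 + kappa gam]. *)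
Lemma gam_le (kappa c : R) : 0 < kappa ->
  (forall v : 'cV[R]_p, kappa * \sum_k v k 0 ^+ 2 <= quad G v) ->
  (forall k, gvec 0 k ^+ 2 <= c) -> gam <= p%:R * c / kappa.
Proof.
move=> kappa_gt0 Hk gc; set a := invmx G *m gvec^T.
have gamE : gam = quad G a by rewrite /gam quad_invmx//; exact: loo_gram_psd.
have gaE : gam = \sum_k gvec 0 k * a k 0.
  by rewrite /gam /quad trmxK -mulmxA mxE.
have g2 : \sum_k gvec 0 k ^+ 2 <= p%:R * c.
  apply: le_trans (ler_sum _ (fun k _ => gc k)) _.
  by rewrite sumr_const card_ord mulr_natl.
rewrite ler_pdivlMr//.
have := Hk a; rewrite -gamE => ka.
have : gam * 2 * kappa <= \sum_k gvec 0 k ^+ 2 + kappa * (kappa * \sum_k a k 0 ^+ 2).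
  rewrite gaE mulrA !mulr_suml mulr_sumr -big_split/=; apply: ler_sum => k _.
  have := sqr_ge0 (gvec 0 k - kappa * a k 0); nra.
have := ler_wpM2l (ltW kappa_gt0) ka; nra.
Qed.

End LeaveOneOutError.

(** * Expectations under the model *)

Section QuadraticExpectation.
Local Open Scope ereal_scope.
Context (R : realType) (d : measure_display) (T : measurableType d)
  (P : probability T R) (Y : R -> {RV P >-> R}) (C : R -> R -> R).
Hypothesis Y_cov : centered_with_cov01 Y C.

Let cov_integral t u : (t \in `[0%R, 1%R])%R -> (u \in `[0%R, 1%R])%R ->
  \int[P]_w (Y t w * Y u w)%:E = (C t u)%:E.
Proof.
move=> t01 u01; case: Y_cov => EY /(_ _ _ t01 u01) <-.
rewrite [in RHS]unlock !EY// [in RHS]unlock.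
apply: eq_integral => w _; congr EFin.
by change (Y t w * Y u w = (Y t w - 0) * (Y u w - 0))%R; rewrite !subr0.
Qed.

Lemma integrable_mul_process t u :
  (t \in `[0%R, 1%R])%R -> (u \in `[0%R, 1%R])%R ->
  P.-integrable setT (fun w => (Y t w * Y u w)%:E).
Proof.
have sq x : (x \in `[0%R, 1%R])%R ->
    P.-integrable setT (fun w => (Y x w * Y x w)%:E).
  move=> x01; apply/integrableP; split.
    by apply/measurable_EFinP; exact: measurable_funM.
  under eq_integral => w _ do rewrite gee0_abs ?lee_fin -?expr2 ?sqr_ge0// expr2.
  by rewrite cov_integral// ltry.
move=> t01 u01; apply: (le_integrable _ _ _ (integrableD _ (sq t t01) (sq u u01))) => //.
  by apply/measurable_EFinP; exact: measurable_funM.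
move=> w _ /=; rewrite lee_fin.
rewrite (@ger0_norm _ (_ + _)%R); last by rewrite addr_ge0// -expr2 sqr_ge0.
rewrite ler_norml; apply/andP; split.
  by have := sqr_ge0 (Y t w + Y u w)%R; nra.
by have := sqr_ge0 (Y t w - Y u w)%R; nra.
Qed.

Lemma integrable_process t : (t \in `[0%R, 1%R])%R ->
  P.-integrable setT (EFin \o Y t).
Proof.
move=> t01; have i1 : P.-integrable setT (EFin \o cst (1 : R)%R : T -> \bar R).
  exact: finite_measure_integrable_cst.
apply: (le_integrable _ _ _ (integrableD _ i1 (integrable_mul_process t01 t01))) => //.
  exact/measurable_EFinP.
move=> w _ /=; rewrite lee_fin.
rewrite (@ger0_norm _ (_ + _)%R); last by rewrite addr_ge0// -expr2 sqr_ge0.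
rewrite ler_norml; apply/andP; split.
  by have := sqr_ge0 (Y t w + 1)%R; have := sqr_ge0 (Y t w); nra.
by have := sqr_ge0 (Y t w - 1)%R; have := sqr_ge0 (Y t w); nra.
Qed.

Lemma expectation_quadratic k (t c : 'I_k -> R) :
  (forall j, t j \in `[0%R, 1%R])%R ->
  P.-integrable setT (fun w => ((\sum_j c j * Y (t j) w) ^+ 2)%:E) /\
  \int[P]_w ((\sum_j c j * Y (t j) w) ^+ 2)%:E =
  (\sum_i \sum_j c i * c j * C (t i) (t j))%:E.
Proof.
move=> t01.
have E w : ((\sum_j c j * Y (t j) w) ^+ 2)%:E =
    \sum_i \sum_j (c i * c j)%:E * (Y (t i) w * Y (t j) w)%:E.
  rewrite expr2 mulr_suml -sumEFin; apply: eq_bigr => i _.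
  rewrite mulr_sumr -sumEFin; apply: eq_bigr => j _.
  by rewrite -EFinM; congr EFin; ring.
have int i j : P.-integrable setT
    (fun w => (c i * c j)%:E * (Y (t i) w * Y (t j) w)%:E).
  exact/integrableZl/integrable_mul_process.
have int1 i : P.-integrable setT
    (fun w => \sum_j (c i * c j)%:E * (Y (t i) w * Y (t j) w)%:E).
  by apply: integrable_sum => // j _.
split.
  apply: (eq_integrable _ (fun w =>
    \sum_i \sum_j (c i * c j)%:E * (Y (t i) w * Y (t j) w)%:E)) => //.
  by apply: integrable_sum => // i _.
under eq_integral => w _ do rewrite E.
rewrite integral_sum//= -sumEFin; apply: eq_bigr => i _.
rewrite integral_sum//= -sumEFin; apply: eq_bigr => j _.
rewrite integralZl//; first by rewrite cov_integral// EFinM.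
exact: integrable_mul_process.
Qed.

Lemma expectation_linear k (t c : 'I_k -> R) :
  (forall j, t j \in `[0%R, 1%R])%R ->
  P.-integrable setT (fun w => (\sum_j c j * Y (t j) w)%:E) /\
  \int[P]_w (\sum_j c j * Y (t j) w)%:E = 0.
Proof.
move=> t01.
have E w : (\sum_j c j * Y (t j) w)%:E = \sum_i (c i)%:E * (Y (t i) w)%:E.
  by rewrite -sumEFin; apply: eq_bigr => i _; rewrite EFinM.
have int i : P.-integrable setT (fun w => (c i)%:E * (Y (t i) w)%:E).
  exact/integrableZl/integrable_process.
split.
  apply: (eq_integrable _ (fun w => \sum_i (c i)%:E * (Y (t i) w)%:E)) => //.
  by apply: integrable_sum => // i _.
under eq_integral => w _ do rewrite E.
rewrite integral_sum//= big1// => i _.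
rewrite integralZl//; last exact: integrable_process.
by case: Y_cov => EY _; have := EY _ (t01 i); rewrite unlock => ->; rewrite mule0.
Qed.

End QuadraticExpectation.

(** * A concrete process with exponential covariance *)

Section ExponentialCovarianceProcess.
Context {R : realType} (theta sigma2 : R).

Let c t : R := expR (- (2 * theta * (1 - t))).

(* A martingale time-changed to have variance [expR (2 * theta * t)], rescaled
   to be stationary, and made odd so as to be centered. *)
Definition exp_process (t : R) (x : measurableTypeR R) : R :=
  Num.sqrt sigma2 * expR (theta * (1 - t)) *
    (\1_`[0, c t] x - \1_`[- c t, 0[ x).

Lemma measurable_exp_process t : measurable_fun setT (exp_process t).
Proof.
apply: measurable_funM => //; apply: measurable_funB.
- exact: measurable_indic.
- exact: measurable_indic.
Qed.

Let lt_m11 : (-1 : R) < 1. Proof. by rewrite (@lt_trans _ _ 0)// ?ltrN10. Qed.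

Definition exp_space : probability (measurableTypeR R) R := uniform_prob lt_m11.

Definition exp_rv (t : R) : {RV exp_space >-> R} :=
  HB.pack_for {RV exp_space >-> R} (exp_process t)
    (isMeasurableFun.Build _ _ (measurableTypeR R) R (exp_process t)
      (measurable_exp_process t)).

Lemma uniform_prob_itv (x y : R) b1 b2 : -1 <= x -> x <= y -> y <= 1 ->
  exp_space [set` Interval (BSide b1 x) (BSide b2 y)] = ((y - x) / 2)%:E.
Proof.
move=> x1 xy y1; rewrite /exp_space /=.
set A := [set` _].
have mA : measurable A by exact: measurable_itv.
have -> : uniform_prob lt_m11 A = (\int[uniform_prob lt_m11]_z (\1_A z)%:E)%E.
  by rewrite integral_indic// setIT.
rewrite integral_uniform; [|exact/measurable_EFinP/measurable_indic|by []].
rewrite integral_indic//.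
have -> : A `&` `[-1, 1] = A.
  apply/setIidl => z; rewrite /A /= !in_itv/= => /andP[xz zy].
  have {}xz : x <= z by case: b1 @A mA xz => // A mA; exact: ltW.
  have {}zy : z <= y by case: b2 @A mA zy => // A mA; exact: ltW.
  by rewrite (le_trans x1 xz) (le_trans zy y1).
transitivity (((1 - -1)^-1)%:E * (y - x)%:E)%E; last first.
  by rewrite -EFinM; congr EFin; field.
congr (_ * _)%E; apply: etrans (lebesgue_measure_itv _) _ => /=.
rewrite lte_fin; case: ifPn => [_|]; first by rewrite -EFinD.
rewrite -leNgt => yx; have -> : y = x by apply/eqP; rewrite eq_le yx xy.
by rewrite subrr.
Qed.

Let A t : set (measurableTypeR R) := `[0, c t].
Let B t : set (measurableTypeR R) := `[- c t, 0[.

Let mA t : measurable (A t). Proof. exact: measurable_itv. Qed.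
Let mB t : measurable (B t). Proof. exact: measurable_itv. Qed.

Hypothesis theta_gt0 : 0 < theta.
Hypothesis sigma2_gt0 : 0 < sigma2.

Let c01 t : t \in `[0, 1] -> 0 < c t <= 1.
Proof.
rewrite in_itv/= => /andP[t0 t1]; rewrite expR_gt0/= -(@expR0 R) ler_expR.
by rewrite oppr_le0 mulr_ge0// ?subr_ge0// mulr_ge0// ltW.
Qed.

Let PA t : t \in `[0, 1] -> exp_space (A t) = (c t / 2)%:E.
Proof.
move=> /c01/andP[c0 c1]; rewrite /A uniform_prob_itv ?subr0 ?lerN10 ?(ltW c0)//.
Qed.

Let PB t : t \in `[0, 1] -> exp_space (B t) = (c t / 2)%:E.
Proof.
move=> /c01/andP[c0 c1]; rewrite /B uniform_prob_itv ?sub0r ?opprK//.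
- by rewrite lerN2.
- by rewrite oppr_le0 ltW.
Qed.

Lemma expectation_exp_rv t : t \in `[0, 1] -> ('E_exp_space[exp_rv t] = 0%:E)%E.
Proof.
move=> t01; rewrite unlock /= /exp_process.
have iE (E : set (measurableTypeR R)) : measurable E ->
  exp_space.-integrable setT (EFin \o \1_E) by move=> mE; exact: integrable_indic.
under eq_integral => w _ do rewrite EFinM EFinB.
rewrite integralZl//; last by apply: integrableB => //; exact: iE.
rewrite integralB//; try exact: iE.
rewrite !integral_indic// !setIT.
transitivity ((Num.sqrt sigma2 * expR (theta * (1 - t)))%:E *
  (exp_space (A t) - exp_space (B t)))%E => //.
by rewrite PA// PB// -EFinB subrr mule0.
Qed.

(** The intervals grow with [t], so for [t <= u] the product of the two variables is a constant
    times the indicator of [A t] and [B t] together, an event of probability [c t]. *)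
Lemma covariance_exp_rv t u : t \in `[0, 1] -> u \in `[0, 1] ->
  covariance exp_space (exp_rv t) (exp_rv u) = (exp_cov theta sigma2 t u)%:E.
Proof.
wlog tu : t u / t <= u => [H t01 u01|t01 u01].
  have [tu|/ltW ut] := leP t u; first exact: H.
  by rewrite covarianceC H// /exp_cov distrC.
have ctu : c t <= c u by rewrite ler_expR lerN2 ler_pM2l ?mulr_gt0// lerB.
have AA x : \1_(A t) x * \1_(A u) x = \1_(A t) x :> R.
  rewrite !indicE; case: (boolP (x \in A t)); rewrite ?mul0r// mul1r inE => xA.
  rewrite mem_set//; move: xA; rewrite /A /= !in_itv/= => /andP[-> /le_trans->//].
have BB x : \1_(B t) x * \1_(B u) x = \1_(B t) x :> R.
  rewrite !indicE; case: (boolP (x \in B t)); rewrite ?mul0r// mul1r inE => xA.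
  rewrite mem_set//; move: xA; rewrite /B /= !in_itv/= => /andP[/(le_trans _)->//].
  by rewrite lerN2.
have AB a b x : \1_(A a) x * \1_(B b) x = 0 :> R.
  rewrite !indicE; case: (boolP (x \in A a)); rewrite ?mul0r// mul1r inE => xA.
  rewrite memNset//; move: xA; rewrite /A /B /= !in_itv/= => /andP[x0 _].
  by rewrite [x < 0]ltNge x0 andbF.
have iE (E : set (measurableTypeR R)) : measurable E ->
  exp_space.-integrable setT (EFin \o \1_E) by move=> mE; exact: integrable_indic.
rewrite unlock !expectation_exp_rv// unlock /=.
pose k := sigma2 * expR (theta * (1 - t)) * expR (theta * (1 - u)).
transitivity (\int[exp_space]_w (k%:E * ((\1_(A t) w)%:E + (\1_(B t) w)%:E)))%E.
  apply: eq_integral => w _; rewrite -EFinD -EFinM; congr EFin.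
  change ((exp_process t w - 0) * (exp_process u w - 0) =
    k * (\1_(A t) w + \1_(B t) w)); rewrite !subr0 /exp_process /k.
  rewrite -[in RHS]AA -[in RHS]BB.
  have := AB t u w; have := AB u t w; have := sqr_sqrtr (ltW sigma2_gt0).
    rewrite -/(A t) -/(B t) -/(A u) -/(B u).
  set a := \1_(A t) w; set b := \1_(B t) w.
  set a' := \1_(A u) w; set b' := \1_(B u) w.
  set q := Num.sqrt _; set x := expR _; set y := expR _ => <- h1 h2.
  transitivity (q ^+ 2 * x * y * (a * a' + b * b' - a * b' - a' * b)); first ring.
  by rewrite h1 h2 !subr0.
rewrite integralZl//; last by apply: integrableD => //; exact: iE.
rewrite integralD//; try exact: iE.
rewrite !integral_indic// !setIT.
transitivity (k%:E * (exp_space (A t) + exp_space (B t)))%E => //.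
rewrite PA// PB// -EFinD -EFinM; congr EFin.
rewrite /exp_cov ler0_norm ?subr_le0// /k /c -splitr -!mulrA -!expRD.
by congr (_ * expR _); ring.
Qed.

Lemma exp_rv_centered_with_cov01 :
  centered_with_cov01 exp_rv (exp_cov theta sigma2).
Proof.
split=> [t t01|t u t01 u01]; first exact: expectation_exp_rv.
exact: covariance_exp_rv.
Qed.

End ExponentialCovarianceProcess.

Lemma model_expectation_quadratic (R : realType) (theta sigma2 : R) n
    (t : 'I_n -> R) (c : 'rV[R]_n) (g : (R -> R) -> R) :
  0 < theta -> 0 < sigma2 -> (forall j, t j \in `[0, 1]) ->
  (forall y, g y = ((c *m \col_j y (t j)) 0 0) ^+ 2) ->
  model_expectation theta sigma2 g =
  sigma2 * (c *m corr_mx t theta *m c^T) 0 0.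
Proof.
move=> theta_gt0 sigma2_gt0 t01 gE.
set v := RHS.
have H : is_model_expectation theta sigma2 g v.
  move=> d T P Y Ycov; rewrite unlock.
  have gE' w : g (fun x => Y x w) = (\sum_j c 0 j * Y (t j) w) ^+ 2.
    by rewrite gE mxE; congr (_ ^+ 2); apply: eq_bigr => j _; rewrite mxE.
  under eq_integral => w _ do rewrite gE'.
  rewrite (expectation_quadratic Ycov (fun j => c 0 j) t01).2; congr EFin.
  rewrite /v mxE mulr_sumr exchange_big/=; apply: eq_bigr => i _.
  rewrite mxE mulr_suml mulr_sumr; apply: eq_bigr => j _.
  by rewrite !mxE /exp_cov; ring.
(* If no process had this covariance, every real number would be a model expectation. The process
   [exp_rv] forces uniqueness. *)
apply: xget_unique => // v' Hv'.
have := Hv' _ _ _ _ (exp_rv_centered_with_cov01 theta_gt0 sigma2_gt0).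
by rewrite (H _ _ _ _ (exp_rv_centered_with_cov01 theta_gt0 sigma2_gt0)) => -[].
Qed.

(** * Gaussian laws *)

Section Density.
Local Open Scope ereal_scope.
Context d (T : measurableType d) (R : realType)
  (mu nu : {measure set T -> \bar R}) (g : T -> R).
Hypothesis mg : measurable_fun setT g.
Hypothesis g_ge0 : forall x, (0 <= g x)%R.
Hypothesis nuE : forall A, measurable A -> nu A = \int[mu]_(x in A) (g x)%:E.

Let integral_density_indic A : measurable A ->
  \int[nu]_x (\1_A x)%:E = \int[mu]_x ((\1_A x)%:E * (g x)%:E).
Proof.
move=> mA; rewrite integral_indic// setIT nuE// integral_mkcond.
apply: eq_integral => x _; rewrite patchE indicE.
by case: (x \in A); rewrite ?mul1e ?mul0e.
Qed.

Import HBNNSimple.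

Let integral_density_nnsfun (f : {nnsfun T >-> R}) :
  \int[nu]_x (f x)%:E = \int[mu]_x ((f x)%:E * (g x)%:E).
Proof.
under [LHS]eq_integral do rewrite fimfunE -fsumEFin//.
rewrite [LHS]ge0_integral_fsum//; last 2 first.
  - by move=> r; exact/measurable_EFinP/measurableT_comp.
  - by move=> n x _; rewrite EFinM nnfun_muleindic_ge0.
under [RHS]eq_integral.
  move=> x xD; rewrite fimfunE -fsumEFin// ge0_mule_fsuml; last first.
    by move=> r; rewrite EFinM nnfun_muleindic_ge0.
  over.
rewrite [RHS]ge0_integral_fsum//; last 2 first.
  - move=> r; apply: emeasurable_funM; last exact/measurable_EFinP.
    exact/measurable_EFinP/measurableT_comp.
  - by move=> r x _; rewrite mule_ge0 ?lee_fin// -lee_fin EFinM nnfun_muleindic_ge0.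
apply: eq_fsbigr => r _.
under eq_integral => x _ do rewrite EFinM.
under [RHS]eq_integral => x _ do rewrite EFinM -muleA.
have mi : measurable (f @^-1` [set r]) by exact: measurable_sfunP.
have [r0|r_lt0] := leP 0%R r.
  have m1 : measurable_fun setT (fun x => (\1_(f @^-1` [set r]) x : R)%:E).
    exact/measurable_EFinP/measurable_indic.
  have m2 : measurable_fun setT (fun x => (\1_(f @^-1` [set r]) x : R)%:E * (g x)%:E).
    by apply: emeasurable_funM => //; exact/measurable_EFinP.
  have p1 x : [set: T] x -> 0 <= (\1_(f @^-1` [set r]) x : R)%:E by rewrite lee_fin.
  have p2 x : [set: T] x -> 0 <= (\1_(f @^-1` [set r]) x : R)%:E * (g x)%:E.
    by rewrite mule_ge0 ?lee_fin.
  by rewrite (ge0_integralZl _ _ m1)// (ge0_integralZl _ _ m2)//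
    integral_density_indic.
have f0 x : \1_(f @^-1` [set r]) x = 0%R :> R.
  rewrite indicE memNset// => /= fx.
  by have : (0 <= f x)%R by []; rewrite fx leNgt r_lt0.
rewrite !integral0_eq// => x _; rewrite f0.
  by rewrite mul0e mule0.
by rewrite mule0.
Qed.

Lemma ge0_integral_density (f : T -> \bar R) :
  measurable_fun setT f -> (forall x, 0 <= f x) ->
  \int[nu]_x f x = \int[mu]_x (f x * (g x)%:E).
Proof.
move=> mf f0; pose f_ := nnsfun_approx measurableT mf.
transitivity (lim (\int[nu]_x (f_ n x)%:E @[n --> \oo])).
  rewrite -monotone_convergence//=.
  - apply: eq_integral => ? /[!inE] xD; apply/esym/cvg_lim => //=.
    exact: cvg_nnsfun_approx.
  - by move=> n; exact/measurable_EFinP/measurable_funTS.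
  - by move=> n ? _; rewrite lee_fin.
  - by move=> ? _ ? ? mn; rewrite lee_fin; exact/lefP/nd_nnsfun_approx.
transitivity (lim (\int[mu]_x ((f_ n x)%:E * (g x)%:E) @[n --> \oo])).
  by apply: congr_lim; apply/funext => n; exact: integral_density_nnsfun.
rewrite -monotone_convergence//=.
- apply: eq_integral => x _; apply/cvg_lim => //=.
  apply: cvgeZr => //; exact: cvg_nnsfun_approx.
- by move=> n; apply: emeasurable_funM; apply/measurable_EFinP.
- by move=> n ? _; rewrite mule_ge0// lee_fin.
- move=> x _ m n mn; rewrite lee_wpmul2r ?lee_fin//.
  exact/lefP/nd_nnsfun_approx.
Qed.

End Density.

(** * Exponential integrals against normal densities *)

Section NormalMoments.
Context {R : realType}.
Notation mu := (@lebesgue_measure R).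

Lemma integral_expR_normal_pdf (m s a : R) : s != 0 ->
  (\int[mu]_x ((expR (a * x))%:E * (normal_pdf m s x)%:E) =
  (expR (a * m + a ^+ 2 * s ^+ 2 / 2))%:E)%E.
Proof.
move=> s0.
transitivity (\int[mu]_x ((expR (a * m + a ^+ 2 * s ^+ 2 / 2))%:E *
    (normal_pdf (m + a * s ^+ 2) s x)%:E))%E.
  apply: eq_integral => x _; rewrite -!EFinM /normal_pdf (negPf s0) /normal_fun.
  congr EFin; rewrite mulrCA [RHS]mulrCA -!expRD; congr (_ * expR _).
  rewrite -mulr_natr; field.
  by rewrite s0.
rewrite integralZl//; last exact: integrable_normal_pdf.
by rewrite integral_normal_pdf mule1.
Qed.

(** The integrand is a multiple of the density of the centered normal law of variance
    [2 * l / (1 - 2 * l)]. *)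
Lemma integral_expR_sqr_normal_pdf (l : R) : 0 < l -> l < 1 / 2 ->
  (\int[mu]_x ((expR (x ^+ 2 / 2))%:E * (normal_pdf 0 (Num.sqrt (2 * l)) x)%:E) =
  ((Num.sqrt (1 - 2 * l))^-1)%:E)%E.
Proof.
move=> l0 l1; set s := Num.sqrt (2 * l).
have s2 : s ^+ 2 = 2 * l by rewrite sqr_sqrtr// mulr_ge0// ltW.
have s0 : s != 0 by rewrite gt_eqF// sqrtr_gt0 mulr_gt0.
have l2 : 0 < 1 - 2 * l by lra.
pose s' := s / Num.sqrt (1 - 2 * l).
have q0 : Num.sqrt (1 - 2 * l) != 0 by rewrite gt_eqF// sqrtr_gt0.
have q2 : Num.sqrt (1 - 2 * l) ^+ 2 = 1 - 2 * l by rewrite sqr_sqrtr// ltW.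
have s'0 : s' != 0 by rewrite mulf_neq0// invr_eq0.
transitivity (\int[mu]_x (((Num.sqrt (1 - 2 * l))^-1)%:E *
    (normal_pdf 0 s' x)%:E))%E.
  apply: eq_integral => x _; rewrite -!EFinM /normal_pdf (negPf s0) (negPf s'0) /normal_fun.
  congr EFin; rewrite mulrCA -expRD mulrA; congr (_ * expR _).
    rewrite /normal_peak /s' exprMn exprVn q2 -invfM; congr (_^-1).
    have -> : s ^+ 2 * pi *+ 2 = (1 - 2 * l) * (s ^+ 2 / (1 - 2 * l) * pi *+ 2).
      move: (pi : R) => c; rewrite mulrnAr; congr (_ *+ 2); field.
      by rewrite gt_eqF.
    by rewrite (sqrtrM _ (ltW l2)).
  rewrite /s' exprMn exprVn q2 s2 subr0 -mulr_natr; field.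
  by rewrite !gt_eqF.
rewrite integralZl//; last exact: integrable_normal_pdf.
by rewrite integral_normal_pdf mule1.
Qed.

End NormalMoments.

(** * Elementary bounds for hyperbolic functions *)

Section ExponentialInequalities.
Context {R : realType}.
Implicit Types x y a : R.

Lemma le_of_deriv_ge0 (h h' : R -> R) (b : R) :
  (forall x, 0 <= x <= b -> is_derive x 1 h (h' x)) ->
  (forall x, 0 <= x <= b -> 0 <= h' x) ->
  0 <= b -> h 0 <= h b.
Proof.
move=> dh h'0; rewrite le_eqVlt => /predU1P[<-//|b0].
rewrite -subr_ge0; have [||c cb ->] := @MVT R h h' 0 b b0.
- move=> x; rewrite in_itv/= => /andP[/ltW x0 /ltW xb].
  by apply: dh; rewrite x0.
- apply: derivable_within_continuous => x; rewrite in_itv/= => xb.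
  by have [] := dh x xb.
- rewrite mulr_ge0//; last by rewrite subr0 ltW.
  by rewrite h'0//; move: cb; rewrite in_itv/= => /andP[/ltW-> /ltW->].
Qed.

Lemma is_derive_mull a x : is_derive x 1 ( *%R a) a.
Proof.
have := @is_deriveZ R R R id a x 1 1 (is_derive_id x 1).
by rewrite /GRing.scale /= mulr1.
Qed.

Lemma is_derive_expRM a x :
  is_derive x 1 (fun y => expR (a * y)) (a * expR (a * x)).
Proof.
have := @is_derive1_comp _ expR ( *%R a) x _ _ (is_derive_expR _)
  (is_derive_mull a x).
by rewrite mulrC.
Qed.

Lemma is_derive_cubic (a b c x : R) :
  is_derive x 1 (fun y => a * y + b * y ^+ 2 + c * y ^+ 3)
    (a + 2 * b * x + 3 * c * x ^+ 2).
Proof.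
have h1 := is_derive_id x (1 : R).
have h2 := @is_deriveZ R R R _ b x 1 _ (is_deriveX 2 h1).
have h3 := @is_deriveZ R R R _ c x 1 _ (is_deriveX 3 h1).
have := is_deriveD (is_deriveD (is_derive_mull a x) h2) h3.
rewrite /GRing.scale /=.
set v := (X in is_derive _ _ _ X -> _); set w := (X in _ -> is_derive _ _ _ X).
by have -> : v = w by rewrite /v /w; ring.
Qed.

Lemma sinh_ge x : 0 <= x -> 2 * x <= expR x - expR (- x).
Proof.
move=> x0; rewrite -subr_ge0.
pose h y := expR (1 * y) - expR (-1 * y) - 2 * y.
pose h' y := 1 * expR (1 * y) - -1 * expR (-1 * y) - 2 : R.
have -> : expR x - expR (- x) - 2 * x = h x by rewrite /h mul1r mulN1r.
have -> : 0 = h 0 by rewrite /h !mulr0 subrr subr0.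
apply: (@le_of_deriv_ge0 _ h') => //.
  move=> y _; rewrite /h /h'; apply: is_deriveB.
    by apply: is_deriveB; exact: is_derive_expRM.
  exact: is_derive_mull.
move=> y _; rewrite /h' !mul1r !mulN1r opprK.
have e0 := expR_gt0 y; rewrite expRN.
have : 0 <= (expR y - 1) ^+ 2 / expR y by rewrite divr_ge0 ?sqr_ge0// ltW.
suff -> : (expR y - 1) ^+ 2 / expR y = expR y + (expR y)^-1 - 2 by [].
by field; rewrite gt_eqF.
Qed.

Let cosh_sinh x : expR x + expR (- x) - 2 = (expR (x / 2) - expR (- (x / 2))) ^+ 2.
Proof.
have -> : expR x = expR (x / 2) ^+ 2 by rewrite -expRM_natl; congr expR; field.
have -> : expR (- x) = expR (- (x / 2)) ^+ 2 by rewrite -expRM_natl; congr expR; field.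
have : expR (x / 2) * expR (- (x / 2)) = 1 by rewrite -expRD subrr expR0.
by rewrite sqrrB => ->; ring.
Qed.

Let sinh_norm x : (expR x - expR (- x)) ^+ 2 = (expR `|x| - expR (- `|x|)) ^+ 2.
Proof. by case: (ger0P x) => // _; rewrite opprK -[RHS]sqrrN opprB. Qed.

Lemma cosh_ge x : 2 + x ^+ 2 <= expR x + expR (- x).
Proof.
rewrite -lerBrDl cosh_sinh sinh_norm.
rewrite (_ : x ^+ 2 = (2 * `|x / 2|) ^+ 2); last first.
  by rewrite exprMn real_normK ?num_real; field.
by rewrite lerXn2r ?nnegrE ?mulr_ge0 ?sinh_ge//; rewrite (le_trans _ (sinh_ge _)) ?mulr_ge0.
Qed.

Lemma cosh_le_sqr x : expR x + expR (- x) <= 2 + x ^+ 2 * expR `|x|.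
Proof.
rewrite -lerBlDl cosh_sinh sinh_norm.
have xE : `|x| = 2 * `|x / 2|.
  by rewrite normrM (@ger0_norm _ 2^-1)//; field.
have -> : x ^+ 2 * expR `|x| = (2 * `|x / 2| * expR `|x / 2|) ^+ 2.
  rewrite [in LHS]xE expRM_natl exprMn -xE; congr (_ * _).
  by rewrite real_normK ?num_real.
set y := `|x / 2|; have y0 : 0 <= y by exact: normr_ge0.
have sh0 : 0 <= expR y - expR (- y) by rewrite (le_trans _ (sinh_ge y0))// mulr_ge0.
rewrite lerXn2r ?nnegrE// ?mulr_ge0 ?expR_ge0//.
have -> : expR (- y) = expR (- (2 * y)) * expR y.
  by rewrite -expRD; congr expR; ring.
by have := expR_ge1Dx (- (2 * y)); have := expR_gt0 y; nra.
Qed.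

Let expR_norm_le x : expR `|x| <= expR x + expR (- x).
Proof.
by case: (ger0P x) => _; rewrite ?(lerDl, lerDr) expR_ge0.
Qed.

Let expR_norm_sub1 x : expR `|x| <= 1 + `|x| * expR `|x|.
Proof.
have := expR_ge1Dx (- `|x|); rewrite expRN.
have e0 := expR_gt0 `|x|.
move=> /(ler_wpM2r (ltW e0)); rewrite mulVf ?gt_eqF//; nra.
Qed.

(** A second-order Taylor bound whose remainder is [a ^+ 3] times a function of [x] alone,
    integrable under any Gaussian law. The 6 comes from [|x| ^+ 3 <= 3! * expR |x|]. *)
Lemma cosh_le a x : 0 <= a <= 1 ->
  expR (a * x) + expR (- (a * x)) <=
  2 + a ^+ 2 * x ^+ 2 + 6 * a ^+ 3 * (expR (2 * x) + expR (- (2 * x))).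
Proof.
move=> /andP[a0 a1].
apply: le_trans (cosh_le_sqr _) _.
rewrite -[leRHS]addrA lerD2l exprMn.
have n2 : x ^+ 2 = `|x| ^+ 2 by rewrite real_normK ?num_real.
have nax : `|a * x| = a * `|x| by rewrite normrM ger0_norm.
have h1 := expR_norm_sub1 (a * x).
have h2 : expR `|a * x| <= expR `|x| by rewrite ler_expR nax ler_piMl.
have h3 : `|x| ^+ 3 <= 6 * expR `|x|.
  have := expR_ge1Dxn 2 (normr_ge0 x).
  rewrite (_ : 3`!%:R = 6 :> R)//; lra.
have h4 : expR `|x| * expR `|x| <= expR (2 * x) + expR (- (2 * x)).
  rewrite -expRD (_ : `|x| + `|x| = `|2 * x|) ?expR_norm_le//.
  by rewrite normrM (@ger0_norm _ 2)//; ring.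
rewrite nax in h1 h2 *; rewrite n2; set n := `|x| in h1 h2 h3 h4 *.
have n0 : 0 <= n by exact: normr_ge0.
have a2 : 0 <= a ^+ 2 * n ^+ 2 by rewrite mulr_ge0 ?sqr_ge0.
apply: (@le_trans _ _ (a ^+ 2 * n ^+ 2 * (1 + a * n * expR n))).
  rewrite ler_wpM2l// (le_trans h1)// lerD2l ler_wpM2l// mulr_ge0//.
rewrite mulrDr mulr1 lerD2l.
have -> : a ^+ 2 * n ^+ 2 * (a * n * expR n) = a ^+ 3 * (n ^+ 3 * expR n) by ring.
set Z := (X in _ <= _ * X) in h4 *.
rewrite (_ : 6 * a ^+ 3 * Z = a ^+ 3 * (6 * Z)); last by ring.
rewrite ler_wpM2l ?exprn_ge0//; have e0 := expR_gt0 n.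
apply: le_trans (ler_wpM2r (ltW e0) h3) _.
by rewrite -mulrA ler_wpM2l.
Qed.

End ExponentialInequalities.

(** * Parameters of a Gaussian law from its first two moments *)

Section GaussianLaw.
Local Open Scope ereal_scope.
Context {R : realType} (d : measure_display) (T : measurableType d)
  (P : probability T R).

Lemma mgf_gaussian_law (X : {RV P >-> R}) (m s : R) :
  (forall A, measurable A -> P (X @^-1` A) = gaussian_law m s A) ->
  forall a : R, \int[P]_w (expR (a * X w))%:E =
    (expR (a * m + a ^+ 2 * s ^+ 2 / 2))%:E.
Proof.
move=> lawX a.
have mexp : measurable_fun setT (fun x : R => (expR (a * x))%:E).
  apply/measurable_EFinP; apply: measurableT_comp => //; exact: measurable_funM.
(* [normal_prob] lives on the Borel type [measurableTypeR R], which has the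
   same measurable sets as [R] but another display. *)
have mX : measurable_fun setT (X : T -> measurableTypeR R).
  exact: (measurable_funP X).
pose X' : {RV P >-> measurableTypeR R} :=
  HB.pack_for {RV P >-> measurableTypeR R} (X : T -> measurableTypeR R)
    (isMeasurableFun.Build _ _ T (measurableTypeR R) _ mX).
transitivity (\int[distribution P X']_x (expR (a * x))%:E).
  by rewrite (ge0_integral_distribution X' mexp).
have [s0|sN0] := eqVneq s 0%R.
  transitivity (\int[\d_(m : measurableTypeR R)]_x (expR (a * x))%:E).
    apply: eq_measure_integral => A mA _.
    by apply: etrans (lawX A mA) _; rewrite /gaussian_law s0 eqxx.
  rewrite integral_dirac// diracT mul1e s0; congr (expR _)%:E.
  by rewrite expr0n mulr0 mul0r addr0.
rewrite -integral_expR_normal_pdf//.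
have e0 (x : R) : 0 <= (expR (a * x))%:E by rewrite lee_fin expR_ge0.
have := @ge0_integral_density _ _ R lebesgue_measure (normal_prob m s) _
  (measurable_normal_pdf m s) (normal_pdf_ge0 m s) (fun _ _ => erefl) _ mexp e0.
move=> <-.
apply: eq_measure_integral => A mA _; apply: etrans (lawX A mA) _.
by rewrite /gaussian_law (negPf sN0).
Qed.

(* A Gaussian law has all exponential moments: comparing [expR (a * x)] with
   its Taylor polynomials for small [a] identifies [m] and [s]. *)
Lemma mgf_gaussian_centered (X : {RV P >-> R}) (m s v : R) :
  (forall A, measurable A -> P (X @^-1` A) = gaussian_law m s A) ->
  P.-integrable setT (EFin \o X) -> \int[P]_w (X w)%:E = 0 ->
  P.-integrable setT (fun w => (X w ^+ 2)%:E) ->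
  \int[P]_w (X w ^+ 2)%:E = v%:E ->
  \int[P]_w (expR (X w))%:E = (expR (v / 2))%:E.
Proof.
move=> lawX iX EX iX2 EX2.
have mgf := mgf_gaussian_law lawX.
have iexp (a : R) : P.-integrable setT (fun w => (expR (a * X w))%:E).
  apply/integrableP; split.
    apply/measurable_EFinP; apply: measurableT_comp => //.
    exact: measurable_funM.
  under eq_integral => w _ do rewrite gee0_abs ?lee_fin ?expR_ge0//.
  by rewrite mgf ltry.
have iexpN (a : R) : P.-integrable setT (fun w => (expR (- (a * X w)))%:E).
  rewrite (_ : (fun _ => _) = (fun w => (expR (- a * X w))%:E)) //.
  by apply/funext => w; rewrite mulNr.
have i1 (c : R) : P.-integrable setT (EFin \o cst c : T -> \bar R).
  exact: finite_measure_integrable_cst.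
have I1 (c : R) : \int[P]_w c%:E = c%:E.
  by rewrite integral_cst//= probability_setT mule1.
have s2 : (0 <= s ^+ 2)%R by exact: sqr_ge0.
have v0 : (0 <= v)%R.
  by rewrite -lee_fin -EX2; apply: integral_ge0 => w _; rewrite lee_fin sqr_ge0.
(* Integrating [1 + a * x <= expR (a * x)] shows that [a * m + a ^+ 2 * s ^+ 2 / 2] is nonnegative
   for all [a]. This fails for small [a] of sign opposite to [m]; the [+ 1] in the choice of [a]
   below covers [s = 0]. *)
have m0 : m = 0%R.
  have H (a : R) : (0 <= a * m + a ^+ 2 * s ^+ 2 / 2)%R.
    rewrite -ler_expR expR0 -lee_fin -mgf.
    have -> : 1%:E = \int[P]_w (1%:E + a%:E * (X w)%:E).
      rewrite integralD//; last 2 first.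
      - exact: i1.
      - exact: integrableZl.
      by rewrite I1 integralZl// EX mule0 adde0.
    apply: le_integral => //.
      apply: integrableD => //; first exact: i1.
      exact: integrableZl.
    by move=> w _; rewrite -EFinM -EFinD lee_fin expR_ge1Dx.
  apply/eqP; rewrite -sqrf_eq0; apply/eqP/le_anti; rewrite sqr_ge0 andbT.
  have := H (- m / (s ^+ 2 + 1))%R.
  have p : (0 < s ^+ 2 + 1)%R by rewrite ltr_wpDl.
  rewrite (_ : _ + _ = - (m ^+ 2) * ((s ^+ 2 + 2) / (2 * (s ^+ 2 + 1) ^+ 2)))%R; last first.
    by field; rewrite gt_eqF.
  rewrite mulNr oppr_ge0 pmulr_lle0// divr_gt0//.
    by rewrite ltr_wpDl.
  by rewrite mulr_gt0// exprn_gt0.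
have mgf2 (a : R) : \int[P]_w ((expR (a * X w))%:E + (expR (- (a * X w)))%:E) =
    (2 * expR (a ^+ 2 * s ^+ 2 / 2))%:E.
  rewrite integralD//.
  under [X in _ + X]eq_integral do rewrite -mulNr.
  by rewrite !mgf sqrrN m0 !mulr0 !add0r -EFinD; congr EFin; ring.
have i2 (a : R) : P.-integrable setT
    (fun w => (expR (a * X w))%:E + (expR (- (a * X w)))%:E).
  by apply: integrableD.
have lo (a : R) : (2 + a ^+ 2 * v <= 2 * expR (a ^+ 2 * s ^+ 2 / 2))%R.
  rewrite -lee_fin -mgf2.
  have -> : (2 + a ^+ 2 * v)%:E = \int[P]_w (2%:E + (a ^+ 2)%:E * (X w ^+ 2)%:E).
    rewrite integralD//; last 2 first.
    - exact: i1.
    - exact: integrableZl.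
    by rewrite I1 integralZl// EX2.
  apply: le_integral => //.
    apply: integrableD => //; first exact: i1.
    exact: integrableZl.
  by move=> w _; rewrite -EFinM -!EFinD lee_fin -exprMn cosh_ge.
have up (a : R) : (0 <= a <= 1)%R -> (2 * expR (a ^+ 2 * s ^+ 2 / 2) <=
    2 + a ^+ 2 * v + 6 * a ^+ 3 * (2 * expR (2 ^+ 2 * s ^+ 2 / 2)))%R.
  move=> a01; rewrite -lee_fin -mgf2.
  have -> : (2 + a ^+ 2 * v + 6 * a ^+ 3 * (2 * expR (2 ^+ 2 * s ^+ 2 / 2)))%:E =
      \int[P]_w (2%:E + (a ^+ 2)%:E * (X w ^+ 2)%:E +
         (6 * a ^+ 3)%:E * ((expR (2 * X w))%:E + (expR (- (2 * X w)))%:E)).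
    rewrite integralD//; last 2 first.
    - apply: integrableD => //; [exact: i1|exact: integrableZl].
    - by apply: integrableZl.
    rewrite integralD//; last 2 first.
    - exact: i1.
    - exact: integrableZl.
    by rewrite I1 integralZl// EX2 integralZl// mgf2.
  apply: le_integral => //.
    apply: integrableD => //; last by apply: integrableZl.
    apply: integrableD => //; [exact: i1|exact: integrableZl].
  by move=> w _ /=; rewrite lee_fin cosh_le.
suff -> : v = (s ^+ 2)%R.
  have := mgf 1%R; rewrite m0 mulr0 add0r expr1n mul1r => <-.
  by apply: eq_integral => w _; rewrite mul1r.
apply/eqP; rewrite eq_le; apply/andP; split.
  rewrite leNgt; apply/negP => sv.
  (* Using [lo] at [a = sqrt b] and [expR u <= 1 / (1 - u)], a contradiction follows as soon as
     [b * v * s ^+ 2 / 2 < v - s ^+ 2]. *)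
  pose b := ((v - s ^+ 2) / (s ^+ 2 * v + v))%R.
  have vp : (0 < v)%R by exact: le_lt_trans sv.
  have b0 : (0 < b)%R by rewrite divr_gt0 ?subr_gt0// ltr_wpDl// mulr_ge0.
  have bE : (b * (s ^+ 2 * v + v) = v - s ^+ 2)%R.
    by rewrite /b divfK// gt_eqF// ltr_wpDl// mulr_ge0.
  have := lo (Num.sqrt b); rewrite (sqr_sqrtr (ltW b0)).
  set u := (b * s ^+ 2 / 2)%R.
  have u1 : (u < 1)%R by rewrite /u; nra.
  have h : (expR u * (1 - u) <= 1)%R.
    have := expR_ge1Dx (- u)%R; rewrite expRN => /(ler_wpM2l (expR_ge0 u)).
    by rewrite mulfV// gt_eqF// expR_gt0.
  have e0 := expR_gt0 u.
  move=> h2.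
  have : ((2 + b * v) * (1 - u) <= 2)%R.
    apply: (@le_trans _ _ (2 * expR u * (1 - u))%R); last by lra.
    by apply: ler_wpM2r => //; rewrite subr_ge0 ltW.
  rewrite /u => h3.
  have : (b * (v * (1 - b * s ^+ 2 / 2) - s ^+ 2) <= 0)%R by lra.
  rewrite pmulr_rle0//; nra.
rewrite leNgt; apply/negP => vs.
set K := expR (2 ^+ 2 * s ^+ 2 / 2) in up.
have K1 : (1 <= K)%R by rewrite -expR0 ler_expR mulr_ge0// mulr_ge0// sqr_ge0.
(* Small enough that [a <= 1] and [12 * a * K < s ^+ 2 - v], against [up] and [1 + u <= expR u]. *)
pose a := ((s ^+ 2 - v) / (12 * K + s ^+ 2 + 1))%R.
have D0 : (0 < 12 * K + s ^+ 2 + 1)%R by lra.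
have aE : (a * (12 * K + s ^+ 2 + 1) = s ^+ 2 - v)%R by rewrite /a divfK// gt_eqF.
have a0 : (0 < a)%R by rewrite divr_gt0 ?subr_gt0.
have a1 : (a <= 1)%R by rewrite ler_pdivrMr// mul1r; lra.
have := up a; rewrite (ltW a0) a1 => /(_ erefl).
have := expR_ge1Dx (a ^+ 2 * s ^+ 2 / 2)%R => h1 h2.
have : (a ^+ 2 * (s ^+ 2 - v - 12 * a * K) <= 0)%R by lra.
by rewrite pmulr_rle0 ?exprn_gt0//; nra.
Qed.

End GaussianLaw.

Lemma mgf_gaussian_process (R : realType) (d : measure_display)
    (T : measurableType d) (P : probability T R) (Y : R -> {RV P >-> R})
    (C : R -> R -> R) n (t c : 'I_n -> R) :
  gaussian_process01 Y -> centered_with_cov01 Y C ->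
  (forall j, t j \in `[0, 1]) ->
  (\int[P]_w (expR (\sum_j c j * Y (t j) w))%:E =
   (expR ((\sum_i \sum_j c i * c j * C (t i) (t j)) / 2))%:E)%E.
Proof.
move=> Ygauss Ycov t01.
have mX : measurable_fun setT (fun w => \sum_j c j * Y (t j) w).
  by apply: measurable_sum => j; exact: measurable_funM.
pose X : {RV P >-> R} := HB.pack_for {RV P >-> R} (fun w => \sum_j c j * Y (t j) w)
  (isMeasurableFun.Build _ _ T R _ mX).
have [m [s lawX]] := Ygauss n t c t01.
have [iX EX] := expectation_linear Ycov c t01.
have [iX2 EX2] := expectation_quadratic Ycov c t01.
exact: (@mgf_gaussian_centered _ _ _ _ X m s).
Qed.

(** * Sums of squares of normal variables *)

Section LogBounds.
Context {R : realType}.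

Lemma is_derive_onem_expR (q : R -> R) (q' x : R) : is_derive x 1 q q' ->
  is_derive x 1 (fun y => (1 - y) * expR (q y)) (((1 - x) * q' - 1) * expR (q x)).
Proof.
move=> dq.
have de : is_derive x 1 (expR \o q) (expR (q x) * q') by exact: is_derive1_comp.
have d1 : is_derive x 1 ((cst 1 : R -> R) - (@id R)) (0 - 1).
  by apply: is_deriveB.
have := is_deriveM d1 de.
rewrite /GRing.scale /=.
have -> : (cst 1 - @id R)%R x = 1 - x by [].
set v := (X in is_derive _ _ _ X -> _); set w := (X in _ -> is_derive _ _ _ X).
by have -> : v = w by rewrite /v /w; ring.
Qed.

(** For [y < 1] this is [- ln (1 - y) >= y + y ^+ 2 / 2], stated without the logarithm;
    [onem_expR_ge1] is the matching upper bound. *)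
Lemma onem_expR_le1 (y : R) : 0 <= y -> (1 - y) * expR (y + 2^-1 * y ^+ 2) <= 1.
Proof.
move=> y0.
pose h y : R := - ((1 - y) * expR (1 * y + 2^-1 * y ^+ 2 + 0 * y ^+ 3)).
pose h' y : R := - (((1 - y) * (1 + 2 * 2^-1 * y + 3 * 0 * y ^+ 2) - 1) *
  expR (1 * y + 2^-1 * y ^+ 2 + 0 * y ^+ 3)).
have : h 0 <= h y.
  apply: (@le_of_deriv_ge0 _ _ h') => // x /andP[x0 xy].
    by apply: is_deriveN; apply: is_derive_onem_expR; exact: is_derive_cubic.
  rewrite /h' -mulNr mulr_ge0 ?expR_ge0//.
  by have := sqr_ge0 x; lra.
by rewrite /h !mul0r !addr0 expr0n !mulr0 !addr0 expR0 subr0 !mul1r; lra.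
Qed.

Lemma onem_expR_ge1 (y : R) : 0 <= y <= 2^-1 ->
  1 <= (1 - y) * expR (y + 2^-1 * y ^+ 2 + 1 * y ^+ 3).
Proof.
move=> /andP[y0 y1].
pose h y : R := (1 - y) * expR (1 * y + 2^-1 * y ^+ 2 + 1 * y ^+ 3).
pose h' y : R := ((1 - y) * (1 + 2 * 2^-1 * y + 3 * 1 * y ^+ 2) - 1) *
  expR (1 * y + 2^-1 * y ^+ 2 + 1 * y ^+ 3).
have : h 0 <= h y.
  apply: (@le_of_deriv_ge0 _ _ h') => // x /andP[x0 xy].
    by apply: is_derive_onem_expR; exact: is_derive_cubic.
  rewrite /h' mulr_ge0 ?expR_ge0//.
  have -> : (1 - x) * (1 + 2 * 2^-1 * x + 3 * 1 * x ^+ 2) - 1 = x ^+ 2 * (2 - 3 * x) by field.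
  by rewrite mulr_ge0 ?sqr_ge0//; lra.
by rewrite /h !expr0n !mulr0 !addr0 expR0 subr0 mulr1 mul1r.
Qed.

(** The middle term is the moment generating function at [k] of a centered chi-square variable with
    [m] degrees of freedom, divided by [n]. Its logarithm [u] exceeds [m k^2 / n^2] by at most
    [256 / n^2], and [expR u <= 1 + u + 2 * u ^+ 2] with [u <= 32 / n], which [n >= 64] keeps below
    [1 / 2]. So [2304 = 256 + 2 * 32 ^ 2]. *)
Lemma chi2_mgf_bounds (n m k : nat) : (64 <= n)%N -> (m <= n)%N -> (k <= 4)%N ->
  (1 : R) + m%:R * k%:R ^+ 2 / n%:R ^+ 2 <=
    (Num.sqrt (1 - 2 * (k%:R / n%:R)))^-1 ^+ m * @expR R (- (k%:R * m%:R / n%:R)) <=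
    1 + m%:R * k%:R ^+ 2 / n%:R ^+ 2 + 2304 / n%:R ^+ 2.
Proof.
move=> n64 mn k4; set M := (X in _ <= X <= _); set N : R := n%:R; set x : R := k%:R / N.
have N64 : 64 <= N by rewrite (ler_nat R 64).
have N0 : 0 < N by lra.
have k4' : k%:R <= 4 :> R by rewrite (ler_nat R k 4).
have m0 : 0 <= m%:R :> R by [].
have mN : m%:R <= N by rewrite ler_nat.
have k0 : 0 <= k%:R :> R by [].
have x0 : 0 <= x by rewrite divr_ge0// ltW.
have xN : x * N = k%:R by rewrite /x divfK// gt_eqF.
have x1 : x <= 16^-1 by rewrite /x ler_pdivrMr//; lra.
have q0 : 0 < 1 - 2 * x by lra.
set s := Num.sqrt (1 - 2 * x).
have s0 : 0 < s by rewrite sqrtr_gt0.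
have s2 : s ^+ 2 = 1 - 2 * x by rewrite sqr_sqrtr// ltW.
pose phi := - ln (1 - 2 * x) / 2 - x.
have sE : s = expR (ln (1 - 2 * x) / 2).
  apply/eqP; rewrite -(@eqrXn2 _ 2)// ?(ltW s0) ?expR_ge0// s2 -expRM_natl.
  by rewrite (_ : 2 * (ln (1 - 2 * x) / 2) = ln (1 - 2 * x)) ?lnK//; field.
have ME : M = expR (m%:R * phi).
  rewrite /M -/N -/x -/s sE -expRN -expRM_natl -expRD; congr expR.
  by rewrite /phi /x; field; rewrite gt_eqF.
have phi_ge : x ^+ 2 <= phi.
  have := @onem_expR_le1 (2 * x); rewrite mulr_ge0// => /(_ erefl).
  rewrite -{1}[1 - 2 * x]lnK// -expRD -[leRHS]expR0 ler_expR /phi; lra.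
have phi_le : phi <= x ^+ 2 + 4 * x ^+ 3.
  have := @onem_expR_ge1 (2 * x); rewrite mulr_ge0//= (_ : 2 * x <= 2^-1); last by lra.
  move=> /(_ erefl).
  rewrite -{1}[1 - 2 * x]lnK// -expRD -[leLHS]expR0 ler_expR /phi; lra.
set D := m%:R * k%:R ^+ 2 / N ^+ 2.
have DE : D = m%:R * x ^+ 2 by rewrite /D /x; field; rewrite gt_eqF.
have lo : D <= m%:R * phi by rewrite DE ler_wpM2l.
have up : m%:R * phi <= D + 256 / N ^+ 2.
  apply: (le_trans (ler_wpM2l m0 phi_le)); rewrite mulrDr DE lerD2l.
  rewrite ler_pdivlMr ?exprn_gt0//.
  have -> : m%:R * (4 * x ^+ 3) * N ^+ 2 = 4 * m%:R * (x * N) ^+ 2 * x by ring.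
  rewrite xN; apply: (@le_trans _ _ (4 * N * k%:R ^+ 2 * x)).
    by rewrite ler_wpM2r// ler_wpM2r ?sqr_ge0// ler_wpM2l.
  have -> : 4 * N * k%:R ^+ 2 * x = 4 * k%:R ^+ 2 * (x * N) by ring.
  by rewrite xN; nra.
have D_le : D <= 16 / N.
  rewrite /D ler_pdivrMr ?exprn_gt0// (_ : 16 / N * N ^+ 2 = N * 16).
    by rewrite ler_pM ?sqr_ge0//; nra.
  by field; rewrite gt_eqF.
have e256 : 256 / N ^+ 2 <= 4 / N.
  rewrite ler_pdivrMr ?exprn_gt0// (_ : 4 / N * N ^+ 2 = 4 * N); first by lra.
  by field; rewrite gt_eqF.
set u := m%:R * phi in ME lo up *.
have N32 : 32 / N <= 2^-1 by rewrite ler_pdivrMr//; lra.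
have D0 : 0 <= D by rewrite DE mulr_ge0 ?sqr_ge0.
have u0 : 0 <= u by exact: le_trans lo.
have uN : u <= 32 / N.
  have : 0 < N^-1 by rewrite invr_gt0.
  lra.
have u1 : u <= 2^-1 by exact: le_trans N32.
have e0 := expR_gt0 u.
have eu : expR u * (1 - u) <= 1.
  have := expR_ge1Dx (- u); rewrite expRN => /(ler_wpM2l (expR_ge0 u)).
  by rewrite mulfV// gt_eqF.
have eu2 : expR u <= 1 + u + 2 * u ^+ 2.
  have : 0 <= (1 + u + 2 * u ^+ 2) * (1 - u) - 1.
    have -> : (1 + u + 2 * u ^+ 2) * (1 - u) - 1 = u ^+ 2 * (1 - 2 * u) by ring.
    by rewrite mulr_ge0 ?sqr_ge0//; lra.
  by move=> h; rewrite -(@ler_pM2r _ (1 - u)); lra.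
rewrite ME; apply/andP; split.
  by have := expR_ge1Dx u; lra.
apply: (le_trans eu2).
have : u ^+ 2 <= (32 / N) ^+ 2 by rewrite lerXn2r ?nnegrE ?divr_ge0// ltW.
have -> : (32 / N) ^+ 2 = 1024 / N ^+ 2 by field; rewrite gt_eqF.
have : 0 < (N ^+ 2)^-1 by rewrite invr_gt0 exprn_gt0.
lra.
Qed.

End LogBounds.

Section IntegralsOnTheWholeSpace.
Local Open Scope ereal_scope.
Context {R : realType} (d : measure_display) (T : measurableType d)
  (mu : {measure set T -> \bar R}).
Implicit Types f g : T -> \bar R.

Lemma ge0_integralTZl f (c : R) : measurable_fun setT f ->
  (forall x, 0 <= f x) -> (0 <= c)%R ->
  \int[mu]_x (c%:E * f x) = c%:E * \int[mu]_x f x.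
Proof. by move=> mf f0 c0; rewrite ge0_integralZl// lee_fin. Qed.

Lemma ge0_integralTD f g : measurable_fun setT f -> measurable_fun setT g ->
  (forall x, 0 <= f x) -> (forall x, 0 <= g x) ->
  \int[mu]_x (f x + g x) = \int[mu]_x f x + \int[mu]_x g x.
Proof. by move=> mf mg f0 g0; rewrite ge0_integralD. Qed.

End IntegralsOnTheWholeSpace.

Section ChiSquare.
Context {R : realType} (d : measure_display) (T : measurableType d)
  (P : probability T R) (n : nat) (X : 'I_n -> T -> R) (Q : pred 'I_n).
Hypothesis mX : forall i, measurable_fun setT (X i).

(* Independence and normality of the [X i], [i] in [Q], are expressed through
   their joint moment generating function. *)
Definition standard_normals := forall b : 'I_n -> R,
  (forall i, ~~ Q i -> b i = 0) ->
  (\int[P]_w (expR (\sum_i b i * X i w))%:E =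
   (expR ((\sum_i b i ^+ 2) / 2))%:E)%E.

Hypothesis HX : standard_normals.

(* [expR (l * x ^+ 2)] is the Laplace transform at [x] of a centered normal
   law of variance [2 * l], so that squares can be integrated one by one. *)
Lemma mgf_squares (l : R) (r : seq 'I_n) (b : 'I_n -> R) :
  0 < l -> l < 1 / 2 -> uniq r -> all Q r ->
  (forall i, ~~ Q i -> b i = 0) -> (forall i, i \in r -> b i = 0) ->
  (\int[P]_w (expR (l * (\sum_(i <- r) X i w ^+ 2) + \sum_i b i * X i w))%:E =
   ((Num.sqrt (1 - 2 * l))^-1 ^+ size r * expR ((\sum_i b i ^+ 2) / 2))%:E)%E.
Proof.
move=> l0 l1; elim: r b => [|i r IH] b.
  move=> _ _ bQ _; rewrite expr0 mul1r -(HX bQ); apply: eq_integral => w _.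
  by rewrite big_nil mulr0 add0r.
move=> /= /andP[ir ur] /andP[Qi Qr] bQ br.
set s := Num.sqrt (2 * l); set kap := (Num.sqrt (1 - 2 * l))^-1.
have s2 : s ^+ 2 = 2 * l by rewrite sqr_sqrtr// mulr_ge0// ltW.
have s0 : s != 0 by rewrite gt_eqF// sqrtr_gt0 mulr_gt0.
pose g w := l * (\sum_(i <- r) X i w ^+ 2) + \sum_i b i * X i w.
pose F (z : T * measurableTypeR R) : \bar R :=
  (expR (g z.1 + z.2 * X i z.1) * normal_pdf 0 s z.2)%:E.
have mg : measurable_fun setT g.
  apply: measurable_funD; last by apply: measurable_sum => j; exact: measurable_funM.
  apply: measurable_funM => //; apply: measurable_sum => j.
  exact: measurable_funX.
have mF : measurable_fun setT F.
  apply/measurable_EFinP; apply: measurable_funM; last first.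
    apply: measurableT_comp; first exact: measurable_normal_pdf.
    exact: measurable_snd.
  apply: measurableT_comp => //; apply: measurable_funD.
    by apply: measurableT_comp => //; exact: measurable_fst.
  apply: measurable_funM; first exact: measurable_snd.
  by apply: measurableT_comp => //; exact: measurable_fst.
have F0 z : (0 <= F z)%E.
  by rewrite lee_fin mulr_ge0 ?expR_ge0 ?normal_pdf_ge0.
transitivity (\int[P]_w \int[lebesgue_measure]_a F (w, a))%E.
  apply: eq_integral => w _; rewrite /F /=.
  transitivity (\int[lebesgue_measure]_a ((expR (g w))%:E *
      ((expR (X i w * a))%:E * (normal_pdf 0 s a)%:E)))%E; last first.
    apply: eq_integral => a _; rewrite -!EFinM mulrA -expRD.
    by rewrite (mulrC a).
  rewrite ge0_integralTZl ?expR_ge0//; last 2 first.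
  - apply: emeasurable_funM; apply/measurable_EFinP.
      apply: measurableT_comp => //; exact: measurable_funM.
    exact: measurable_normal_pdf.
  - by move=> a; rewrite mule_ge0// lee_fin ?expR_ge0 ?normal_pdf_ge0.
  rewrite integral_expR_normal_pdf// -EFinM -expRD big_cons s2; congr (expR _)%:E.
  by rewrite /g; field.
rewrite (@fubini_tonelli _ _ _ _ _ P lebesgue_measure F)//.
transitivity (\int[lebesgue_measure]_a
    ((kap ^+ size r * expR ((\sum_i b i ^+ 2) / 2))%:E *
     ((expR (a ^+ 2 / 2))%:E * (normal_pdf 0 s a)%:E)))%E.
  apply: eq_integral => a _; rewrite /F /=.
  (* The auxiliary variable becomes the coefficient of [X i], a free slot since [b] vanishes on
     [i :: r]. This is why the statement carries a linear form along with the squares. *)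
  pose b' j := if j == i then a else b j.
  have bi : b i = 0 by apply: br; rewrite inE eqxx.
  have b'E w : expR (g w + a * X i w) =
      expR (l * (\sum_(i <- r) X i w ^+ 2) + \sum_i b' i * X i w).
    rewrite /g -addrA; congr (expR (_ + _)).
    rewrite (bigD1 i)//= [in RHS](bigD1 i)//= /b' eqxx bi mul0r add0r addrC.
    by congr (_ + _); apply: eq_bigr => j /negPf ->.
  transitivity (\int[P]_w ((normal_pdf 0 s a)%:E *
      (expR (l * (\sum_(i <- r) X i w ^+ 2) + \sum_i b' i * X i w))%:E))%E.
    by apply: eq_integral => w _; rewrite -EFinM b'E mulrC.
  rewrite ge0_integralTZl; first last.
  - exact: normal_pdf_ge0.
  - by move=> w; rewrite lee_fin expR_ge0.
  - apply/measurable_EFinP; apply: measurableT_comp => //; apply: measurable_funD.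
      apply: measurable_funM => //; apply: measurable_sum => j.
      exact: measurable_funX.
    by apply: measurable_sum => j; exact: measurable_funM.
  rewrite IH//; last 2 first.
  - by move=> j Qj; rewrite /b'; case: eqP => [ji|_]; [rewrite ji Qi in Qj|exact: bQ].
  - move=> j jr; rewrite /b'; case: eqP => [ji|_]; first by rewrite -ji jr in ir.
    by apply: br; rewrite inE jr orbT.
  rewrite -!EFinM; congr EFin.
  have -> : \sum_j b' j ^+ 2 = \sum_j b j ^+ 2 + a ^+ 2.
    rewrite (bigD1 i)//= [in RHS](bigD1 i)//= /b' eqxx bi expr0n add0r addrC.
    by congr (_ + _); apply: eq_bigr => j /negPf ->.
  rewrite [(_ + a ^+ 2) / 2]mulrDl expRD -/kap; ring.
rewrite ge0_integralTZl; first last.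
- by rewrite mulr_ge0 ?expR_ge0// exprn_ge0// invr_ge0 sqrtr_ge0.
- by move=> a; rewrite mule_ge0// lee_fin ?expR_ge0 ?normal_pdf_ge0.
- apply: emeasurable_funM; apply/measurable_EFinP.
    by apply: measurableT_comp => //; exact: measurable_funM.
  exact: measurable_normal_pdf.
rewrite integral_expR_sqr_normal_pdf// -EFinM -/kap exprS; congr EFin; ring.
Qed.

Definition chi2 (w : T) : R := \sum_(i | Q i) X i w ^+ 2.

Let m := #|Q|.

Lemma measurable_chi2 : measurable_fun setT chi2.
Proof.
rewrite /chi2; under eq_fun do rewrite big_mkcond.
by apply: measurable_sum => i; case: (Q i) => //; exact: measurable_funX.
Qed.

Lemma mgf_chi2 (k : nat) : (64 <= n)%N -> (0 < k)%N -> (k <= 4)%N ->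
  (\int[P]_w (expR (k%:R * ((chi2 w - m%:R) / n%:R)))%:E =
   ((Num.sqrt (1 - 2 * (k%:R / n%:R)))^-1 ^+ m *
     @expR R (- (k%:R * m%:R / n%:R)))%:E)%E.
Proof.
move=> n64 k0 k4.
have N64 : 64 <= n%:R :> R by rewrite (ler_nat R 64).
have k4' : k%:R <= 4 :> R by rewrite (ler_nat R k 4).
have N0 : 0 < n%:R :> R by lra.
have l0 : 0 < k%:R / n%:R :> R by rewrite divr_gt0// ltr0n.
have l1 : k%:R / n%:R < 1 / 2 :> R by rewrite ltr_pdivrMr//; lra.
have Qr : all Q (enum Q) by apply/allP => i; rewrite mem_enum.
have := mgf_squares (b := fun=> 0) l0 l1 (enum_uniq Q) Qr (fun _ _ => erefl) (fun _ _ => erefl).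
rewrite [X in X / 2]big1 ?mul0r ?expR0 ?mulr1 => [|i _]; last by rewrite expr0n.
rewrite -cardE -/m => E.
transitivity (\int[P]_w ((expR (- (k%:R * m%:R / n%:R)))%:E *
  (expR (k%:R / n%:R * (\sum_(i <- enum Q) X i w ^+ 2) + \sum_i 0 * X i w))%:E))%E.
  apply: eq_integral => w _; rewrite -EFinM -expRD; congr (expR _)%:E.
  rewrite [\sum_i 0 * _]big1 => [|i _]; last by rewrite mul0r.
  rewrite addr0 /chi2 big_enum/=; field.
  by rewrite gt_eqF.
rewrite ge0_integralTZl; first last.
- exact: expR_ge0.
- by move=> w; rewrite lee_fin expR_ge0.
- apply/measurable_EFinP; apply: measurableT_comp => //; apply: measurable_funD.
    apply: measurable_funM => //; apply: measurable_sum => j.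
    exact: measurable_funX.
  by apply: measurable_sum => j; exact: measurable_funM.
by rewrite E -EFinM mulrC.
Qed.

(* The fourth finite difference of [k |-> E (expR (k * U))] only sees the terms
   of order [1 / n ^+ 2], the first ones being polynomial of degree 2 in [k]. *)
Lemma chi2_fourth_moment : (64 <= n)%N ->
  (\int[P]_w ((expR ((chi2 w - m%:R) / n%:R) - 1) ^+ 4)%:E <=
   (16128 / n%:R ^+ 2)%:E)%E.
Proof.
move=> n64; pose U w : R := (chi2 w - m%:R) / n%:R.
have mE (c : R) : measurable_fun setT (fun w => (expR (c * U w))%:E).
  apply/measurable_EFinP; apply: measurableT_comp => //.
  apply: measurable_funM => //; apply: measurable_funM => //.
  apply: measurable_funB => //; exact: measurable_chi2.
have mW : measurable_fun setT (fun w => ((expR (U w) - 1) ^+ 4)%:E).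
  apply/measurable_EFinP; apply: measurable_funX; apply: measurable_funB => //.
  have := mE 1 => /measurable_EFinP.
  by under eq_fun do rewrite mul1r.
have mn : (m <= n)%N by rewrite /m -[X in (_ <= X)%N]card_ord max_card.
have E k : (0 < k)%N -> (k <= 4)%N -> exists2 M : R,
   (\int[P]_w (expR (k%:R * U w))%:E = M%:E)%E &
   1 + m%:R * k%:R ^+ 2 / n%:R ^+ 2 <= M <=
   1 + m%:R * k%:R ^+ 2 / n%:R ^+ 2 + 2304 / n%:R ^+ 2.
  by move=> k0 k4; eexists; [exact: mgf_chi2|exact: chi2_mgf_bounds].
have [M1 E1 B1] := E 1 isT isT; have [M2 E2 B2] := E 2 isT isT.
have [M3 E3 B3] := E 3 isT isT; have [M4 E4 B4] := E 4 isT isT.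
have p0 (c : R) w : (0 <= (expR (c * U w))%:E)%E by rewrite lee_fin expR_ge0.
have mcE (c c' : R) : measurable_fun setT (fun w => c'%:E * (expR (c * U w))%:E)%E.
  exact: emeasurable_funM.
have pc (c c' : R) w : 0 <= c' -> (0 <= c'%:E * (expR (c * U w))%:E)%E.
  by move=> c'0; rewrite mule_ge0// lee_fin.
have W0 w : (0 <= ((expR (U w) - 1) ^+ 4)%:E)%E.
  by rewrite lee_fin exprn_even_ge0.
(* The binomial expansion, with the negative terms moved to the left so that only nonnegative
   functions are integrated. *)
have Hsum : (\int[P]_w ((expR (U w) - 1) ^+ 4)%:E + (4 * M3 + 4 * M1)%:E =
             (M4 + 6 * M2 + 1)%:E)%E.
  have -> : ((4 * M3 + 4 * M1)%:E =
     \int[P]_w (4%:E * (expR (3%:R * U w))%:E + 4%:E * (expR (1%:R * U w))%:E))%E.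
    rewrite ge0_integralTD//; try by move=> w; exact: pc.
    by rewrite !ge0_integralTZl// E1 E3.
  have -> : ((M4 + 6 * M2 + 1)%:E =
     \int[P]_w ((expR (4%:R * U w))%:E + 6%:E * (expR (2%:R * U w))%:E + 1%:E))%E.
    rewrite ge0_integralTD//; try (by move=> w; rewrite adde_ge0// pc);
      try exact: emeasurable_funD.
    rewrite integral_cst//= probability_setT mule1 ge0_integralTD//.
      by rewrite ge0_integralTZl// E4 E2.
  rewrite -ge0_integralTD//; try (by move=> w; rewrite adde_ge0// pc);
    try exact: emeasurable_funD.
  apply: eq_integral => w _; rewrite -!EFinM -!EFinD; congr EFin.
  have eE k : expR (k%:R * U w) = expR (U w) ^+ k by rewrite expRM_natl.
  by rewrite !eE expr1; ring.
have -> : (\int[P]_w ((expR ((chi2 w - m%:R) / n%:R) - 1) ^+ 4)%:E =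
   (M4 + 6 * M2 + 1)%:E - (4 * M3 + 4 * M1)%:E)%E by rewrite -Hsum addeK.
(* The polynomial parts cancel. Only the upper errors of [M4] and [6 * M2] remain, and
   [16128 = 7 * 2304]. *)
rewrite -EFinB lee_fin.
move: B1 B2 B3 B4 => /andP[B1 _] /andP[_ B2] /andP[B3 _] /andP[_ B4]; lra.
Qed.

End ChiSquare.

(** The fourth moments are summable, so almost surely the series of the [W n w] is finite and its
    terms tend to 0, whatever the dependence between different [n]. Continuity of [ln] at 1 then
    leads back from [expR U] to [U]. *)
Lemma chi2_lln (R : realType) (d : measure_display) (T : measurableType d)
    (P : probability T R) (X : forall n, 'I_n -> T -> R)
    (Q : forall n, pred 'I_n) :
  (forall n i, measurable_fun setT (X n i)) ->
  (\forall n \near \oo, standard_normals P (X n) (Q n)) ->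
  {ae P, forall w,
    (chi2 (X n) (Q n) w - #|Q n|%:R) / n%:R @[n --> \oo] --> (0 : R)}.
Proof.
move=> mX [N0 _ HN0].
pose N := maxn 64 N0.
pose W n w : R := if (N <= n)%N then
  (expR ((chi2 (X n) (Q n) w - #|Q n|%:R) / n%:R) - 1) ^+ 4 else 0.
have mW n : measurable_fun setT (fun w => (W n w)%:E).
  apply/measurable_EFinP; rewrite /W; case: (N <= n)%N => //.
  apply: measurable_funX; apply: measurable_funB => //.
  apply: measurableT_comp => //; apply: measurable_funM => //.
  by apply: measurable_funB => //; exact: measurable_chi2.
have W0 n w : 0 <= W n w by rewrite /W; case: ifP => // _; rewrite exprn_even_ge0.
have [C C0 IW] : exists2 C : R, 0 <= C &
    forall n, (\int[P]_w (W n w)%:E <= (C / n%:R ^+ 2)%:E)%E.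
  exists 16128%:R => [|n]; first exact: ler0n.
  rewrite /W; case E: (N <= n)%N.
    move: E; rewrite /N geq_max => /andP[n64 nN0]; apply: chi2_fourth_moment => //.
    exact: HN0.
  move: (ler0n R 16128); move: (16128%:R : R) => C C0.
  by rewrite integral0 lee_fin divr_ge0// exprn_ge0.
have Sfin : (\sum_(0 <= n <oo) \int[P]_w (W n w)%:E < +oo)%E.
  apply: (@le_lt_trans _ _ (2 * C)%:E); last exact: ltry.
  apply: lime_le.
    by apply: is_cvg_nneseries => n _ _; apply: integral_ge0 => w _; rewrite lee_fin.
  apply: nearW => n.
  apply: (@le_trans _ _ (\sum_(0 <= k < n) (C / k%:R ^+ 2)%:E)%E).
    by apply: lee_sum => k _; exact: IW.
  rewrite sumEFin lee_fin -mulr_sumr mulrC ler_wpM2r//.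
  (* The term [j = 0] is [0^-1 = 0]; the others are compared with a telescoping sum. *)
  have H k : \sum_(0 <= j < k.+2) (j%:R ^+ 2)^-1 <= 2 - (k.+1%:R)^-1 :> R.
    elim: k => [|k IH].
      by rewrite big_nat_recr//= big_nat1 expr0n invr0 expr1n invr1; lra.
    rewrite big_nat_recr//=; apply: le_trans (lerD IH (lexx _)) _.
    have k1 : 0 < k.+1%:R :> R by rewrite ltr0n.
    rewrite -[k.+2%:R]natr1; move: (k.+1%:R : R) k1 => x x0.
    rewrite -subr_ge0.
    have -> : 2 - (x + 1)^-1 - (2 - x^-1 + ((x + 1) ^+ 2)^-1) =
      (x * (x + 1) ^+ 2)^-1 by field; lra.
    by rewrite invr_ge0 mulr_ge0 ?sqr_ge0// ltW.
  case: n => [|[|k]]; first by rewrite big_geq.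
    by rewrite big_nat1 expr0n invr0.
  by apply: le_trans (H k) _; rewrite lerBlDr lerDl invr_ge0.
have iS : P.-integrable setT (fun w => \sum_(0 <= n <oo) (W n w)%:E)%E.
  apply/integrableP; split.
    apply: ge0_emeasurable_sum => // n w _ _; by rewrite lee_fin.
  under eq_integral => w _ do
    (rewrite gee0_abs; last by apply: nneseries_ge0 => n _ _; rewrite lee_fin).
  by rewrite integral_nneseries// => n w _; rewrite lee_fin.
have := integrable_ae measurableT iS.
apply: filterS => w /(_ I) fin.
have W_cvg : W ^~ w @ \oo --> 0.
  apply: cvg_series_cvg_0; apply: nondecreasing_is_cvgn.
    apply/nondecreasing_seqP => n.
    by rewrite /series/= big_nat_recr//= lerDl.
  exists (fine (\sum_(0 <= n <oo) (W n w)%:E)%E) => _ [n _ <-].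
  rewrite -lee_fin fineK// /series /= -sumEFin.
  by apply: nneseries_lim_ge => k _ _; rewrite lee_fin.
set U := (X in X @ _ --> _).
have E_cvg : (fun n => expR (U n)) @ \oo --> (1 : R).
  apply/cvgrPdist_lt => e e0.
  have e4 : 0 < e ^+ 4 by rewrite exprn_gt0.
  near=> n.
  have Nn : (N <= n)%N by near: n; exists N.
  have : `|0 - W n w| < e ^+ 4 by near: n; move/cvgrPdist_lt : W_cvg; apply.
  by rewrite sub0r normrN /W Nn -/(U n) normrX ltr_pXn2r ?nnegrE ?(ltW e0)// distrC.
have -> : U = (fun n => ln (expR (U n))) by apply/funext => n; rewrite expRK.
rewrite -[X in _ --> X](@ln1 R).
by apply: continuous_cvg => //; exact: continuous_ln.
Unshelve. all: by end_near.
Qed.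

(** * Dense designs *)

Section ExponentialBounds.
Context {R : realType}.
Implicit Types x y u v : R.

Lemma onem_expRN_le x : 1 - expR (- x) <= x.
Proof. by have := expR_ge1Dx (- x); lra. Qed.

Lemma onem_expRN_ge x : 0 <= x -> x * (1 - x) <= 1 - expR (- x).
Proof.
move=> x0; have e0 := expR_gt0 (- x).
have : expR (- x) * (1 + x) <= 1.
  have := expR_ge1Dx x => /(ler_wpM2l (ltW e0)).
  by rewrite -expRD addNr expR0.
move=> h; rewrite -(@ler_pM2r _ (1 + x)); last lra.
have : 0 <= x ^+ 3 by rewrite exprn_ge0.
have -> : x * (1 - x) * (1 + x) = x - x ^+ 3 by ring.
by lra.
Qed.

Lemma expRN_lipschitz x y : 0 <= x -> 0 <= y ->
  `|expR (- x) - expR (- y)| <= `|x - y|.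
Proof.
wlog xy : x y / x <= y => [H x0 y0|x0 y0].
  have [xy|/ltW yx] := leP x y; first exact: H.
  by rewrite distrC (distrC x) H.
have -> : expR (- y) = expR (- x) * expR (- (y - x)).
  by rewrite -expRD; congr expR; ring.
have e0 := expR_gt0 (- x); have e1 : expR (- x) <= 1 by rewrite -expR0 ler_expR oppr_le0.
have d1 := onem_expRN_le (y - x).
have d0 : expR (- (y - x)) <= 1 by rewrite -expR0 ler_expR oppr_le0 subr_ge0.
rewrite ger0_norm; last by nra.
by rewrite ler0_norm ?subr_le0//; nra.
Qed.

Definition sinh x : R := (expR x - expR (- x)) / 2.
Definition cosh x : R := (expR x + expR (- x)) / 2.

Lemma sinh_lb x : 0 <= x -> x <= sinh x.
Proof. by move=> /sinh_ge; rewrite /sinh; lra. Qed.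

Lemma cosh_lb x : 1 <= cosh x.
Proof. by have := cosh_ge x; have := sqr_ge0 x; rewrite /cosh; lra. Qed.

Lemma cosh_ub x : 0 <= x <= 2^-1 -> cosh x <= 1 + x ^+ 2.
Proof.
move=> /andP[x0 x1]; have := cosh_le_sqr x.
rewrite ger0_norm// => h.
have e0 := expR_gt0 x.
have : expR x * (1 - x) <= 1.
  have := expR_ge1Dx (- x); rewrite expRN => /(ler_wpM2l (ltW e0)).
  by rewrite mulfV// gt_eqF.
move=> h2; have e2 : expR x <= 2 by nra.
have := ler_wpM2l (sqr_ge0 x) e2; rewrite /cosh; lra.
Qed.

Lemma sinh_ub x : 0 <= x <= 2^-1 -> sinh x <= x * (1 + x ^+ 2).
Proof.
move=> /andP[x0 x1].
pose h y : R := (2 * y + 0 * y ^+ 2 + 2 * y ^+ 3) - (expR (1 * y) - expR (-1 * y)).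
suff : h 0 <= h x.
  rewrite /h !mul0r !mulr0 !expr0n !mulr0 !mul1r mulN1r subrr !addr0 subr0 /sinh.
  lra.
pose h' y : R := (2 + 2 * 0 * y + 3 * 2 * y ^+ 2) -
  (1 * expR (1 * y) - -1 * expR (-1 * y)).
apply: (@le_of_deriv_ge0 _ _ h') => // y /andP[y0 yx].
  apply: is_deriveB; first exact: is_derive_cubic.
  by apply: is_deriveB; exact: is_derive_expRM.
have := @cosh_ub y; rewrite y0 (le_trans yx x1) /cosh /h' => /(_ erefl).
rewrite !mul1r !mulN1r opprK; have := sqr_ge0 y; lra.
Qed.

(** The weights [a] and [b] of exponential interpolation solve [a sinh u = b sinh v] and
    [a cosh u + b cosh v = 1], a higher-order perturbation of the system solved by the linear
    weights. The bound by [u * v], not by [(u + v) ^+ 2], matches [om] even for very unequal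
    spacings. *)
Lemma sinh_ratio u v : 0 < u -> 0 < v -> u <= 2^-1 -> v <= 2^-1 ->
  `|sinh v / sinh (u + v) - v / (u + v)| <= 6 * (u * v).
Proof.
move=> u0 v0 u1 v1; have uv0 : 0 < u + v by lra.
have Suv0 : 0 < sinh (u + v) by apply: lt_le_trans (sinh_lb (ltW uv0)).
set a := sinh v / sinh (u + v); set b := sinh u / sinh (u + v).
have Su := sinh_lb (ltW u0); have Sv := sinh_lb (ltW v0).
have u01 : 0 <= u <= 2^-1 by rewrite (ltW u0). have v01 : 0 <= v <= 2^-1 by rewrite (ltW v0).
have Su2 := sinh_ub u01; have Sv2 := sinh_ub v01.
have Cu := cosh_lb u; have Cu2 := cosh_ub u01.
have Cv := cosh_lb v; have Cv2 := cosh_ub v01.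
have Suv := sinh_lb (ltW uv0).
have rel1 : a * sinh u = b * sinh v by rewrite /a /b; field; rewrite gt_eqF.
have eu : expR u * expR (- u) = 1 by rewrite -expRD subrr expR0.
have ev : expR v * expR (- v) = 1 by rewrite -expRD subrr expR0.
have addS : sinh (u + v) = sinh v * cosh u + sinh u * cosh v.
  by rewrite /sinh /cosh opprD !expRD; field.
have rel2 : a * cosh u + b * cosh v = 1.
  by rewrite /a /b mulrAC [_ / _ * cosh v]mulrAC -mulrDl -addS divff// gt_eqF.
have a0 : 0 <= a by rewrite divr_ge0// ltW//; lra.
have b0 : 0 <= b by rewrite divr_ge0// ltW//; lra.
have aub : a * (u + v) <= 2 * v.
  rewrite /a mulrAC ler_pdivrMr//.
  have : v ^+ 2 <= 1 by nra.
  nra.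
have bub : b * (u + v) <= 2 * u.
  rewrite /b mulrAC ler_pdivrMr//.
  have : u ^+ 2 <= 1 by nra.
  nra.
set p := u + v in uv0 aub bub *; have p0 := ltW uv0.
clearbody a b; have u00 := ltW u0; have v00 := ltW v0.
(* The first two summands add up to [b * (sinh v - v)]. *)
have key : a - v / p = ((b * (sinh v - v) * -1 + b * (sinh v - v) * 2 - a * (sinh u - u)) -
    v * (a * (cosh u - 1) + b * (cosh v - 1))) / p + 0.
  apply: (mulIf (lt0r_neq0 uv0)); rewrite mulrBl mulrDl mul0r addr0 !divfK ?gt_eqF//.
  have -> : v * (a * (cosh u - 1) + b * (cosh v - 1)) = v * (1 - a - b).
    transitivity (v * ((a * cosh u + b * cosh v) - a - b)); first by ring.
    by rewrite rel2.
  by rewrite /p; lra.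
have B1 : 0 <= b * (sinh v - v) * p <= 2 * u * v ^+ 3.
  have : 0 <= sinh v - v <= v ^+ 3 by apply/andP; split; lra.
  move=> /andP[s0 s1]; apply/andP; split; first by rewrite !mulr_ge0.
  by rewrite mulrAC ler_pM// mulr_ge0.
have B2 : 0 <= a * (sinh u - u) * p <= 2 * v * u ^+ 3.
  have : 0 <= sinh u - u <= u ^+ 3 by apply/andP; split; lra.
  move=> /andP[s0 s1]; apply/andP; split; first by rewrite !mulr_ge0.
  by rewrite mulrAC ler_pM// mulr_ge0.
have B3 : 0 <= v * (a * (cosh u - 1) + b * (cosh v - 1)) * p <=
    2 * v ^+ 2 * u ^+ 2 + 2 * u * v ^+ 3.
  have c0 : 0 <= cosh u - 1 <= u ^+ 2 by apply/andP; split; lra.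
  have c1 : 0 <= cosh v - 1 <= v ^+ 2 by apply/andP; split; lra.
  have -> : v * (a * (cosh u - 1) + b * (cosh v - 1)) * p =
    v * ((a * p) * (cosh u - 1) + (b * p) * (cosh v - 1)) by ring.
  move: c0 c1 => /andP[c0 c0'] /andP[c1 c1'].
  have m1 : 0 <= a * p * (cosh u - 1) by rewrite !mulr_ge0.
  have m2 : 0 <= b * p * (cosh v - 1) by rewrite !mulr_ge0.
  have n1 : a * p * (cosh u - 1) <= 2 * v * u ^+ 2.
    by rewrite ler_pM// mulr_ge0.
  have n2 : b * p * (cosh v - 1) <= 2 * u * v ^+ 2.
    by rewrite ler_pM// mulr_ge0.
  apply/andP; split; first by rewrite mulr_ge0 ?addr_ge0.
  have := ler_wpM2l (ltW v0) (lerD n1 n2).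
  by move=> /le_trans; apply; rewrite le_eqVlt; apply/orP; left; apply/eqP; ring.
rewrite key addr0.
set X := (X in `|X / p|).
have XE : X * p = b * (sinh v - v) * p - a * (sinh u - u) * p -
    v * (a * (cosh u - 1) + b * (cosh v - 1)) * p by rewrite /X; ring.
have p2 : 0 < p ^+ 2 by rewrite exprn_gt0.
have -> : X / p = (X * p) / p ^+ 2 by field; rewrite gt_eqF.
rewrite normrM [`|(p ^+ 2)^-1|]ger0_norm ?invr_ge0 ?(ltW p2)// ler_pdivrMr//.
have pv : 0 < u * v by rewrite mulr_gt0.
have -> : 6 * (u * v) * p ^+ 2 = 6 * u ^+ 3 * v + 12 * u ^+ 2 * v ^+ 2 + 6 * u * v ^+ 3.
  by rewrite /p; ring.
have e1 : 0 <= u ^+ 3 * v by rewrite mulr_ge0 ?exprn_ge0 ?ltW.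
have e2 : 0 <= u * v ^+ 3 by rewrite mulr_ge0 ?exprn_ge0 ?ltW.
have e3 : 0 <= u ^+ 2 * v ^+ 2 by rewrite mulr_ge0 ?exprn_ge0 ?ltW.
rewrite XE ler_norml; move: B1 B2 B3 => /andP[? ?] /andP[? ?] /andP[? ?].
by apply/andP; split; lra.
Qed.

End ExponentialBounds.

(** * Scales of the spacings, and expansion of weights and variances *)

Section DesignScales.
Context {R : realType} (n : nat) (t : nat -> R).
Let dl i := t i - t i.-1.
Let dr i := t i.+1 - t i.

Definition by_position (i : nat) (x y z : R) : R :=
  if i is 0 then x else if i.+1 == n then y else z.

(* Linear interpolation weights of the two neighbours; at an end point all the
   weight is on the only neighbour. *)
Definition lam i := by_position i 0 1 (dr i / (dl i + dr i)).
Definition lam' i := by_position i 1 0 (dl i / (dl i + dr i)).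

(* [2 * theta * tau i] is the leading term of [kvar i]; prediction errors of
   smooth functions are of order [om i]. *)
Definition tau i := by_position i (dr i) (dl i) (dl i * dr i / (dl i + dr i)).
Definition om i := by_position i (dr i) (dl i) (dl i * dr i).

Variant position_spec (i : nat) : Type :=
| LeftEnd of i = 0%N
| RightEnd of (0 < i)%N & i.+1 = n
| Interior of (0 < i)%N & (i.+1 < n)%N.

Lemma positionP i : (i < n)%N -> position_spec i.
Proof.
move=> i_lt; case: i i_lt => [|i] i_lt; first exact: LeftEnd.
have [h|h] := eqVneq i.+2 n; first exact: RightEnd.
by apply: Interior => //; rewrite ltn_neqAle h.
Qed.

Lemma by_position_right i x y z :
  (0 < i)%N -> i.+1 = n -> by_position i x y z = y.
Proof. by case: i => // i _ h; rewrite /by_position h eqxx. Qed.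

Lemma by_position_interior i x y z :
  (0 < i)%N -> (i.+1 < n)%N -> by_position i x y z = z.
Proof. by case: i => // i _ h; rewrite /by_position ltn_eqF. Qed.

Hypothesis n_gt1 : (1 < n)%N.
Hypothesis t_lt : forall k l, (k < l)%N -> (l < n)%N -> t k < t l.
Variable h : R.
Hypothesis t_h : forall l, (l.+1 < n)%N -> t l.+1 - t l <= h.

Lemma spacing_l i : (0 < i)%N -> (i < n)%N -> 0 < t i - t i.-1 <= h.
Proof. by case: i => // i _ i_lt; rewrite subr_gt0 t_lt//= t_h. Qed.

Lemma spacing_r i : (i.+1 < n)%N -> 0 < t i.+1 - t i <= h.
Proof. by move=> i_lt; rewrite subr_gt0 t_lt//= t_h. Qed.

Lemma h_gt0 : 0 < h.
Proof. by have /andP[] := spacing_r n_gt1; exact: lt_le_trans. Qed.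

Lemma tau_gt0 i : (i < n)%N -> 0 < tau i.
Proof.
move=> i_lt; rewrite /tau.
have [->|i0 iSn|i0 iSn] := positionP i_lt.
- by have /andP[] := spacing_r n_gt1.
- by rewrite by_position_right//; have /andP[] := spacing_l i0 i_lt.
rewrite by_position_interior//.
have /andP[? _] := spacing_l i0 i_lt; have /andP[? _] := spacing_r iSn.
by apply: divr_gt0; [exact: mulr_gt0|exact: addr_gt0].
Qed.

Lemma om_gt0 i : (i < n)%N -> 0 < om i.
Proof.
move=> i_lt; rewrite /om.
have [->|i0 iSn|i0 iSn] := positionP i_lt.
- by have /andP[] := spacing_r n_gt1.
- by rewrite by_position_right//; have /andP[] := spacing_l i0 i_lt.
rewrite by_position_interior//.
have /andP[? _] := spacing_l i0 i_lt; have /andP[? _] := spacing_r iSn.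
exact: mulr_gt0.
Qed.

Hypothesis h_le1 : h <= 1.

Lemma om_sqr_le i : (i < n)%N -> om i ^+ 2 <= 2 * h * tau i.
Proof.
move=> i_lt; have h0 := h_gt0; rewrite /om /tau.
have [->|i0 iSn|i0 iSn] := positionP i_lt.
- rewrite /by_position; have /andP[] := spacing_r n_gt1; rewrite -/(dr 0).
  by move: (dr 0) => x *; nra.
- rewrite !by_position_right//; have /andP[] := spacing_l i0 i_lt; rewrite -/(dl i).
  by move: (dl i) => x *; nra.
rewrite !by_position_interior//.
have /andP[] := spacing_l i0 i_lt; have /andP[] := spacing_r iSn.
rewrite -/(dl i) -/(dr i); move: (dl i) (dr i) => x y y0 yh x0 xh.
have xy0 : 0 < x * y by rewrite mulr_gt0.
rewrite mulrA ler_pdivlMr ?addr_gt0//.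
have -> : 2 * h * (x * y) = x * y * (2 * h) by ring.
have -> : (x * y) ^+ 2 * (x + y) = x * y * (x * y * (x + y)) by ring.
rewrite ler_pM2l//.
have xy1 : x * y <= 1.
  by rewrite mulr_ile1 ?(ltW x0) ?(ltW y0)// (le_trans _ h_le1).
apply: (@le_trans _ _ (1 * (x + y))); last lra.
by rewrite ler_wpM2r// addr_ge0// ltW.
Qed.

Lemma sum_dl : \sum_(i < n) (if (0 < i)%N then dl i else 0) = t n.-1 - t 0.
Proof.
case: n n_gt1 => // m _; rewrite big_ord_recl/= add0r.
by rewrite -(telescope_sumr t (leq0n m)) big_mkord; apply: eq_bigr.
Qed.

Lemma sum_dr : \sum_(i < n) (if (i.+1 < n)%N then dr i else 0) = t n.-1 - t 0.
Proof.
case: n n_gt1 => // m _; rewrite big_ord_recr/= ltnn addr0.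
rewrite -(telescope_sumr t (leq0n m)) big_mkord; apply: eq_bigr => i _.
by rewrite ltnS ltn_ord.
Qed.

Lemma sum_delta (k : nat) (x : R) : (k < n)%N ->
  \sum_(i < n) (i == k :> nat)%:R * x = x.
Proof.
move=> kn; rewrite (bigD1 (Ordinal kn))//= eqxx mul1r big1 ?addr0// => i.
by rewrite -val_eqE /= => /negPf ->; rewrite mul0r.
Qed.

Hypothesis t01 : forall l, (l < n)%N -> 0 <= t l <= 1.

(** Each end point contributes at most [h]. An interior point contributes [dl * dr * (dl + dr) <= h
    ^+ 2 * (dl + dr)], and the spacings add up to at most 1 on each side. *)
Lemma sum_om_sqr : \sum_(i < n) om i ^+ 2 / tau i <= 4 * h.
Proof.
have h0 := h_gt0.
have h1 := h_le1.
have len : t n.-1 - t 0 <= 1.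
  have /andP[_ ?] : 0 <= t n.-1 <= 1 by apply: t01; case: n n_gt1.
  have /andP[? _] : 0 <= t 0 <= 1 by apply: t01; case: n n_gt1.
  lra.
have bnd (i : 'I_n) : om i ^+ 2 / tau i <=
    (i == 0 :> nat)%:R * h + (i == n.-1 :> nat)%:R * h +
    h ^+ 2 * ((if (0 < i)%N then dl i else 0) + (if (i.+1 < n)%N then dr i else 0)).
  have i_lt := ltn_ord i.
  have dl0 : 0 <= if (0 < i)%N then dl i else 0.
    by case: ifP => // i0; have /andP[/ltW] := spacing_l i0 i_lt.
  have dr0 : 0 <= if (i.+1 < n)%N then dr i else 0.
    by case: ifP => // i0; have /andP[/ltW] := spacing_r i0.
  have s0 : 0 <= h ^+ 2 * ((if (0 < i)%N then dl i else 0) +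
      (if (i.+1 < n)%N then dr i else 0)) by rewrite mulr_ge0 ?sqr_ge0 ?addr_ge0.
  have d0 k : 0 <= (i == k :> nat)%:R * h by rewrite mulr_ge0 ?ler0n ?ltW.
  rewrite ler_pdivrMr ?tau_gt0//.
  have [i0|i0 iSn|i0 iSn] := positionP i_lt.
  - rewrite -ler_pdivrMr ?tau_gt0//; apply: (@le_trans _ _ h).
      rewrite /om /tau i0 /by_position expr2 mulfK.
        by have /andP[] := spacing_r n_gt1.
      by have /andP[/lt0r_neq0] := spacing_r n_gt1.
    by rewrite {1}i0 eqxx mul1r -addrA lerDl addr_ge0.
  - rewrite -ler_pdivrMr ?tau_gt0//; apply: (@le_trans _ _ h).
      rewrite /om /tau !by_position_right// expr2 mulfK.
        by have /andP[] := spacing_l i0 i_lt.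
      by have /andP[/lt0r_neq0] := spacing_l i0 i_lt.
    have -> : (i == n.-1 :> nat) by apply/eqP; lia.
    by rewrite mul1r addrAC lerDr addr_ge0.
  rewrite -ler_pdivrMr ?tau_gt0//.
  apply: (@le_trans _ _ (h ^+ 2 * (dl i + dr i))); last first.
    by rewrite i0 iSn lerDr addr_ge0.
  rewrite /om /tau !by_position_interior//.
  have /andP[] := spacing_l i0 i_lt; have /andP[] := spacing_r iSn.
  rewrite -/(dl i) -/(dr i); move: (dl i) (dr i) => x y y0 yh x0 xh.
  rewrite (_ : _ / _ = x * y * (x + y)); last first.
    by field; rewrite !gt_eqF// addr_gt0.
  by apply: ler_wpM2r; rewrite ?expr2 ?addr_ge0 ?ler_pM ?(ltW x0) ?(ltW y0).
apply: le_trans (ler_sum _ (fun i _ => bnd i)) _.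
rewrite !big_split/= -mulr_sumr big_split/= sum_dl sum_dr.
rewrite !sum_delta//; [|by case: n n_gt1|exact: ltnW].
move: (t n.-1 - t 0) len => L len {bnd}.
have : h * (h * (L + L)) <= h * 2.
  by rewrite ler_pM2l//; have := ler_wpM2l (ltW h0) len; lra.
lra.
Qed.

Section Weights.
Variables (theta A : R).
Hypothesis theta_gt0 : 0 < theta.
Hypothesis theta_le : theta <= A.
Hypothesis Ah : 8 * A * h <= 1.

Let th d : 0 < d <= h -> 0 < theta * d /\ 8 * (theta * d) <= 8 * A * h.
Proof.
move=> /andP[d0 dh]; split; first by rewrite mulr_gt0.
rewrite -[leRHS]mulrA; apply: ler_wpM2l => //.
by apply: ler_pM; rewrite ?(ltW theta_gt0) ?(ltW d0).
Qed.

Let rhoE i : (0 < i)%N -> rho t theta i = expR (- (theta * dl i)).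
Proof. by case: i => // i _; rewrite /rho mulNr. Qed.

Let rhorE i : (i.+1 < n)%N -> rhor n t theta i = expR (- (theta * dr i)).
Proof. by move=> iSn; rewrite /rhor iSn /rho mulNr. Qed.

Let rhor_right i : i.+1 = n -> rhor n t theta i = 0.
Proof. by rewrite /rhor => ->; rewrite ltnn. Qed.

Let sqrE (x : R) : expR (- x) ^+ 2 = expR (- (2 * x)) :> R.
Proof. by rewrite -expRM_natl mulrN. Qed.

(** In the interior [kvar] is [p * q / r], where [p], [q], [r] are the values of [1 - expR (- z)] at
    [x], [y], [x + y], each between [z * (1 - z)] and [z]. The leading term is
    [x * y / (x + y) = 2 * theta * tau i]. *)
Lemma kvar_bounds i : (i < n)%N ->
  (1 - 4 * A * h) * (2 * theta * tau i) <= kvar n t theta i <=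
  (1 + 8 * A * h) * (2 * theta * tau i).
Proof.
move=> i_lt; have h0 := h_gt0; have A0 := lt_le_trans theta_gt0 theta_le.
have Ah1 := Ah.
have endpoint d : 0 < d <= h ->
   (1 - 4 * A * h) * (2 * theta * d) <= 1 - expR (- (theta * d)) ^+ 2 <=
   (1 + 8 * A * h) * (2 * theta * d).
  move=> dh; have [td tdh] := th dh; rewrite sqrE.
  have x0 : 0 <= 2 * (theta * d) by lra.
  have := onem_expRN_le (2 * (theta * d)); have := onem_expRN_ge x0.
  have Ah0 : 0 < A * h by rewrite mulr_gt0.
  rewrite -!(mulrA _ theta d) -!(mulrA _ A h) in tdh *.
  move: (theta * d) (A * h) td tdh x0 Ah0 => x y *; apply/andP; split; nra.
rewrite /kvar /kden /tau.
have [->|i0 iSn|i0 iSn] := positionP i_lt.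
- rewrite /by_position /rho expr0n /= mul0r subr0 divr1 mul1r rhorE//.
  exact/endpoint/spacing_r.
- rewrite by_position_right// rhor_right// expr0n /= mulr0 subr0 divr1 mulr1 rhoE//.
  exact/endpoint/spacing_l.
rewrite by_position_interior// rhoE// rhorE// !sqrE -expRD.
have [x0 xh] := th (spacing_l i0 i_lt); have [y0 yh] := th (spacing_r iSn).
rewrite -/(dl i) -/(dr i) in x0 xh y0 yh *.
set x := 2 * (theta * dl i); set y := 2 * (theta * dr i).
have xp : 0 < x by rewrite /x; lra.
have yp : 0 < y by rewrite /y; lra.
have -> : - x - y = - (x + y) by ring.
have -> : 2 * theta * (dl i * dr i / (dl i + dr i)) = x * y / (x + y).
  have /andP[dl0 _] := spacing_l i0 i_lt; have /andP[dr0 _] := spacing_r iSn.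
  have s0 : dl i + dr i != 0 by rewrite gt_eqF// (addr_gt0 dl0 dr0).
  have -> : x + y = 2 * theta * (dl i + dr i) by rewrite /x /y; ring.
  by rewrite /x /y; field; rewrite s0 gt_eqF.
set e := A * h; rewrite -!(mulrA _ A h) -/e in xh yh *.
have xe : x <= 2 * e by rewrite /x; lra.
have ye : y <= 2 * e by rewrite /y; lra.
have e8 : 8 * e <= 1 by rewrite /e mulrA.
have e0 : 0 < e by rewrite mulr_gt0.
have := onem_expRN_le x; have := onem_expRN_ge (ltW xp).
have := onem_expRN_le y; have := onem_expRN_ge (ltW yp).
have xy0 : 0 < x + y by rewrite addr_gt0.
have := onem_expRN_le (x + y); have := onem_expRN_ge (ltW xy0).
move: (1 - expR (- x)) (1 - expR (- y)) (1 - expR (- (x + y))) => p q r.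
move=> r1 r2 q1 q2 p1 p2.
have p0 : 0 < p by apply: lt_le_trans p1; rewrite mulr_gt0//; lra.
have q0 : 0 < q by apply: lt_le_trans q1; rewrite mulr_gt0//; lra.
have r0 : 0 < r by apply: lt_le_trans r1; rewrite mulr_gt0//; lra.
have xyp : 0 < x * y by rewrite mulr_gt0.
apply/andP; split.
  rewrite ler_pdivlMr//; apply: (@le_trans _ _ ((1 - 4 * e) * (x * y))).
    have -> : (1 - 4 * e) * (x * y / (x + y)) * r =
              ((1 - 4 * e) * (x * y)) * (r / (x + y)) by field; rewrite gt_eqF.
    rewrite ler_piMr//; first by rewrite mulr_ge0 ?ltW//; lra.
    by rewrite ler_pdivrMr// mul1r.
  apply: (@le_trans _ _ (x * (1 - x) * (y * (1 - y)))).
    have -> : x * (1 - x) * (y * (1 - y)) = (1 - x) * (1 - y) * (x * y) by ring.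
    by rewrite ler_wpM2r ?ltW//; nra.
  by rewrite ler_pM// mulr_ge0//; lra.
rewrite ler_pdivrMr//.
have xs : x + y <= 4 * e by lra.
apply: (@le_trans _ _ (x * y)); first by rewrite ler_pM// ltW.
apply: (@le_trans _ _ ((1 + 8 * e) * (x * y / (x + y)) *
                       ((x + y) * (1 - (x + y))))); last first.
  by rewrite ler_wpM2l// mulr_ge0 ?divr_ge0 ?(ltW xyp) ?(ltW xy0)//; lra.
have -> : (1 + 8 * e) * (x * y / (x + y)) * ((x + y) * (1 - (x + y))) =
   x * y * ((1 + 8 * e) * (1 - (x + y))) by field; rewrite gt_eqF.
rewrite ler_peMr ?(ltW xyp)//.
apply: (@le_trans _ _ ((1 + 8 * e) * (1 - 4 * e))); first by nra.
by rewrite ler_wpM2l//; lra.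
Qed.

(** [6 * A ^+ 2] comes from [sinh_ratio] in the interior, [A] from [1 - expR (- theta * d) <= A * d]
    at the end points. *)
Let C1 := 6 * A ^+ 2 + A.

Lemma weight_const_ge0 : 0 <= C1.
Proof.
have A0 := lt_le_trans theta_gt0 theta_le.
by rewrite addr_ge0 ?mulr_ge0 ?sqr_ge0// ltW.
Qed.

Let ratio_sinh (u v : R) : expR (- u) * (1 - expR (- v) ^+ 2) /
  (1 - expR (- u) ^+ 2 * expR (- v) ^+ 2) = sinh v / sinh (u + v).
Proof.
rewrite -exprMn -expRD /sinh opprD.
have -> : expR v - expR (- v) = expR v * (1 - expR (- v) ^+ 2).
  by rewrite mulrBr expr2 mulrA -expRD subrr expR0; ring.
have -> : expR (u + v) - expR (- u - v) = expR (u + v) * (1 - expR (- u - v) ^+ 2).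
  by rewrite mulrBr expr2 mulrA -expRD -opprD subrr expR0; ring.
have [d0|d0] := eqVneq (1 - expR (- u - v) ^+ 2) 0.
  by rewrite d0 !mulr0 invr0 mulr0 mul0r invr0 mulr0.
move: d0; set d := 1 - expR (- u - v) ^+ 2 => d0.
rewrite expRD (expRN u); move: (expR u) (expR v) (expR_gt0 u) (expR_gt0 v).
move=> a b a0 b0; field.
by rewrite d0 !gt_eqF.
Qed.

Lemma weights_bound i : (i < n)%N ->
  `|wl n t theta i - lam i| <= C1 * om i /\ `|wr n t theta i - lam' i| <= C1 * om i.
Proof.
move=> i_lt; have h0 := h_gt0; have A0 := lt_le_trans theta_gt0 theta_le.
have Ah1 := Ah.
have om0 := om_gt0 i_lt.
have Aom d : 0 < d <= h -> `|expR (- (theta * d)) - 1| <= C1 * d.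
  move=> /andP[d0 dh]; have t0 : 0 <= theta * d by rewrite mulr_ge0 ?ltW.
  have := expRN_lipschitz t0 (lexx 0); rewrite oppr0 expR0 addr0 (ger0_norm t0).
  move=> /le_trans; apply; rewrite ler_wpM2r ?(ltW d0)//.
  by rewrite (le_trans theta_le)// /C1 lerDr mulr_ge0 ?sqr_ge0.
rewrite /wl /wr /kden /lam /lam' /om in om0 *.
have [->|i0 iSn|i0 iSn] := positionP i_lt.
- rewrite /by_position /rho expr0n /= !mul0r !subr0 normr0 divr1 mulr1.
  rewrite rhorE//; split; last exact/Aom/spacing_r.
  rewrite mulr_ge0 ?weight_const_ge0//.
  by have /andP[/ltW] := spacing_r n_gt1.
- rewrite !by_position_right// in om0 *.
  rewrite rhor_right// expr0n /= mulr0 !subr0 !divr1 mulr1 mul0r normr0 rhoE//.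
  split; first exact/Aom/spacing_l.
  by rewrite mulr_ge0 ?weight_const_ge0// ltW.
rewrite !by_position_interior// rhoE// rhorE// in om0 *.
have [x0 xh] := th (spacing_l i0 i_lt); have [y0 yh] := th (spacing_r iSn).
rewrite -/(dl i) -/(dr i) in x0 xh y0 yh *.
have /andP[dl0 _] := spacing_l i0 i_lt; have /andP[dr0 _] := spacing_r iSn.
rewrite -/(dl i) -/(dr i) in dl0 dr0.
have xb : theta * dl i <= 2^-1 by lra.
have yb : theta * dr i <= 2^-1 by lra.
have s0 : dl i + dr i != 0 by rewrite gt_eqF// (addr_gt0 dl0 dr0).
have le_C1 : 6 * (theta * dl i * (theta * dr i)) <= C1 * (dl i * dr i).
  have -> : 6 * (theta * dl i * (theta * dr i)) = 6 * theta ^+ 2 * (dl i * dr i) by ring.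
  rewrite ler_wpM2r ?(ltW om0)// /C1 -[leLHS]addr0 lerD ?(ltW A0)// ler_wpM2l//.
  by rewrite lerXn2r ?nnegrE ?(ltW A0) ?(ltW theta_gt0).
split.
  have := sinh_ratio x0 y0 xb yb; rewrite -ratio_sinh.
  have -> : theta * dr i / (theta * dl i + theta * dr i) = dr i / (dl i + dr i).
    by rewrite -mulrDr; field; rewrite s0 gt_eqF.
  by move=> /le_trans; apply.
have := sinh_ratio y0 x0 yb xb; rewrite -ratio_sinh.
have -> : theta * dl i / (theta * dr i + theta * dl i) = dl i / (dl i + dr i).
  by rewrite -mulrDr addrC; field; rewrite s0 gt_eqF.
rewrite (mulrC (expR (- (theta * dr i)) ^+ 2)) (mulrC (theta * dr i)).
by move=> /le_trans; apply.
Qed.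

End Weights.
End DesignScales.

(** * Comparison of norms and predictions for two values of theta *)

Section ChangeOfTheta.
Context {R : realType} (n : nat) (t : nat -> R).
Hypothesis n_gt1 : (1 < n)%N.
Hypothesis t_lt : forall k l, (k < l)%N -> (l < n)%N -> t k < t l.
Hypothesis t01 : forall l, (l < n)%N -> 0 <= t l <= 1.
Variables (h theta theta0 a A : R).
Hypothesis t_h : forall l, (l.+1 < n)%N -> t l.+1 - t l <= h.
Hypothesis a_gt0 : 0 < a.
Hypothesis a_le : a <= theta.
Hypothesis theta_le : theta <= A.
Hypothesis theta0_gt0 : 0 < theta0.
Hypothesis theta0_le : theta0 <= A.
Hypothesis Ah : 8 * A * h <= 1.

Let theta_gt0 : 0 < theta. Proof. exact: lt_le_trans a_le. Qed.

(** Changing [theta] changes an innovation by [O(d) * y l], with [d] the spacing and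
    [y l ^+ 2 <= q0]. Squared and divided by [ivar], of order [d], this is [O(d) * q0], which sums
    to [O(q0)] over an interval of length at most 1. *)
Lemma rkhs_le (y : nat -> R) :
  rkhs n t theta y <= (1 + 8 * A ^+ 2 / a + 4 * A / a) * rkhs n t theta0 y.
Proof.
set q0 := rkhs n t theta0 y.
have q0_ge0 : 0 <= q0 by exact: rkhs_ge0.
have A0 : 0 < A by exact: lt_le_trans theta_le.
have c0 : 0 <= 8 * A ^+ 2 / a * q0.
  have A2 : 0 <= A ^+ 2 by exact: sqr_ge0.
  exact: mulr_ge0 (divr_ge0 (mulr_ge0 (ler0n _ _) A2) (ltW a_gt0)) q0_ge0.
have term (l : 'I_n) : innov t theta y l ^+ 2 / ivar t theta l <=
    (1 + 4 * A / a) * (innov t theta0 y l ^+ 2 / ivar t theta0 l) +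
    8 * A ^+ 2 / a * q0 * (if (0 < l)%N then t l - t l.-1 else 0).
  case: l => -[|l] l_lt /=.
    rewrite /innov /ivar /rho !mul0r !subr0 expr0n subr0 divr1 mulr0 addr0.
    by rewrite mulrDl mul1r lerDl mulr_ge0 ?sqr_ge0// divr_ge0 ?mulr_ge0 ?ltW.
  have /andP[d0 dh] := spacing_r t_lt t_h l_lt.
  have iv := ivar_gt0 theta_gt0 t_lt l_lt.
  have iv0 := ivar_gt0 theta0_gt0 t_lt l_lt.
  have y_le := sqr_le_rkhs theta0_gt0 t_lt y (ltnW l_lt).
  rewrite -/q0 in y_le.
  rewrite ler_pdivrMr//.
  set u := innov t theta0 y l.+1; set d := t l.+1 - t l in d0 dh *.
  have -> : innov t theta y l.+1 = u - (rho t theta l.+1 - rho t theta0 l.+1) * y l.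
    by rewrite /u /innov /=; ring.
  have rE x : rho t x l.+1 = expR (- (x * d)) by rewrite /rho mulNr.
  have ivE x : ivar t x l.+1 = 1 - expR (- (2 * (x * d))).
    by rewrite /ivar rE -expRM_natl mulrN.
  have td0 : 0 < theta * d by rewrite mulr_gt0.
  have td00 : 0 < theta0 * d by rewrite mulr_gt0.
  have dr : `|rho t theta l.+1 - rho t theta0 l.+1| <= 2 * A * d.
    rewrite !rE; apply: le_trans (expRN_lipschitz (ltW td0) (ltW td00)) _.
    rewrite -mulrBl normrM (gtr0_norm d0) ler_wpM2r ?(ltW d0)//.
    have := theta_le; have := theta0_le; have := theta0_gt0; have := theta_gt0.
    by rewrite ler_norml => *; apply/andP; split; lra.
  set r := rho t theta l.+1 - rho t theta0 l.+1 in dr *.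
  have r2 : r ^+ 2 <= 4 * A ^+ 2 * d ^+ 2.
    have -> : 4 * A ^+ 2 * d ^+ 2 = (2 * A * d) ^+ 2 by ring.
    rewrite -(real_normK (num_real r)) lerXn2r ?nnegrE//.
    by rewrite !mulr_ge0 ?(ltW A0) ?(ltW d0).
  have ivlo : a * d <= ivar t theta l.+1.
    have tdA : theta * d <= A * h by rewrite ler_pM ?(ltW theta_gt0) ?(ltW d0).
    rewrite ivE; have x0 : 0 <= 2 * (theta * d) by lra.
    apply: le_trans (onem_expRN_ge x0).
    have h8 := Ah.
    have h1 : 4 * (theta * d) <= 1 by lra.
    have h2 : a * d <= theta * d by rewrite ler_wpM2r ?(ltW d0).
    by nra.
  have ivup : ivar t theta0 l.+1 <= 2 * A * d.
    rewrite ivE; apply: le_trans (onem_expRN_le _) _.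
    by rewrite -mulrA ler_wpM2l// ler_wpM2r ?(ltW d0).
  have sq : (u - r * y l) ^+ 2 <= 2 * u ^+ 2 + 2 * (4 * A ^+ 2 * d ^+ 2) * q0.
    have : (r * y l) ^+ 2 <= (4 * A ^+ 2 * d ^+ 2) * q0.
      by rewrite exprMn ler_pM ?sqr_ge0.
    have := sqr_ge0 (u + r * y l); lra.
  apply: (le_trans sq).
  have g1 : 2 * u ^+ 2 <= 4 * A / a * (u ^+ 2 / ivar t theta0 l.+1) * ivar t theta l.+1.
    apply: (@le_trans _ _ (4 * A / a * (u ^+ 2 / (2 * A * d)) * (a * d))).
      rewrite le_eqVlt; apply/orP; left; apply/eqP; field.
      by rewrite !gt_eqF.
    have cA : 0 <= 4 * A / a by rewrite divr_ge0 ?mulr_ge0 ?(ltW a_gt0) ?(ltW A0).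
    have dA : 0 < 2 * A * d by rewrite !mulr_gt0.
    apply: ler_pM => //.
    - by rewrite mulr_ge0// divr_ge0 ?sqr_ge0 ?(ltW dA).
    - by rewrite mulr_ge0 ?(ltW a_gt0) ?(ltW d0).
    by rewrite ler_wpM2l// ler_wpM2l ?sqr_ge0// lef_pV2 ?posrE.
  have g2 : 2 * (4 * A ^+ 2 * d ^+ 2) * q0 <= 8 * A ^+ 2 / a * q0 * d * ivar t theta l.+1.
    apply: (@le_trans _ _ (8 * A ^+ 2 / a * q0 * d * (a * d))).
      rewrite le_eqVlt; apply/orP; left; apply/eqP; field.
      by rewrite gt_eqF.
    by apply: ler_wpM2l => //; exact: mulr_ge0 c0 (ltW d0).
  have g3 : 0 <= u ^+ 2 / ivar t theta0 l.+1 * ivar t theta l.+1.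
    by rewrite mulr_ge0 ?divr_ge0 ?sqr_ge0 ?(ltW iv) ?(ltW iv0).
  move: g1 g2 g3; set p := u ^+ 2 / _; set c := ivar t theta l.+1.
  lra.
apply: le_trans (ler_sum _ (fun l _ => term l)) _.
rewrite big_split/= -!mulr_sumr (sum_dl t n_gt1) -/(rkhs n t theta0 y) -/q0.
have len : t n.-1 - t 0 <= 1.
  have /andP[_ ?] : 0 <= t n.-1 <= 1 by apply: t01; case: n n_gt1.
  have /andP[? _] : 0 <= t 0 <= 1 by apply: t01; case: n n_gt1.
  lra.
have := ler_wpM2l c0 len.
lra.
Qed.

(** For both parameters the weights are within [C * om] of the same linear interpolation weights,
    hence within [2 * C * om] of each other. *)
Lemma krig_err_diff (y : nat -> R) i : (i < n)%N ->
  (krig_err n t theta y i - krig_err n t theta0 y i) ^+ 2 <=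
  16 * (6 * A ^+ 2 + A) ^+ 2 * om n t i ^+ 2 * rkhs n t theta0 y.
Proof.
move=> i_lt; set q0 := rkhs n t theta0 y; set C := 6 * A ^+ 2 + A.
have q0_ge0 : 0 <= q0 by exact: rkhs_ge0.
have [wl1 wr1] := weights_bound n_gt1 t_lt t_h theta_gt0 theta_le Ah i_lt.
have [wl2 wr2] := weights_bound n_gt1 t_lt t_h theta0_gt0 theta0_le Ah i_lt.
have om0 := om_gt0 n_gt1 t_lt t_h i_lt.
have diff (u v w o : R) : `|u - w| <= C * o -> `|v - w| <= C * o ->
    (u - v) ^+ 2 <= 4 * C ^+ 2 * o ^+ 2.
  rewrite !ler_norml => /andP[? ?] /andP[? ?].
  have -> : 4 * C ^+ 2 * o ^+ 2 = (2 * C * o) ^+ 2 by ring.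
  have : 0 <= (2 * C * o - (u - v)) * (2 * C * o + (u - v)).
    by apply: mulr_ge0; lra.
  lra.
have dl2 := diff _ _ _ _ wl1 wl2; have dr2 := diff _ _ _ _ wr1 wr2.
rewrite /krig_err.
set p := wl n t theta i - wl n t theta0 i in dl2.
set r := wr n t theta i - wr n t theta0 i in dr2.
have -> : y i - wl n t theta i * y i.-1 - wr n t theta i * y i.+1 -
   (y i - wl n t theta0 i * y i.-1 - wr n t theta0 i * y i.+1) =
   - (p * y i.-1 + r * y i.+1) by rewrite /p /r; ring.
have yl : y i.-1 ^+ 2 <= q0.
  by apply: sqr_le_rkhs => //; apply: leq_ltn_trans i_lt; exact: leq_pred.
have K0 : 0 <= 4 * C ^+ 2 * om n t i ^+ 2 by rewrite !(sqr_ge0, mulr_ge0).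
have T1 : (p * y i.-1) ^+ 2 <= 4 * C ^+ 2 * om n t i ^+ 2 * q0.
  by rewrite exprMn ler_pM ?sqr_ge0.
have T2 : (r * y i.+1) ^+ 2 <= 4 * C ^+ 2 * om n t i ^+ 2 * q0.
  have [iSn|iSn] := ltnP i.+1 n; first by rewrite exprMn ler_pM ?sqr_ge0// sqr_le_rkhs.
  have -> : r = 0 by rewrite /r /wr /rhor ltnNge iSn/= !mul0r subrr.
  by rewrite mul0r expr0n mulr_ge0.
have := sqr_ge0 (p * y i.-1 - r * y i.+1).
rewrite sqrrN; move: T1 T2; set X := p * _; set Z := r * _; set W := _ * q0.
have -> : 16 * C ^+ 2 * om n t i ^+ 2 * q0 = 4 * W by rewrite /W; ring.
lra.
Qed.

Lemma krig_err_interp (g : nat -> R) (M : R) i : (i < n)%N ->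
  `|g i - lam n t i * g i.-1 - lam' n t i * g i.+1| <= M * om n t i ->
  (forall k, (k < n)%N -> `|g k| <= M) ->
  `|krig_err n t theta g i| <= M * (1 + 2 * (6 * A ^+ 2 + A)) * om n t i.
Proof.
move=> i_lt gi gM; set C := 6 * A ^+ 2 + A.
have [wl1 wr1] := weights_bound n_gt1 t_lt t_h theta_gt0 theta_le Ah i_lt.
have om0 := om_gt0 n_gt1 t_lt t_h i_lt.
rewrite -/C in wl1 wr1.
have -> : krig_err n t theta g i =
   (g i - lam n t i * g i.-1 - lam' n t i * g i.+1) -
   (wl n t theta i - lam n t i) * g i.-1 - (wr n t theta i - lam' n t i) * g i.+1.
  by rewrite /krig_err; ring.
have M0 : 0 <= M by apply: le_trans (gM 0%N (ltnW n_gt1)).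
have C0 : 0 <= C * om n t i by apply: le_trans wl1.
have T1 : `|(wl n t theta i - lam n t i) * g i.-1| <= C * om n t i * M.
  rewrite normrM ler_pM// gM//.
  by apply: leq_ltn_trans i_lt; exact: leq_pred.
have T2 : `|(wr n t theta i - lam' n t i) * g i.+1| <= C * om n t i * M.
  have [iSn|iSn] := ltnP i.+1 n; first by rewrite normrM ler_pM// gM.
  have i0 : (0 < i)%N by rewrite lt0n; apply: contraTneq iSn => ->; rewrite -ltnNge.
  have iE : i.+1 = n by apply/eqP; rewrite eqn_leq i_lt iSn.
  rewrite /wr /rhor ltnNge iSn/= !mul0r /lam' by_position_right// subrr mul0r.
  by rewrite normr0 mulr_ge0.
apply: le_trans (ler_normB _ _) _; apply: le_trans (lerD (ler_normB _ _) (lexx _)) _.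
lra.
Qed.

End ChangeOfTheta.

(** * Mean value and Taylor estimates on the unit interval *)

Section UnitIntervalCalculus.
Context {R : realType}.
Implicit Types (g : R -> R) (x y : R).

Lemma derivative01_linear_approx g (g' : R -> R) x e :
  derivative01 g g' -> 0 <= x <= 1 -> 0 < e ->
  exists2 d, 0 < d & forall y, 0 <= y <= 1 -> `|y - x| < d ->
    `|g y - g x - g' x * (y - x)| <= e * `|y - x|.
Proof.
move=> dg x01 e0; have x01' : (x \in `[0, 1])%R by rewrite in_itv.
have /cvgrPdist_le /(_ e e0) := dg x x01'.
rewrite !near_withinE => /nbhs_ballP[d /= d0 H]; exists d => // y y01 yd.
have [->|yx] := eqVneq y x; first by rewrite !subrr mulr0 subrr normr0 mulr0.
have y01' : `[0, 1]%classic y by rewrite /= in_itv.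
have ydx : ball x d y by rewrite /ball /= distrC.
have := H y ydx yx y01'.
have yx0 : y - x != 0 by rewrite subr_eq0.
have yx1 : 0 < `|y - x| by rewrite normr_gt0.
rewrite distrC -(ler_pM2r yx1) -normrM mulrBl divfK// => /le_trans; apply.
Qed.

Lemma derivative01_is_derive g (g' : R -> R) x : derivative01 g g' -> 0 < x < 1 ->
  is_derive x 1 g (g' x).
Proof.
move=> dg /andP[x0 x1].
have H : (h^-1 *: ((g \o shift x) (h *: 1) - g x)) @[h --> 0^'] --> g' x.
  apply/cvgrPdist_le => e e0.
  have x01 : 0 <= x <= 1 by rewrite !ltW.
  have [d d0 Hd] := derivative01_linear_approx dg x01 e0.
  rewrite near_withinE; apply/nbhs_ballP.
  exists (Num.min d (Num.min x (1 - x))) => /=.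
    by rewrite !lt_min d0 x0 subr_gt0.
  move=> h; rewrite /ball /= sub0r normrN !lt_min => /and3P[hd hx h1x] h0.
  rewrite /GRing.scale /= mulr1.
  have h_gt0 : 0 < `|h| by rewrite normr_gt0.
  have hx' : h + x - x = h by rewrite addrK.
  have := Hd (h + x); rewrite hx'.
  have -> : 0 <= h + x <= 1.
    by move: hx h1x; rewrite !ltr_norml => /andP[? ?] /andP[? ?]; apply/andP; split; lra.
  move=> /(_ erefl hd) h2.
  rewrite distrC -(ler_pM2r h_gt0) -normrM mulrBl mulrAC mulVf// mul1r.
  exact: h2.
apply: DeriveDef; first exact: (cvgP _ H).
exact: (cvg_lim _ H).
Qed.

Lemma derivative01_continuous g (g' : R -> R) x : derivative01 g g' -> 0 <= x <= 1 ->
  g @ within `[0, 1] (nbhs x) --> g x.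
Proof.
move=> dg x01; apply/cvgrPdist_lt => e e0.
have [d d0 Hd] := derivative01_linear_approx dg x01 ltr01.
rewrite near_withinE; apply/nbhs_ballP.
pose c := `|g' x| + 1.
have c0 : 0 < c by rewrite ltr_wpDl.
exists (Num.min d (e / (2 * c))) => /=; first by rewrite lt_min d0 divr_gt0 ?mulr_gt0.
move=> y; rewrite /ball /= lt_min distrC => /andP[yd ye] /=; rewrite in_itv /= => y01.
have := Hd y y01 yd; rewrite mul1r => h.
have : `|y - x| * (2 * c) < e by rewrite -ltr_pdivlMr ?mulr_gt0.
have e1 : g x - g y = - ((g y - g x - g' x * (y - x)) + g' x * (y - x)) by ring.
have := ler_normD (g y - g x - g' x * (y - x)) (g' x * (y - x)).
rewrite e1 normrN normrM => h3 h4.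
apply: (le_lt_trans h3); apply: le_lt_trans (lerD h (lexx _)) _.
apply: le_lt_trans h4; rewrite /c.
have := normr_ge0 (y - x); have := normr_ge0 (g' x); nra.
Qed.

Lemma derivative01_MVT g (g' : R -> R) x y : derivative01 g g' ->
  0 <= x -> x < y -> y <= 1 ->
  exists2 c, x <= c <= y & g y - g x = g' c * (y - x).
Proof.
move=> dg x0 xy y1.
have [||c] := @MVT R g g' x y xy; last 1 first.
- by rewrite in_itv/= => /andP[/ltW xc /ltW cy] E; exists c => //; rewrite xc.
- move=> z; rewrite in_itv/= => /andP[xz zy]; apply: derivative01_is_derive dg _.
  by rewrite (le_lt_trans x0 xz) (lt_le_trans zy y1).
apply/subspace_continuousP => z; rewrite /= in_itv/= => /andP[xz zy].
have z01 : 0 <= z <= 1 by rewrite (le_trans x0 xz) (le_trans zy y1).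
apply: cvg_trans (derivative01_continuous dg z01).
apply: cvg_app; apply: within_subset => u; rewrite /= !in_itv/= => /andP[xu uy].
by rewrite (le_trans x0 xu) (le_trans uy y1).
Qed.

Lemma derivative01_lipschitz g (g' : R -> R) M : derivative01 g g' ->
  (forall x, 0 <= x <= 1 -> `|g' x| <= M) ->
  forall x y, 0 <= x <= 1 -> 0 <= y <= 1 -> `|g y - g x| <= M * `|y - x|.
Proof.
move=> dg gM x y; wlog xy : x y / x < y => [H x01 y01|/andP[x0 _] /andP[_ y1]].
  have [xy|yx|->] := ltgtP x y; first exact: H.
    by rewrite distrC (distrC y) H.
  by rewrite !subrr normr0 mulr0.
have [c /andP[xc cy] ->] := derivative01_MVT dg x0 xy y1.
by rewrite normrM ler_wpM2r// gM// (le_trans x0 xc) (le_trans cy y1).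
Qed.

Lemma C2_bounds g : twice_continuously_differentiable01 g ->
  exists g1 : R -> R, exists2 M, 0 <= M &
    forall x y, 0 <= x <= 1 -> 0 <= y <= 1 ->
    [/\ `|g x| <= M, `|g y - g x| <= M * `|y - x| &
        `|g y - g x - g1 x * (y - x)| <= M * (y - x) ^+ 2].
Proof.
move=> [g1 [g2 [dg dg1 cg2]]].
have [M2 M20 g2M] : exists2 M, 0 <= M & forall x, 0 <= x <= 1 -> `|g2 x| <= M.
  have ng2 : {within `[0, 1], continuous (fun x => `|g2 x|)}.
    move=> x; apply: continuous_comp; first exact: cg2.
    exact: norm_continuous.
  have [c c01 H] := EVT_max ler01 ng2.
  by exists `|g2 c| => // x x01; apply: H; rewrite in_itv.
have lip1 := derivative01_lipschitz dg1 g2M.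
have O01 : 0 <= (0 : R) <= 1 by rewrite lexx ler01.
pose M1 := `|g1 0| + M2.
have M10 : 0 <= M1 by rewrite addr_ge0.
have le1 x M : 0 <= M -> 0 <= x <= 1 -> M * `|x - 0| <= M.
  by move=> M0 /andP[x0 x1]; rewrite subr0 ger0_norm// ler_piMr.
have bnd1 x : 0 <= x <= 1 -> `|g1 x| <= M1.
  move=> x01; have := lip1 0 x O01 x01; have := le1 x M2 M20 x01 => h1 h2.
  have := ler_normD (g1 0) (g1 x - g1 0); rewrite addrC subrK /M1; lra.
have lip := derivative01_lipschitz dg bnd1.
pose M := M1 + M2 + `|g 0|.
have M0 : 0 <= M by rewrite !addr_ge0.
exists g1, M => // x y x01 y01; split.
- have := lip 0 x O01 x01; have := le1 x M1 M10 x01 => h1 h2.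
  have := ler_normD (g 0) (g x - g 0); rewrite addrC subrK /M; lra.
- apply: le_trans (lip x y x01 y01) _; rewrite ler_wpM2r// /M -addrA lerDl.
  by rewrite addr_ge0.
apply: (@le_trans _ _ (M2 * (y - x) ^+ 2)); last first.
  by rewrite ler_wpM2r ?sqr_ge0// /M addrAC lerDr addr_ge0.
have [c cxy ->] : exists2 c, (0 <= c <= 1) /\ `|c - x| <= `|y - x| &
    g y - g x = g1 c * (y - x).
  move: x01 y01 => /andP[x0 x1] /andP[y0 y1]; have [xy|yx|->] := ltgtP x y.
  - have [c /andP[xc cy] E] := derivative01_MVT dg x0 xy y1; exists c => //.
    split; first by rewrite (le_trans x0 xc) (le_trans cy y1).
    by rewrite !ger0_norm ?subr_ge0 ?(ltW xy)// lerB.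
  - have [c /andP[yc cx] E] := derivative01_MVT dg y0 yx x1; exists c => //.
      split; first by rewrite (le_trans y0 yc) (le_trans cx x1).
      by rewrite !ler0_norm ?subr_le0 ?(ltW yx)// lerN2 lerB.
    by rewrite -opprB E -mulrN opprB.
  - by exists y; rewrite ?subrr ?mulr0// y0 y1.
move: cxy => [c01 cxy]; rewrite -mulrBl normrM.
have -> : (y - x) ^+ 2 = `|y - x| * `|y - x| by rewrite -expr2 real_normK ?num_real.
rewrite mulrA ler_wpM2r//; apply: le_trans (lip1 x c x01 c01) _.
by rewrite ler_wpM2l.
Qed.

End UnitIntervalCalculus.

(** Linear interpolation is exact on affine functions, so in the interior only the quadratic
    remainders [M x^2] and [M y^2] remain, and their weighted mean is exactly [M x y]. At an end
    point the Lipschitz bound is used. *)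
Lemma interpolation_bound (R : realType) (n : nat) (t : nat -> R) (g : R -> R)
    (g1 : R -> R) (M : R) :
  (1 < n)%N -> (forall k l, (k < l)%N -> (l < n)%N -> t k < t l) ->
  (forall l, (l < n)%N -> 0 <= t l <= 1) ->
  (forall x y, 0 <= x <= 1 -> 0 <= y <= 1 ->
    [/\ `|g x| <= M, `|g y - g x| <= M * `|y - x| &
        `|g y - g x - g1 x * (y - x)| <= M * (y - x) ^+ 2]) ->
  forall i, (i < n)%N ->
  `|g (t i) - lam n t i * g (t i.-1) - lam' n t i * g (t i.+1)| <= M * om n t i.
Proof.
move=> n1 t_lt t01 gM i i_lt; rewrite /lam /lam' /om.
have ti := t01 i i_lt.
have [i0|i0 iSn|i0 iSn] := positionP i_lt.
- rewrite i0 /by_position mul0r subr0 mul1r in ti *.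
  have [_ + _] := gM _ _ ti (t01 1%N n1).
  rewrite distrC [`|t 1 - _|]ger0_norm// subr_ge0; exact/ltW/t_lt.
- rewrite !by_position_right// mul0r subr0 mul1r.
  have i1 : (i.-1 < i)%N by rewrite prednK.
  have [_ + _] := gM _ _ (t01 _ (ltn_trans i1 i_lt)) ti.
  rewrite [`|t i - _|]ger0_norm// subr_ge0; exact/ltW/t_lt.
rewrite !by_position_interior//.
have i1 : (i.-1 < i)%N by rewrite prednK.
have [_ _ Hl] := gM _ _ ti (t01 _ (ltn_trans i1 i_lt)).
have [_ _ Hr] := gM _ _ ti (t01 _ iSn).
have dl0 : 0 < t i - t i.-1 by rewrite subr_gt0 t_lt.
have dr0 : 0 < t i.+1 - t i by rewrite subr_gt0 t_lt.
set x := t i - t i.-1 in dl0 *; set y := t i.+1 - t i in dr0 Hr *.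
have xE : t i.-1 - t i = - x by rewrite /x opprB.
rewrite xE sqrrN in Hl.
set A := g (t i.-1) - g (t i) - _ in Hl; set B := g (t i.+1) - _ - _ in Hr.
have s0 : 0 < x + y by rewrite addr_gt0.
have -> : g (t i) - y / (x + y) * g (t i.-1) - x / (x + y) * g (t i.+1) =
   - (y / (x + y) * A + x / (x + y) * B).
  by rewrite /A /B; field; rewrite gt_eqF.
rewrite normrN; apply: le_trans (ler_normD _ _) _.
rewrite !normrM !normfV !(gtr0_norm dr0, gtr0_norm dl0, gtr0_norm s0).
have w1 : 0 <= y / (x + y) by rewrite divr_ge0 ?ltW.
have w2 : 0 <= x / (x + y) by rewrite divr_ge0 ?ltW.
apply: le_trans (lerD (ler_wpM2l w1 Hl) (ler_wpM2l w2 Hr)) _.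
rewrite le_eqVlt; apply/orP; left; apply/eqP; field; by rewrite gt_eqF.
Qed.

(** * Uniform lower bound on the Gram matrices *)

Section InvertibleSample.
Context {R : realType} (p : nat) (f : 'I_p -> R -> R).
Hypothesis f_indep : linearly_independent01 f.

Let frow (x : R) : 'rV[R]_p := \row_k f k x.

(** With fewer than [p] rows some nonzero [c] is orthogonal to all of them; by linear independence
    the combination [c] of the functions is nonzero at some [u], and the row at [u] can be added. *)
Lemma row_free_sample m : (m <= p)%N ->
  exists2 x : 'I_m -> R, forall j, 0 <= x j <= 1 &
    row_free (\matrix_(j, k) f k (x j)).
Proof.
elim: m => [|m IH] mp.
  exists (fun=> 0) => [[]//|]; apply: inj_row_free => v _.
  by apply/rowP => -[].
have [x x01 xfree] := IH (ltnW mp).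
set M := \matrix_(j, k) f k (x j) in xfree.
have [c c0 Mc] : exists2 c : 'cV[R]_p, c != 0 & M *m c = 0.
  have : kermx M^T != 0.
    rewrite -mxrank_eq0 mxrank_ker mxrank_tr -lt0n subn_gt0.
    by rewrite (leq_ltn_trans _ mp)// rank_leq_row.
  move=> /rowV0Pn[v /sub_kermxP vM v0]; exists v^T.
    by rewrite -(inj_eq trmx_inj) trmxK trmx0.
  by apply: trmx_inj; rewrite trmx_mul trmxK vM trmx0.
have [u u01 uc] : exists2 u, 0 <= u <= 1 & (frow u *m c) 0 0 != 0.
  apply: contrapT => H; move/negP: c0; apply; apply/eqP/colP => k.
  rewrite mxE; move: k; apply: f_indep => u; rewrite in_itv/= => u01.
  apply: contrapT => fu; apply: H; exists u => //; apply/eqP => fu0.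
  by apply: fu; rewrite -[RHS]fu0 mxE; apply: eq_bigr => k _; rewrite mxE mulrC.
pose x' (j : 'I_(m + 1)) := match fintype.split j with inl i => x i | inr _ => u end.
have x'01 j : 0 <= x' j <= 1 by rewrite /x'; case: (fintype.split j).
have x'E : \matrix_(j, k) f k (x' j) = col_mx M (frow u).
  apply/matrixP => j k; rewrite !mxE /x'; case: (fintype.split j) => i; by rewrite mxE.
have free : row_free (\matrix_(j, k) f k (x' j)).
  apply: inj_row_free => v; rewrite x'E -[v]hsubmxK mul_row_col.
  set v1 := lsubmx v; set v2 := rsubmx v => E.
  have v20 : v2 = 0.
    have := congr1 (fun z => (z *m c) 0 0) E.
    rewrite mulmxDl -!mulmxA Mc mulmx0 add0r mul0mx mxE big_ord1 [X in _ = X]mxE.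
    move=> /eqP; rewrite mulf_eq0 (negPf uc) orbF => /eqP v00.
    by apply/rowP => k; rewrite ord1 v00 mxE.
  move: E; rewrite v20 mul0mx addr0 => v1M.
  have -> : v1 = 0 by apply: (row_free_inj xfree); rewrite v1M mul0mx.
  by rewrite row_mx0.
by move: x' x'01 free {x'E}; rewrite addn1 => x' x'01 free; exists x'.
Qed.

Lemma unit_sample : exists2 x : 'I_p -> R, forall j, 0 <= x j <= 1 &
  (\matrix_(j, k) f k (x j)) \in unitmx.
Proof.
by have [x x01 xfree] := row_free_sample (leqnn p); exists x; rewrite // -row_free_unit.
Qed.

End InvertibleSample.

Lemma sum_cauchy_schwarz (R : realType) n (a b : 'I_n -> R) :
  (\sum_i a i * b i) ^+ 2 <= (\sum_i a i ^+ 2) * (\sum_i b i ^+ 2).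
Proof.
have q1 (c : 'I_n -> R) : quad 1%:M (\col_i c i) = \sum_i c i ^+ 2.
  by rewrite /quad mulmx1 mxE; apply: eq_bigr => i _; rewrite !mxE expr2.
have psd1 : psd (1%:M : 'M[R]_n).
  split=> [|x]; first by rewrite trmx1.
  rewrite /quad mulmx1 mxE; apply: sumr_ge0 => i _.
  by rewrite mxE -expr2 sqr_ge0.
have := psd_cauchy_schwarz (\col_i a i) (\col_i b i) psd1.
rewrite !q1 mulmx1 mxE (_ : \sum_j _ = \sum_i a i * b i)//.
by apply: eq_bigr => i _; rewrite !mxE.
Qed.

(** Both ends of the design interval containing [x] are within [h] of it, and at most one of them
    has index [i]. *)
Lemma design_near (R : realType) (n : nat) (t : nat -> R) (h x : R) (i : nat) :
  (1 < n)%N -> (forall k l, (k < l)%N -> (l < n)%N -> t k < t l) ->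
  (forall l, (l.+1 < n)%N -> t l.+1 - t l <= h) ->
  t 0 <= x <= t n.-1 ->
  exists l, [/\ (l < n)%N, l != i & `|x - t l| <= h].
Proof.
move=> n1 t_lt t_h /andP[x0 xn].
have [l ln /andP[tl tl1]] : exists2 l, (l.+1 < n)%N & t l <= x <= t l.+1.
  have : exists k, (k < n)%N && (x <= t k) by exists n.-1; rewrite xn andbT prednK// ltnW.
  move=> H; case: (ex_minnP H) => -[|k] /andP[kn xk] kmin.
    exists 0%N => //; rewrite x0/= (le_trans xk)//; exact/ltW/t_lt.
  exists k => //; rewrite xk andbT leNgt; apply/negP => xk1.
  by have := kmin k; rewrite (ltnW kn) (ltW xk1) ltnn => /(_ isT).
have d := t_h l ln.
have [li|li] := eqVneq l i.
  exists l.+1; split => //; first by rewrite -li gtn_eqF.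
  rewrite ler0_norm; lra.
exists l; split => //; first exact: ltnW.
rewrite ger0_norm; lra.
Qed.

Section GramLowerBound.
Context {R : realType} (p : nat) (f : 'I_p -> R -> R).
Hypothesis f_indep : linearly_independent01 f.
Variable M : R.
Hypothesis f_lip : forall k x y, 0 <= x <= 1 -> 0 <= y <= 1 ->
  `|f k y - f k x| <= M * `|y - x|.
Hypothesis M_ge0 : 0 <= M.

(* A left-out point leaves the other neighbour of each sample point [x j], so
   the bound is uniform in the left-out index. *)
Lemma loo_gram_lower_bound : exists kappa h0 : R, [/\ 0 < kappa, 0 < h0 &
  forall (n : nat) (t : nat -> R) (h theta : R) (i : 'I_n),
    (1 < n)%N -> (forall k l, (k < l)%N -> (l < n)%N -> t k < t l) ->
    (forall l, (l.+1 < n)%N -> t l.+1 - t l <= h) ->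
    t 0 = 0 -> t n.-1 = 1 -> 0 <= h <= h0 -> 0 < theta ->
    forall v : 'cV[R]_p, kappa * \sum_k v k 0 ^+ 2 <=
      quad (loo_gram_mx f (fun i : 'I_n => t i) theta i) v].
Proof.
have [x x01 xunit] := unit_sample f_indep.
set X := \matrix_(j, k) f k (x j) in xunit.
pose C := \sum_k \sum_j (invmx X k j) ^+ 2.
have C0 : 0 <= C by apply: sumr_ge0 => k _; apply: sumr_ge0 => j _; exact: sqr_ge0.
have norm_le (v : 'cV[R]_p) :
    \sum_k v k 0 ^+ 2 <= C * \sum_j ((X *m v) j 0) ^+ 2.
  rewrite /C mulr_suml; apply: ler_sum => k _.
  have -> : v k 0 = \sum_j invmx X k j * (X *m v) j 0.
    by rewrite -[in LHS](mulKmx xunit v) mxE.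
  exact: sum_cauchy_schwarz.
pose P : R := p%:R.
have P0 : 0 <= P by rewrite ler0n.
(* Chosen so that for [h <= D^-1] and [h <= 1] the discretization error, see [small], is at most
   [S / 2] and is absorbed by [S]. The [+ 1] keep [D] positive. *)
pose D := 4 * (C + 1) * (P + 1) ^+ 2 * (M + 1) ^+ 2.
have D0 : 0 < D.
  by rewrite /D !mulr_gt0// ?exprn_gt0// ltr_wpDl.
exists (4 * (C + 1) * (P + 1))^-1, (Num.min 1 D^-1); split.
- by rewrite invr_gt0 !mulr_gt0// ltr_wpDl.
- by rewrite lt_min ltr01 invr_gt0.
move=> n t h theta i n1 t_lt t_h t0 tn /andP[h0]; rewrite le_min => /andP[h1 hD] theta0 v.
set G := quad _ v; set S := \sum_k _.
have S0 : 0 <= S by apply: sumr_ge0 => k _; exact: sqr_ge0.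
have t01 l : (l < n)%N -> 0 <= t l <= 1.
  move=> ln; have le k m : (k <= m)%N -> (m < n)%N -> t k <= t m.
    by rewrite leq_eqVlt => /predU1P[->//|km] mn; rewrite ltW// t_lt.
  have nn : (n.-1 < n)%N by rewrite prednK// ltnW.
  have l_le : (l <= n.-1)%N by rewrite -ltnS prednK// ltnW.
  by apply/andP; split; [rewrite -t0 le|rewrite -tn le].
have KiE : loo_corr_mx (fun i : 'I_n => t i) theta i =
    kmx n.-1 (fun k => t (bump i k)) theta by rewrite /loo_corr_mx -loo_kmx.
have GE : G = quad (invmx (loo_corr_mx (fun i : 'I_n => t i) theta i))
    (loo_design_mx f (fun i : 'I_n => t i) i *m v).
  by rewrite /G /quad /loo_gram_mx trmx_mul !mulmxA.
(* By [sqr_entry_le], [G] dominates the squared value of the combination [v] at any remaining design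
   point; the Lipschitz bound carries this over to [x j]. *)
have entry (j : 'I_p) : ((X *m v) j 0) ^+ 2 <= 2 * G + 2 * (M * h) ^+ 2 * P * S.
  have xj : t 0 <= x j <= t n.-1 by rewrite t0 tn.
  have [l [ln li lx]] := design_near i n1 t_lt t_h xj.
  have [l' l'E|l'E] := unliftP i (Ordinal ln); last first.
    by move: li; rewrite -l'E /= eqxx.
  have tl : t (bump i l') = t l by rewrite -[bump i l']/(lift i l' : nat) -l'E.
  set y := (loo_design_mx f (fun i : 'I_n => t i) i *m v) l' 0.
  have yG : y ^+ 2 <= G.
    rewrite GE KiE; apply: sqr_entry_le => // k m km mn; exact: bump_lt.
  have yE : y = \sum_k f k (t l) * v k 0.
    by rewrite /y mxE; apply: eq_bigr => k _; rewrite !mxE /= tl.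
  have dE : (X *m v) j 0 - y = \sum_k (f k (x j) - f k (t l)) * v k 0.
    rewrite yE mxE -sumrB; apply: eq_bigr => k _; by rewrite mxE mulrBl.
  have d2 : ((X *m v) j 0 - y) ^+ 2 <= (M * h) ^+ 2 * P * S.
    rewrite dE; apply: le_trans (sum_cauchy_schwarz _ _) _.
    rewrite ler_wpM2r//.
    have fk k : (f k (x j) - f k (t l)) ^+ 2 <= (M * h) ^+ 2.
      rewrite -(real_normK (num_real (_ - _))) lerXn2r ?nnegrE ?mulr_ge0//.
      apply: le_trans (f_lip _ (t01 l ln) (x01 j)) _.
      by rewrite ler_wpM2l.
    apply: le_trans (ler_sum _ (fun k _ => fk k)) _.
    by rewrite sumr_const card_ord mulr_natr.
  have := sqr_ge0 ((X *m v) j 0 - 2 * y); lra.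
have S_le : S <= C * (P * (2 * G + 2 * (M * h) ^+ 2 * P * S)).
  apply: le_trans (norm_le v) _; rewrite ler_wpM2l//.
  apply: le_trans (ler_sum _ (fun j _ => entry j)) _.
  by rewrite sumr_const card_ord -[leLHS]mulr_natl.
have G0 : 0 <= G.
  have Ku : kmx n.-1 (fun k => t (bump i k)) theta \in unitmx.
    by apply: kmx_unit => // k m; exact: bump_lt.
  have Kp : psd (kmx n.-1 (fun k => t (bump i k)) theta).
    by apply: kmx_psd => // k m; exact: bump_lt.
  by rewrite GE KiE; case: (psd_invmx Kp Ku) => _; exact.
have small : C * (P * (2 * (M * h) ^+ 2 * P * S)) <= 2^-1 * S.
  have -> : C * (P * (2 * (M * h) ^+ 2 * P * S)) = 2 * (C * P ^+ 2 * M ^+ 2 * h ^+ 2) * S by ring.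
  rewrite ler_wpM2r//.
  have hD' : h * D <= 1 by rewrite -ler_pdivlMr// div1r.
  have h2 : h ^+ 2 <= h by rewrite expr2 ler_piMr.
  have c1 : C * P ^+ 2 * M ^+ 2 <= (C + 1) * (P + 1) ^+ 2 * (M + 1) ^+ 2.
    apply: ler_pM; rewrite ?mulr_ge0 ?sqr_ge0//.
      apply: ler_pM; rewrite ?sqr_ge0//; first by rewrite lerDl.
      by rewrite lerXn2r ?nnegrE ?addr_ge0// lerDl.
    by rewrite lerXn2r ?nnegrE ?addr_ge0// lerDl.
  have K0 : 0 <= C * P ^+ 2 * M ^+ 2 by rewrite !(mulr_ge0, sqr_ge0).
  have k1 : C * P ^+ 2 * M ^+ 2 * h ^+ 2 <= (C + 1) * (P + 1) ^+ 2 * (M + 1) ^+ 2 * h.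
    by apply: ler_pM => //; exact: sqr_ge0.
  have k2 : (C + 1) * (P + 1) ^+ 2 * (M + 1) ^+ 2 * h * 4 <= 1.
    by apply: le_trans hD'; rewrite /D le_eqVlt; apply/orP; left; apply/eqP; ring.
  lra.
have S_le2 : S <= 4 * (C * (P * G)).
  move: S_le small; rewrite !mulrDr => a1 a2; lra.
rewrite mulrC ler_pdivrMr; last by rewrite !mulr_gt0// ltr_wpDl.
apply: (le_trans S_le2).
rewrite (_ : 4 * (C * (P * G)) = G * (4 * C * P)); last by ring.
rewrite ler_wpM2l//; apply: ler_pM; rewrite ?mulr_ge0//; last by rewrite lerDl.
by rewrite ler_wpM2l// lerDl.
Qed.

End GramLowerBound.

Lemma unitmx_of_quad_ge (R : realType) n (G : 'M[R]_n) (kappa : R) :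
  0 < kappa -> (forall v : 'cV[R]_n, kappa * \sum_k v k 0 ^+ 2 <= quad G v) -> G \in unitmx.
Proof.
move=> k0 H; rewrite -row_free_unit; apply: inj_row_free => v vG.
have := H v^T; rewrite /quad trmxK vG mul0mx mxE pmulr_rle0// => S_le0.
apply/rowP => k; rewrite mxE; apply/eqP; rewrite -sqrf_eq0; apply/eqP/le_anti.
rewrite sqr_ge0 andbT; apply: le_trans S_le0.
rewrite (bigD1 k)//= mxE lerDl; apply: sumr_ge0 => j _; exact: sqr_ge0.
Qed.

(** * Expansion of the score *)

Section LeaveOneOutScore.
Context {R : realType} (p n : nat) (f : 'I_p -> R -> R) (t : nat -> R).
Variables (theta sigma2 : R) (beta : 'cV[R]_p) (i : 'I_n).
Hypothesis theta_gt0 : 0 < theta.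
Hypothesis sigma2_gt0 : 0 < sigma2.
Hypothesis t_lt : forall k l, (k < l)%N -> (l < n)%N -> t k < t l.
Hypothesis t01 : forall l, (l < n)%N -> 0 <= t l <= 1.
Local Notation s := (fun i : 'I_n => t i).
Hypothesis G_unit : loo_gram_mx f s theta i \in unitmx.

Lemma loo_mseE : loo_mse f s beta theta sigma2 i =
  sigma2 * (kvar n t theta i + gam f t theta i).
Proof.
rewrite /loo_mse (@model_expectation_quadratic _ _ _ _ s (ecoef f t theta i))//.
- by rewrite -ecoef_var.
- by move=> j; rewrite in_itv/= t01.
move=> y; have := loo_pred_observations theta_gt0 t_lt G_unit beta y.
by move=> /= ->; rewrite sqrrN.
Qed.

Lemma loo_residualE (y : R -> R) : let z := observations f s beta y in
  (z i 0 - loo_pred f s theta i z) ^+ 2 =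
  (krig_err n t theta (y \o t) i -
    (gvec f t theta i *m bmx f t theta i *m vecn n (y \o t)) 0 0) ^+ 2.
Proof.
move=> z; have := loo_pred_observations theta_gt0 t_lt G_unit beta y.
rewrite -/z -[_ - loo_pred _ _ _ _ _]opprB sqrrN /= => ->; rewrite sqrrN.
have D (u v : 'M[R]_1) : (u - v) 0 0 = u 0 0 - v 0 0 by rewrite !mxE.
rewrite /ecoef mulmxBl D (@kvec_mul _ _ _ _ _ _ (y \o t))// => k.
by rewrite mxE.
Qed.

End LeaveOneOutScore.

Lemma ln1D_bound (R : realType) (d e : R) : `|d| <= e -> e <= 2^-1 ->
  `|ln (1 + d)| <= 2 * e.
Proof.
rewrite ler_norml => /andP[d1 d2] e1; have p0 : 0 < 1 + d by lra.
rewrite ler_norml; apply/andP; split; last first.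
  by apply: le_trans (le_ln1Dx _) _; lra.
have := @le_ln1Dx R ((1 + d)^-1 - 1).
have -> : 1 + ((1 + d)^-1 - 1) = (1 + d)^-1 by ring.
rewrite lnV ?posrE// => H.
have i0 : 0 < (1 + d)^-1 by rewrite invr_gt0.
have : (1 + d)^-1 - 1 <= 2 * e.
  rewrite lerBlDr -(ler_pM2r p0) mulVf ?gt_eqF//; nra.
by have := H ltac:(lra); lra.
Qed.

(** One summand of the score: [m] is the mean square error at the current parameters, [x] their
    product, [e] and [E] the prediction errors at the current [theta] and at [theta0], [k0] the
    known-mean variance at [theta0]. The parameter [eta] trades a relative error on [E ^+ 2] against
    [D / eta]. *)
Lemma score_term (R : realType) (x tau theta0 d d0 E e eta D eps m k0 : R) :
  0 < x -> 0 < tau -> 0 < theta0 -> `|d| <= eps -> `|d0| <= eps -> eps <= 2^-1 ->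
  0 < eta -> eta <= 1 -> (e - E) ^+ 2 <= D ->
  m = 2 * tau * x * (1 + d) -> k0 = 2 * theta0 * tau * (1 + d0) ->
  `|ln m + e ^+ 2 / m - (ln (2 * tau) + ln x + theta0 * (E ^+ 2 / k0) / x)| <=
  2 * eps + (4 * (eps + eta) * (theta0 * (E ^+ 2 / k0)) + 2 * (D / (tau * eta))) / x.
Proof.
move=> x0 tau0 th0 dle d0le epsle eta0 eta1 eE -> ->.
have eps0 : 0 <= eps by apply: le_trans dle.
have lnd := ln1D_bound dle epsle.
have /andP[d1 d2] : - eps <= d <= eps by rewrite -ler_norml.
have /andP[e1 e2] : - eps <= d0 <= eps by rewrite -ler_norml.
have p0 : 0 < 1 + d by lra. have p00 : 0 < 1 + d0 by lra.
have t2 : 0 < 2 * tau by lra.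
rewrite !lnM ?posrE ?mulr_gt0//.
set V := E ^+ 2 / _.
have K0 : 0 < 2 * theta0 * tau * (1 + d0) by rewrite !mulr_gt0.
have V0 : 0 <= V by rewrite divr_ge0 ?sqr_ge0 ?ltW.
have EV : E ^+ 2 = 2 * tau * (theta0 * V * (1 + d0)).
  by rewrite /V; field; rewrite !gt_eqF.
set W := theta0 * V in EV *.
have W0 : 0 <= W by exact: mulr_ge0 (ltW th0) V0.
have D0 : 0 <= D by apply: le_trans eE; exact: sqr_ge0.
set Q := D / (tau * eta).
have DQ : D = tau * eta * Q by rewrite /Q; field; rewrite !gt_eqF.
have Q0 : 0 <= Q by rewrite divr_ge0// ltW// mulr_gt0.
pose Z := e ^+ 2 / (2 * tau).
have Z0 : 0 <= Z by rewrite divr_ge0 ?sqr_ge0 ?ltW.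
have eZ : e ^+ 2 = 2 * tau * Z by rewrite /Z; field; rewrite gt_eqF.
(* Young's inequality multiplied through by [eta]; [sq2] is its lower counterpart. *)
have sq1 (u v : R) : eta * (u + v) ^+ 2 <= eta * ((1 + eta) * u ^+ 2) + (eta + 1) * v ^+ 2.
  have := sqr_ge0 (eta * u - v); lra.
have sq2 (u v : R) : eta * ((1 - eta) * u ^+ 2) - (1 - eta) * v ^+ 2 <= eta * (u + v) ^+ 2.
  have : 0 <= (eta * u + v) ^+ 2 by exact: sqr_ge0.
  lra.
have Ee : E + (e - E) = e by ring.
have Zup : Z <= (1 + eta) * (W * (1 + d0)) + Q.
  have := sq1 E (e - E); rewrite Ee eZ EV => h.
  have : (eta + 1) * (e - E) ^+ 2 <= 2 * D.
    have := ler_wpM2l (ltW eta0) eE; nra.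
  rewrite DQ => h2.
  have : (2 * tau * eta) * Z <= (2 * tau * eta) * ((1 + eta) * (W * (1 + d0)) + Q) by lra.
  by rewrite ler_pM2l// mulr_gt0.
have Zlo : (1 - eta) * (W * (1 + d0)) - Q <= Z.
  have := sq2 E (e - E); rewrite Ee eZ EV => h.
  have : (1 - eta) * (e - E) ^+ 2 <= 2 * D.
    have : (1 - eta) * (e - E) ^+ 2 <= 1 * (e - E) ^+ 2.
      by rewrite ler_wpM2r ?sqr_ge0//; lra.
    lra.
  rewrite DQ => h2.
  have : (2 * tau * eta) * ((1 - eta) * (W * (1 + d0)) - Q) <= (2 * tau * eta) * Z by lra.
  by rewrite ler_pM2l// mulr_gt0.
pose r := (1 + d)^-1.
have r1 : r <= 1 + 2 * eps by rewrite -(ler_pM2r p0) mulVf ?gt_eqF//; nra.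
have r2 : 1 - eps <= r by rewrite -(ler_pM2r p0) mulVf ?gt_eqF//; nra.
have r0 : 0 < r by rewrite invr_gt0.
have -> : e ^+ 2 / (2 * tau * x * (1 + d)) = Z * r / x.
  by rewrite eZ /r; field; rewrite !gt_eqF.
have Wd : W * (1 + d0) <= W * (1 + eps) by rewrite ler_wpM2l//; lra.
have Wd' : W * (1 - eps) <= W * (1 + d0) by rewrite ler_wpM2l//; lra.
have up : Z * r - W <= 4 * (eps + eta) * W + 2 * Q.
  have h1 : Z <= (1 + eta) * (W * (1 + eps)) + Q.
    apply: le_trans Zup _; rewrite lerD2r ler_wpM2l//; lra.
  have h2 : Z * r <= ((1 + eta) * (W * (1 + eps)) + Q) * (1 + 2 * eps).
    by apply: ler_pM => //; exact: ltW.
  have h3 : (1 + eta) * (1 + eps) * (1 + 2 * eps) <= 1 + 4 * (eps + eta).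
    have u1 : (1 + eps) * (1 + 2 * eps) <= 1 + 4 * eps by nra.
    have : (1 + eta) * ((1 + eps) * (1 + 2 * eps)) <= (1 + eta) * (1 + 4 * eps).
      by rewrite ler_wpM2l//; lra.
    have : eta * eps <= eta * 2^-1 by rewrite ler_wpM2l// ltW.
    lra.
  have := ler_wpM2l W0 h3.
  have : Q * (1 + 2 * eps) <= Q * 2 by rewrite ler_wpM2l//; lra.
  lra.
have lo : - (4 * (eps + eta) * W + 2 * Q) <= Z * r - W.
  have h1 : (1 - eta) * (W * (1 - eps)) - Q <= Z.
    apply: le_trans Zlo; rewrite lerD2r ler_wpM2l//; lra.
  have h2 : (1 - eps) * Z <= Z * r by rewrite mulrC ler_wpM2l.
  have h3 : (1 - eps) * ((1 - eta) * (W * (1 - eps)) - Q) <= (1 - eps) * Z.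
    by rewrite ler_wpM2l//; lra.
  have h4 : 1 - 4 * (eps + eta) <= (1 - eps) * ((1 - eta) * (1 - eps)).
    have : eps * eta <= eps * 1 by rewrite ler_wpM2l.
    have : eps * eta * eps <= eps * eta * 2^-1 by rewrite ler_wpM2l// mulr_ge0// ltW.
    have : 0 <= eps ^+ 2 by exact: sqr_ge0.
    have : 0 <= eps * eta by rewrite mulr_ge0// ltW.
    nra.
  have := ler_wpM2l W0 h4.
  have : (1 - eps) * Q <= 1 * Q by rewrite ler_wpM2r//; lra.
  lra.
apply: (@le_trans _ _ `|ln (1 + d) + (Z * r - W) / x|).
  by rewrite le_eqVlt; apply/orP; left; apply/eqP; congr (`|_|); rewrite mulrBl; ring.
apply: le_trans (ler_normD _ _) _; apply: lerD => //.
rewrite normrM [`|x^-1|]gtr0_norm ?invr_gt0// ler_pM2r ?invr_gt0//.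
by rewrite ler_norml lo up.
Qed.

Section ScoreExpansion.
Context {R : realType} (p : nat) (f : 'I_p -> R -> R) (M kappa : R).
Variables (g1 : 'I_p -> R -> R) (theta0 a A b : R).
Hypothesis f_C2 : forall k x y, 0 <= x <= 1 -> 0 <= y <= 1 ->
    [/\ `|f k x| <= M, `|f k y - f k x| <= M * `|y - x| &
        `|f k y - f k x - g1 k x * (y - x)| <= M * (y - x) ^+ 2].
Hypothesis M_ge0 : 0 <= M.
Hypothesis kappa_gt0 : 0 < kappa.
Hypothesis theta0_gt0 : 0 < theta0.
Hypothesis theta0_le : theta0 <= A.
Hypothesis a_gt0 : 0 < a.
Hypothesis b_gt0 : 0 < b.

Definition krig_stat n (t : nat -> R) (y : nat -> R) : R :=
  \sum_(i < n) krig_err n t theta0 y i ^+ 2 / kvar n t theta0 i.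

Definition score_offset n (t : nat -> R) : R :=
  \sum_(i < n) ln (2 * tau n t i).

(** [C1] bounds the change of weights, [Cg] bounds [gam] by [om ^+ 2], [Ck] compares norms, [Ce]
    bounds the squared change of the prediction error ([2 * 16 * C1 ^+ 2] for [theta], the rest for
    the mean) and [Cd] the relative change of the variance. *)
Let C1 := 6 * A ^+ 2 + A.
Let Cg := p%:R * (M * (1 + 2 * C1)) ^+ 2 / kappa.
Let Ck := 1 + 8 * A ^+ 2 / a + 4 * A / a.
Let Ce := 32 * C1 ^+ 2 + 2 * Cg * Ck.
Let Cd := 8 * A + Cg / a.

Lemma score_expansion (n : nat) (t : nat -> R) (h theta sigma2 : R)
    (beta : 'cV[R]_p) (y : R -> R) :
  (1 < n)%N -> (forall k l, (k < l)%N -> (l < n)%N -> t k < t l) ->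
  (forall l, (l < n)%N -> 0 <= t l <= 1) ->
  (forall l, (l.+1 < n)%N -> t l.+1 - t l <= h) ->
  h <= 1 -> 8 * A * h <= 1 -> Cd * h <= 2^-1 ->
  (forall (i : 'I_n) (v : 'cV[R]_p), kappa * \sum_k v k 0 ^+ 2 <=
      quad (loo_gram_mx f (fun i : 'I_n => t i) theta i) v) ->
  a <= theta <= A -> b <= sigma2 ->
  `|loo_log_score f (fun i : 'I_n => t i) beta
      (observations f (fun i : 'I_n => t i) beta y) theta sigma2 -
    (score_offset n t + n%:R * ln (theta * sigma2) +
     theta0 * krig_stat n t (y \o t) / (theta * sigma2))| <=
  (2 * Cd * n%:R + (4 * (Cd + 1) * theta0 * krig_stat n t (y \o t) +
     8 * Ce * rkhs n t theta0 (y \o t)) / (a * b)) * Num.sqrt h.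
Proof.
move=> n1 t_lt t01 t_h h1 Ah Cdh gramH /andP[a_le theta_le] b_le.
set s := fun i : 'I_n => t i; set yt := y \o t; set V := krig_stat n t yt.
set q0 := rkhs n t theta0 yt; set x := theta * sigma2.
have theta_gt0 : 0 < theta by exact: lt_le_trans a_le.
have sigma2_gt0 : 0 < sigma2 by exact: lt_le_trans b_le.
have A0 : 0 < A by exact: lt_le_trans theta_le.
have x0 : 0 < x by rewrite mulr_gt0.
have h0 : 0 < h by exact: h_gt0 t_h.
have C10 : 0 <= C1.
  by have := sqr_ge0 A; rewrite /C1; lra.
have Cg0 : 0 <= Cg.
  exact: divr_ge0 (mulr_ge0 (ler0n _ _) (sqr_ge0 _)) (ltW kappa_gt0).
have Ck0 : 0 <= Ck.
  have : 0 <= 8 * A ^+ 2 / a by exact: divr_ge0 (mulr_ge0 (ler0n _ _) (sqr_ge0 _)) (ltW _).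
  have : 0 <= 4 * A / a by rewrite divr_ge0 ?mulr_ge0 ?(ltW A0) ?(ltW a_gt0).
  by rewrite /Ck; lra.
have Ce0 : 0 <= Ce.
  have : 0 <= Cg * Ck by exact: mulr_ge0.
  by have := sqr_ge0 C1; rewrite /Ce; lra.
have Cga0 : 0 <= Cg / a by rewrite divr_ge0 ?(ltW a_gt0).
have Cd0 : 0 <= Cd by rewrite /Cd; lra.
have q00 : 0 <= q0 by exact: rkhs_ge0.
have Gu (i : 'I_n) : loo_gram_mx f s theta i \in unitmx.
  exact: unitmx_of_quad_ge kappa_gt0 (gramH i).
have gv (i : 'I_n) k : gvec f t theta i 0 k ^+ 2 <= (M * (1 + 2 * C1) * om n t i) ^+ 2.
  have -> : gvec f t theta i 0 k = krig_err n t theta (f k \o t) i.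
    have -> : gvec f t theta i 0 k = (kvec t theta i *m col k (design_mx f s)) 0 0.
      rewrite /gvec !mxE; apply: eq_bigr => j _; by rewrite [col _ _ _ _]mxE.
    by apply: kvec_mul => j; rewrite !mxE.
  have om0 := om_gt0 n1 t_lt t_h (ltn_ord i).
  rewrite -(real_normK (num_real _)) lerXn2r ?nnegrE//.
    rewrite mulr_ge0 ?(ltW om0)// mulr_ge0//; lra.
  apply: (krig_err_interp n1 t_lt t_h a_gt0 a_le theta_le Ah (ltn_ord i)) => /=.
    exact: (interpolation_bound n1 t_lt t01 (f_C2 k) (ltn_ord i)).
  by move=> l ln; have [] := f_C2 k (t01 l ln) (t01 l ln).
have gam_om (i : 'I_n) : gam f t theta i <= Cg * om n t i ^+ 2.
  have := gam_le theta_gt0 t_lt (Gu i) kappa_gt0 (gramH i) (gv i).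
  move=> /le_trans; apply; rewrite exprMn /Cg.
  by rewrite le_eqVlt; apply/orP; left; apply/eqP; rewrite mulrA mulrAC.
have rk : rkhs n t theta yt <= Ck * q0.
  exact: (rkhs_le n1 t_lt t01 t_h a_gt0 a_le theta_le theta0_gt0 theta0_le Ah).
have err (i : 'I_n) : (krig_err n t theta yt i -
    (gvec f t theta i *m bmx f t theta i *m vecn n yt) 0 0 -
    krig_err n t theta0 yt i) ^+ 2 <= Ce * om n t i ^+ 2 * q0.
  have e1 := krig_err_diff n1 t_lt t_h a_gt0 a_le theta_le theta0_gt0 theta0_le Ah yt (ltn_ord i).
  rewrite -/C1 -/q0 in e1.
  have e2 := mean_correction_le theta_gt0 t_lt (Gu i) yt.
  have g0 := gam_ge0 theta_gt0 t_lt (Gu i).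
  have e3 : gam f t theta i * rkhs n t theta yt <= Cg * om n t i ^+ 2 * (Ck * q0).
    by apply: ler_pM => //; exact: rkhs_ge0.
  move: e1 e2; set u := krig_err n t theta yt i; set v := krig_err n t theta0 yt i.
  set w := (_ *m vecn n yt) 0 0 => e1 e2.
  have := sqr_ge0 (u - v + w).
  have -> : Ce * om n t i ^+ 2 * q0 = 32 * C1 ^+ 2 * om n t i ^+ 2 * q0 +
     2 * (Cg * om n t i ^+ 2 * (Ck * q0)) by rewrite /Ce; ring.
  lra.
(* Balances the relative error [eta] with the summed squared differences, of order [h / eta] by
   [sum_om_sqr]. *)
pose eta := Num.sqrt h.
have eta0 : 0 < eta by rewrite sqrtr_gt0.
have eta2 : eta ^+ 2 = h by rewrite sqr_sqrtr// ltW.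
have eta1 : eta <= 1 by rewrite -(@sqrtr1 R) ler_wsqrtr.
have term (i : 'I_n) : `|ln (loo_mse f s beta theta sigma2 i) +
    ((observations f s beta y) i 0 - loo_pred f s theta i (observations f s beta y)) ^+ 2 /
      loo_mse f s beta theta sigma2 i -
    (ln (2 * tau n t i) + ln x +
      theta0 * (krig_err n t theta0 yt i ^+ 2 / kvar n t theta0 i) / x)| <=
    2 * (Cd * h) +
    (4 * (Cd * h + eta) * (theta0 * (krig_err n t theta0 yt i ^+ 2 / kvar n t theta0 i)) +
      2 * (Ce * q0 / eta * (om n t i ^+ 2 / tau n t i))) / x.
  have ta0 := tau_gt0 n1 t_lt t_h (ltn_ord i).
  have mE := loo_mseE beta theta_gt0 sigma2_gt0 t_lt t01 (Gu i).
  have rE := loo_residualE beta theta_gt0 t_lt (Gu i) y.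
  rewrite /= -/s in mE rE; rewrite rE.
  have /andP[kv1 kv2] := kvar_bounds n1 t_lt t_h theta_gt0 theta_le Ah (ltn_ord i).
  have /andP[kv01 kv02] := kvar_bounds n1 t_lt t_h theta0_gt0 theta0_le Ah (ltn_ord i).
  have omt := om_sqr_le n1 t_lt t_h h1 (ltn_ord i).
  have g0 := gam_ge0 theta_gt0 t_lt (Gu i).
  have g1' : gam f t theta i <= Cg * (2 * h * tau n t i).
    by apply: le_trans (gam_om i) _; rewrite ler_wpM2l.
  have tt : 0 < 2 * theta * tau n t i by rewrite !mulr_gt0.
  have tt0 : 0 < 2 * theta0 * tau n t i by rewrite !mulr_gt0.
  have Ahh : 0 < A * h by rewrite mulr_gt0.
  have -> : 2 * (Ce * q0 / eta * (om n t i ^+ 2 / tau n t i)) =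
    2 * (Ce * om n t i ^+ 2 * q0 / (tau n t i * eta)) by field; rewrite !gt_eqF.
  apply: (@score_term R x (tau n t i) theta0
    ((kvar n t theta i + gam f t theta i) / (2 * theta * tau n t i) - 1)
    (kvar n t theta0 i / (2 * theta0 * tau n t i) - 1)) => //.
  - rewrite ler_norml; apply/andP; split.
      rewrite lerBrDr ler_pdivlMr//.
      apply: (@le_trans _ _ (kvar n t theta i)); last by rewrite lerDl.
      apply: le_trans kv1; rewrite ler_pM2r// /Cd mulrDl.
      have : 0 <= Cg / a * h by rewrite mulr_ge0// ltW.
      lra.
    rewrite lerBlDr ler_pdivrMr//.
    apply: le_trans (lerD kv2 g1') _.
    have ga : Cg * (2 * h * tau n t i) <= (Cg / a * h) * (2 * theta * tau n t i).
      have -> : Cg / a * h * (2 * theta * tau n t i) = (Cg * (2 * h * tau n t i)) * (theta / a).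
        by field; rewrite gt_eqF.
      apply: ler_peMr; last by rewrite ler_pdivlMr// mul1r.
      exact: mulr_ge0 Cg0 (mulr_ge0 (mulr_ge0 (ler0n _ _) (ltW h0)) (ltW ta0)).
    apply: le_trans (lerD (lexx _) ga) _.
    by rewrite -mulrDl ler_pM2r// /Cd; lra.
  - have ca : 0 <= Cg / a * h by rewrite mulr_ge0// ltW.
    have cdE : Cd * h = 8 * A * h + Cg / a * h by rewrite /Cd mulrDl.
    rewrite ler_norml cdE; apply/andP; split.
      rewrite lerBrDr ler_pdivlMr//; apply: le_trans kv01; rewrite ler_pM2r//; lra.
    by rewrite lerBlDr ler_pdivrMr//; apply: le_trans kv02 _; rewrite ler_pM2r//; lra.
  - by rewrite mE /x; field; rewrite !gt_eqF.
  - by field; rewrite !gt_eqF.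
rewrite /loo_log_score.
have -> : score_offset n t + n%:R * ln x + theta0 * V / x = \sum_(i < n)
    (ln (2 * tau n t i) + ln x + theta0 * (krig_err n t theta0 yt i ^+ 2 / kvar n t theta0 i) / x).
  rewrite !big_split/= sumr_const card_ord /score_offset.
  congr (_ + _ + _); first by rewrite mulr_natl.
  by rewrite /V /krig_stat mulr_sumr mulr_suml.
rewrite -sumrB; apply: le_trans (ler_norm_sum _ _ _) _.
apply: le_trans (ler_sum _ (fun i _ => term i)) _.
rewrite big_split/= sumr_const card_ord -mulr_suml big_split/= -!mulr_sumr.
rewrite -/(krig_stat n t yt) -/V.
have so := sum_om_sqr n1 t_lt t_h h1 t01.
have V0 : 0 <= V.
  apply: sumr_ge0 => i _; rewrite divr_ge0 ?sqr_ge0//.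
  exact/ltW/(kvar_gt0 theta0_gt0 t_lt).
have hE : h = eta * eta by rewrite -eta2 expr2.
have h_eta : h <= eta by rewrite hE ler_piMr// ltW.
have abx : a * b <= x by rewrite ler_pM ?(ltW a_gt0) ?(ltW b_gt0).
have ab0 : 0 < a * b by rewrite mulr_gt0.
rewrite [leRHS]mulrDl; apply: lerD.
  have -> : 2 * (Cd * h) *+ n = 2 * Cd * n%:R * h by rewrite -mulr_natr; ring.
  by rewrite ler_wpM2l// mulr_ge0 ?ler0n// mulr_ge0.
rewrite [leRHS]mulrAC.
apply: ler_pM.
- rewrite addr_ge0// mulr_ge0//.
  + by rewrite mulr_ge0// addr_ge0 ?mulr_ge0 ?(ltW h0) ?(ltW eta0).
  + exact: mulr_ge0 (ltW theta0_gt0) V0.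
  + rewrite mulr_ge0//; first by rewrite divr_ge0 ?mulr_ge0 ?(ltW eta0).
    apply: sumr_ge0 => i _; rewrite divr_ge0 ?sqr_ge0//.
    exact: ltW (tau_gt0 n1 t_lt t_h (ltn_ord i)).
- by rewrite invr_ge0 ltW.
- rewrite -/eta [leRHS]mulrDl; apply: lerD.
    have : Cd * h <= Cd * eta by rewrite ler_wpM2l.
    have tV : 0 <= theta0 * V by exact: mulr_ge0 (ltW theta0_gt0) V0.
    move=> cd.
    have -> : 4 * (Cd + 1) * theta0 * V * eta = 4 * (Cd * eta + eta) * (theta0 * V) by ring.
    by rewrite ler_wpM2r//; lra.
  have -> : 8 * Ce * q0 * eta = 2 * (Ce * q0 / eta * (4 * h)).
    by rewrite hE; field; rewrite gt_eqF.
  rewrite ler_wpM2l// ler_wpM2l// divr_ge0 ?mulr_ge0 ?(ltW eta0)//.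
- by rewrite lef_pV2 ?posrE.
Qed.

End ScoreExpansion.

(** * Existence of minimizers *)

Section MatrixConvergence.
Context {R : realType} {T : Type} (F : set_system T) {FF : ProperFilter F}.

Definition mx_cvg m n (M : T -> 'M[R]_(m, n)) (L : 'M[R]_(m, n)) :=
  forall i j, M x i j @[x --> F] --> L i j.

Lemma cvg_sumr I (r : seq I) (Q : pred I) (f : I -> T -> R) (l : I -> R) :
  (forall i, Q i -> f i x @[x --> F] --> l i) ->
  \sum_(i <- r | Q i) f i x @[x --> F] --> \sum_(i <- r | Q i) l i.
Proof. by apply: cvg_big; exact: add_continuous. Qed.

Lemma cvg_prodr I (r : seq I) (Q : pred I) (f : I -> T -> R) (l : I -> R) :
  (forall i, Q i -> f i x @[x --> F] --> l i) ->
  \prod_(i <- r | Q i) f i x @[x --> F] --> \prod_(i <- r | Q i) l i.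
Proof. by apply: cvg_big; exact: mul_continuous. Qed.

Lemma mx_cvg_cst m n (L : 'M[R]_(m, n)) : mx_cvg (fun=> L) L.
Proof. by move=> i j; exact: cvg_cst. Qed.

Lemma mx_cvg_tr m n (M : T -> 'M[R]_(m, n)) L :
  mx_cvg M L -> mx_cvg (fun x => (M x)^T) L^T.
Proof. by move=> ML i j; rewrite mxE; under eq_cvg do rewrite mxE; exact: ML. Qed.

Lemma mx_cvgD m n (M N : T -> 'M[R]_(m, n)) L K :
  mx_cvg M L -> mx_cvg N K -> mx_cvg (fun x => M x + N x) (L + K).
Proof.
by move=> ML NK i j; rewrite mxE; under eq_cvg do rewrite mxE; exact: cvgD (ML i j) (NK i j).
Qed.

Lemma mx_cvgN m n (M : T -> 'M[R]_(m, n)) L :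
  mx_cvg M L -> mx_cvg (fun x => - M x) (- L).
Proof. by move=> ML i j; rewrite mxE; under eq_cvg do rewrite mxE; exact: cvgN (ML i j). Qed.

Lemma mx_cvgM m n p (M : T -> 'M[R]_(m, n)) (N : T -> 'M[R]_(n, p)) L K :
  mx_cvg M L -> mx_cvg N K -> mx_cvg (fun x => M x *m N x) (L *m K).
Proof.
move=> ML NK i j; rewrite mxE; under eq_cvg do rewrite mxE.
by apply: cvg_sumr => k _; exact: cvgM (ML i k) (NK k j).
Qed.

Lemma det_cvg n (M : T -> 'M[R]_n) L : mx_cvg M L -> \det (M x) @[x --> F] --> \det L.
Proof.
move=> ML; apply: cvg_sumr => s _; apply: cvgM; first exact: cvg_cst.
by apply: cvg_prodr => i _; exact: ML.
Qed.

(** Where the determinant is nonzero, hence eventually, the inverse is the adjugate divided by the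
    determinant. *)
Lemma mx_cvg_invmx n (M : T -> 'M[R]_n) L :
  mx_cvg M L -> L \in unitmx -> mx_cvg (fun x => invmx (M x)) (invmx L).
Proof.
move=> ML Lu i j; have dL := det_cvg ML.
have dL0 : \det L != 0 by rewrite -unitfE -unitmxE.
have inv_eq x : \det (M x) != 0 -> (\det (M x))^-1 * \adj (M x) i j = invmx (M x) i j.
  by move=> d0; rewrite /invmx unitmxE unitfE d0 [RHS]mxE.
have -> : invmx L i j = (\det L)^-1 * \adj L i j by rewrite /invmx Lu [LHS]mxE.
apply: cvg_trans (_ : (\det (M x))^-1 * \adj (M x) i j @[x --> F] --> _).
  apply: near_eq_cvg; have : \forall x \near F, \det (M x) != 0.
    by apply: (dL [set x | x != 0]); apply: open_nbhs_nbhs; split => //; exact: open_neq.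
  by apply: filterS => x; exact: inv_eq.
apply: cvgM; first exact: cvgV.
rewrite mxE; under eq_cvg do rewrite mxE.
rewrite /cofactor.
apply: cvgM; first exact: cvg_cst.
by apply: det_cvg => k l; rewrite !mxE; under eq_cvg do rewrite !mxE; exact: ML.
Qed.

End MatrixConvergence.

Section ScoreContinuity.
Context {R : realType} (p n : nat) (f : 'I_p -> R -> R) (t : nat -> R).
Local Notation s := (fun i : 'I_n => t i).
Hypothesis t_lt : forall k l, (k < l)%N -> (l < n)%N -> t k < t l.
Hypothesis G_unit : forall theta (i : 'I_n), 0 < theta -> loo_gram_mx f s theta i \in unitmx.
Variable theta : R.
Hypothesis theta_gt0 : 0 < theta.

Lemma rho_cvg l : rho t x l @[x --> theta] --> rho t theta l.
Proof.
rewrite /rho; case: l => [|l]; first exact: cvg_cst.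
apply: continuous_cvg.
  exact: continuous_expR.
by apply: cvgMl; apply: cvgN; exact: cvg_id.
Qed.

Lemma rhor_cvg l : rhor n t x l @[x --> theta] --> rhor n t theta l.
Proof. by rewrite /rhor; case: ifP => _; [exact: rho_cvg|exact: cvg_cst]. Qed.

Lemma corr_mx_cvg : mx_cvg (nbhs theta) (fun x => corr_mx s x) (corr_mx s theta).
Proof.
move=> i j; rewrite mxE; under eq_cvg do rewrite mxE.
apply: continuous_cvg.
  exact: continuous_expR.
by apply: cvgMl; apply: cvgN; exact: cvg_id.
Qed.

Lemma loo_corr_mx_cvg (i : 'I_n) :
  mx_cvg (nbhs theta) (fun x => loo_corr_mx s x i) (loo_corr_mx s theta i).
Proof.
move=> k l; rewrite !mxE; under eq_cvg do rewrite !mxE.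
by have /(_ (lift i k) (lift i l)) := corr_mx_cvg; rewrite !mxE; under eq_cvg do rewrite mxE.
Qed.

Lemma loo_gram_mx_cvg (i : 'I_n) :
  mx_cvg (nbhs theta) (fun x => loo_gram_mx f s x i) (loo_gram_mx f s theta i).
Proof.
apply: mx_cvgM; last exact: mx_cvg_cst.
apply: mx_cvgM; first exact: mx_cvg_cst.
by apply: mx_cvg_invmx; [exact: loo_corr_mx_cvg|exact: loo_corr_unit].
Qed.

Lemma loo_pred_cvg (i : 'I_n) (z : 'cV[R]_n) :
  loo_pred f s x i z @[x --> theta] --> loo_pred f s theta i z.
Proof.
have Ki : mx_cvg (nbhs theta) (fun x => invmx (loo_corr_mx s x i)) (invmx (loo_corr_mx s theta i)).
  by apply: mx_cvg_invmx; [exact: loo_corr_mx_cvg|exact: loo_corr_unit].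
have Gi : mx_cvg (nbhs theta) (fun x => invmx (loo_gram_mx f s x i))
    (invmx (loo_gram_mx f s theta i)).
  by apply: mx_cvg_invmx; [exact: loo_gram_mx_cvg|exact: G_unit].
have bi : mx_cvg (nbhs theta) (fun x => loo_beta f s x i z) (loo_beta f s theta i z).
  apply: mx_cvgM; last exact: mx_cvg_cst.
  by apply: mx_cvgM => //; apply: mx_cvgM => //; exact: mx_cvg_cst.
pose pr x := row i (design_mx f s) *m loo_beta f s x i z +
  (loo_corr_vec s x i)^T *m invmx (loo_corr_mx s x i) *m
    (row' i z - loo_design_mx f s i *m loo_beta f s x i z).
suff : mx_cvg (nbhs theta) pr (pr theta) by move/(_ 0 0).
apply: mx_cvgD.
  by apply: mx_cvgM => //; exact: mx_cvg_cst.
apply: mx_cvgM.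
  apply: mx_cvgM => //; apply: mx_cvg_tr => k l.
  rewrite !mxE; under eq_cvg do rewrite !mxE.
  by have /(_ i (lift i k)) := corr_mx_cvg; rewrite !mxE; under eq_cvg do rewrite mxE.
apply: mx_cvgD; first exact: mx_cvg_cst.
by apply: mx_cvgN; apply: mx_cvgM => //; exact: mx_cvg_cst.
Qed.

Let kden_neq0 (i : 'I_n) : kden n t theta i != 0.
Proof.
apply/eqP => k0; have := kvar_gt0 theta_gt0 t_lt (ltn_ord i).
by rewrite /kvar k0 invr0 mulr0 ltxx.
Qed.

Let onem_sqr_cvg (u : R -> R) : u x @[x --> theta] --> u theta ->
  1 - u x ^+ 2 @[x --> theta] --> 1 - u theta ^+ 2.
Proof.
by move=> ut; apply: cvgB; [exact: cvg_cst|exact: (cvgM ut ut)].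
Qed.

Let kden_cvg (i : 'I_n) : (kden n t x i)^-1 @[x --> theta] --> (kden n t theta i)^-1.
Proof.
apply: cvgV => //; rewrite /kden -exprMn; under eq_cvg do rewrite -exprMn.
by apply: (onem_sqr_cvg (u := fun x => rho t x i * rhor n t x i)); apply: cvgM;
  [exact: rho_cvg|exact: rhor_cvg].
Qed.

Lemma kvar_cvg (i : 'I_n) : kvar n t x i @[x --> theta] --> kvar n t theta i.
Proof.
apply: cvgM => //; apply: cvgM; apply: onem_sqr_cvg; [exact: rho_cvg|exact: rhor_cvg].
Qed.

Lemma kvec_cvg (i : 'I_n) : mx_cvg (nbhs theta) (fun x => kvec t x i) (kvec t theta i).
Proof.
move=> k l; rewrite !mxE; under eq_cvg do rewrite !mxE.
apply: cvgB; first exact: cvg_cst.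
apply: cvgD; apply: cvgMr; apply: cvgM => //; apply: cvgM;
  by [exact: rho_cvg|exact: rhor_cvg|apply: onem_sqr_cvg; exact: rho_cvg
     |apply: onem_sqr_cvg; exact: rhor_cvg].
Qed.

Lemma gam_cvg (i : 'I_n) : gam f t x i @[x --> theta] --> gam f t theta i.
Proof.
have gc : mx_cvg (nbhs theta) (fun x => gvec f t x i) (gvec f t theta i).
  by apply: mx_cvgM; [exact: kvec_cvg|exact: mx_cvg_cst].
pose q x := (gvec f t x i)^T^T *m invmx (loo_gram_mx f s x i) *m (gvec f t x i)^T.
suff : mx_cvg (nbhs theta) q (q theta) by move/(_ 0 0).
apply: mx_cvgM; last exact: mx_cvg_tr.
apply: mx_cvgM; first by apply: mx_cvg_tr; exact: mx_cvg_tr.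
by apply: mx_cvg_invmx; [exact: loo_gram_mx_cvg|exact: G_unit].
Qed.

End ScoreContinuity.

Section Argmin.
Context {R : realType} (p n : nat) (f : 'I_p -> R -> R) (t : nat -> R).
Local Notation s := (fun i : 'I_n => t i).
Hypothesis t_lt : forall k l, (k < l)%N -> (l < n)%N -> t k < t l.
Hypothesis t01 : forall l, (l < n)%N -> 0 <= t l <= 1.
Hypothesis G_unit : forall theta (i : 'I_n), 0 < theta -> loo_gram_mx f s theta i \in unitmx.

Lemma loo_mse_gt0 beta theta sigma2 (i : 'I_n) : 0 < theta -> 0 < sigma2 ->
  0 < loo_mse f s beta theta sigma2 i.
Proof.
move=> th s2; rewrite (loo_mseE beta th s2 t_lt t01 (G_unit i th)) mulr_gt0//.
by rewrite ltr_pwDl ?(gam_ge0 th t_lt (G_unit i th))// (kvar_gt0 th t_lt).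
Qed.

Lemma loo_well_definedP beta theta sigma2 : 0 < theta -> 0 < sigma2 ->
  loo_well_defined f s beta theta sigma2.
Proof.
by move=> th s2 i; split; [exact: loo_corr_unit|exact: G_unit|exact: loo_mse_gt0].
Qed.

Lemma loo_log_score_argmin (a A b B : R) beta (z : 'cV[R]_n) :
  0 < a -> a <= A -> 0 < b -> b <= B ->
  exists x, is_argmin (`[a, A] `*` `[b, B]) (loo_log_score f s beta z) x.
Proof.
move=> a0 aA b0 bB; set J := _ `*` _.
pose v (i : 'I_n) x := kvar n t x i + gam f t x i.
(* [loo_mse] is defined by a choice; on [J] it is replaced by its closed form, whose continuity can
   be proved. *)
pose S (x : R * R) := \sum_(i < n) (ln (x.2 * v i x.1) +
  (z i 0 - loo_pred f s x.1 i z) ^+ 2 / (x.2 * v i x.1)).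
have Jgt0 x : J x -> 0 < x.1 /\ 0 < x.2.
  move=> [/=]; rewrite !in_itv/= => /andP[ax _] /andP[bx _].
  by split; [exact: lt_le_trans ax|exact: lt_le_trans bx].
have SE x : J x -> loo_log_score f s beta z x.1 x.2 = S x.
  move=> /Jgt0[x1 x2]; apply: eq_bigr => i _.
  by have /= -> := loo_mseE beta x1 x2 t_lt t01 (G_unit i x1).
have S_cont x : x \in J -> {for x, continuous S}.
  rewrite inE => /Jgt0[x1 x2]; apply: cvg_sumr => i _.
  have v_gt0 : 0 < x.2 * v i x.1.
    have := loo_mse_gt0 beta i x1 x2.
    by rewrite (loo_mseE beta x1 x2 t_lt t01 (G_unit i x1)).
  have fst_cvg (u : R -> R) : u y @[y --> x.1] --> u x.1 -> u y.1 @[y --> x] --> u x.1.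
    by move=> ux; apply: (cvg_comp _ _ cvg_fst).
  have v_cvg : y.2 * v i y.1 @[y --> x] --> x.2 * v i x.1.
    apply: cvgM; first exact: cvg_snd.
    by apply: fst_cvg; apply: cvgD; [exact: kvar_cvg|exact: gam_cvg].
  apply: cvgD; first by apply: continuous_cvg => //; exact: continuous_ln.
  apply: cvgM; last by apply: cvgV => //; exact: lt0r_neq0.
  have e_cvg : z i 0 - loo_pred f s y.1 i z @[y --> x] --> z i 0 - loo_pred f s x.1 i z.
    apply: cvgB; first exact: cvg_cst.
    by apply: (fst_cvg (fun y => loo_pred f s y i z)); exact: loo_pred_cvg.
  exact: (cvgM e_cvg e_cvg).
have J0 : J !=set0.
  by exists (a, b); split; rewrite /= in_itv/= lexx.
have Jc : compact J by apply: compact_setX; exact: segment_compact.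
have [c cJ cmin] := compact_EVT_min J0 Jc (continuous_in_subspaceT S_cont).
exists c; split; first by move: cJ; rewrite inE.
move=> y yJ; rewrite (SE _ yJ) SE; last by move: cJ; rewrite inE.
by apply: cmin; rewrite inE.
Qed.

End Argmin.

(** * Consistency *)

Section Whitening.
Context {R : realType} (d : measure_display) (T : measurableType d)
  (P : probability T R) (Y : R -> {RV P >-> R}) (theta0 sigma02 : R).
Hypothesis theta0_gt0 : 0 < theta0.
Hypothesis sigma02_gt0 : 0 < sigma02.
Hypothesis Y_gauss : gaussian_process01 Y.
Hypothesis Y_cov : centered_with_cov01 Y (exp_cov theta0 sigma02).

(** The covariance of the transformed data has to be diagonal on [Q] only, since the coefficients
    [b] vanish elsewhere; this allows the parity classes. *)
Lemma standard_normals_linear n (t : nat -> R) (U : 'M[R]_n) (v : 'I_n -> R)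
    (g : (nat -> R) -> 'I_n -> R) (Q : pred 'I_n) :
  (forall l, (l < n)%N -> 0 <= t l <= 1) ->
  (forall x i, (U *m vecn n x) i 0 = g x i) -> (forall i, 0 < v i) ->
  (forall i j, Q i -> Q j -> (U *m kmx n t theta0 *m U^T) i j = (i == j)%:R * v i) ->
  standard_normals P
    (fun i w => g (fun l => Y (t l) w) i / Num.sqrt (sigma02 * v i)) Q.
Proof.
move=> t01 Ug v0 Uv b bQ.
have sv i : 0 < sigma02 * v i by rewrite mulr_gt0.
pose e : 'rV[R]_n := \row_i (b i / Num.sqrt (sigma02 * v i)).
pose c i := (e *m U) 0 i.
have -> : (fun w => (expR (\sum_i b i *
      (g (fun l => Y (t l) w) i / Num.sqrt (sigma02 * v i))))%:E) =
    (fun w => (expR (\sum_i c i * Y (t i) w))%:E).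
  apply/funext => w; congr (expR _)%:E.
  transitivity ((e *m (U *m vecn n (fun l => Y (t l) w))) 0 0).
    by rewrite mxE; apply: eq_bigr => i _; rewrite Ug [e _ _]mxE; ring.
  by rewrite mulmxA mxE; apply: eq_bigr => i _; rewrite [vecn _ _ _ _]mxE.
rewrite (mgf_gaussian_process _ (t := fun i => t i) Y_gauss Y_cov); last first.
  by move=> j; rewrite in_itv; exact: t01.
congr (expR (_ / 2))%:E.
transitivity (sigma02 * (e *m (U *m kmx n t theta0 *m U^T) *m e^T) 0 0).
  have -> : e *m (U *m kmx n t theta0 *m U^T) *m e^T =
      (e *m U) *m kmx n t theta0 *m (e *m U)^T by rewrite trmx_mul !mulmxA.
  rewrite mxE mulr_sumr exchange_big/=; apply: eq_bigr => j _.
  rewrite mxE mulr_suml mulr_sumr; apply: eq_bigr => i _.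
  by rewrite !mxE /exp_cov /c !mxE; ring.
rewrite mxE mulr_sumr; apply: eq_bigr => i _.
rewrite mxE [_^T _ _]mxE [X in _ * (_ * X)]mxE.
have [Qi|/bQ ->] := boolP (Q i); last by rewrite mul0r mulr0 mulr0 expr0n.
rewrite (bigD1 i)//= Uv// eqxx mul1r [e _ _]mxE big1 ?addr0 => [|j ji].
  have := sqr_sqrtr (ltW (sv i)); move: (sv i).
  set q := Num.sqrt _ => sv0 q2; have q0 : q != 0.
    by apply: contraTneq sv0 => q0; rewrite -q2 q0 expr0n ltxx.
  have vE : v i = q ^+ 2 / sigma02 by rewrite q2; field; rewrite gt_eqF.
  by rewrite vE; field; rewrite q0 gt_eqF.
rewrite [e _ _]mxE; have [Qj|/bQ ->] := boolP (Q j); last by rewrite !mul0r.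
by rewrite Uv// (negPf ji) mul0r mulr0.
Qed.

Variable t : nat -> nat -> R.
Hypothesis t_design : \forall n \near \oo,
  (forall k l, (k < l)%N -> (l < n)%N -> t n k < t n l) /\
  (forall l, (l < n)%N -> 0 <= t n l <= 1).

Let y n w l := Y (t n l) w.

Let my n l : measurable_fun setT (fun w => y n w l).
Proof. exact: measurable_funPT. Qed.

Let chi2E n (Q : pred 'I_n) (g : T -> 'I_n -> R) (v : 'I_n -> R) w :
  (forall i, 0 < v i) ->
  chi2 (fun i w => g w i / Num.sqrt (sigma02 * v i)) Q w =
  (\sum_(i | Q i) g w i ^+ 2 / v i) / sigma02.
Proof.
move=> v0; rewrite mulr_suml; apply: eq_bigr => i _.
rewrite expr_div_n sqr_sqrtr; last by rewrite ltW// mulr_gt0.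
by field; rewrite !gt_eqF.
Qed.

Lemma rkhs_lln : {ae P, forall w,
  rkhs n (t n) theta0 (y n w) / n%:R @[n --> \oo] --> sigma02}.
Proof.
pose X n (i : 'I_n) w := innov (t n) theta0 (y n w) i /
  Num.sqrt (sigma02 * ivar (t n) theta0 i).
have mX n i : measurable_fun setT (X n i).
  apply: measurable_funM => //; apply: measurable_funB => //.
  exact: measurable_funM.
have sX : \forall n \near \oo, standard_normals P (@X n) predT.
  apply: filterS t_design => n [t_lt t01].
  have [U [UE Ucov]] := innov_mx theta0 t_lt.
  apply: (standard_normals_linear (U := U)
    (v := fun i => ivar (t n) theta0 i) (g := fun x i => innov (t n) theta0 x i)) => //.
  - by move=> x i; rewrite UE mxE.
  - by move=> i; exact: (ivar_gt0 theta0_gt0 t_lt (ltn_ord i)).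
  - by move=> i j _ _; rewrite Ucov !mxE mulr_natl.
have := chi2_lln mX sX; apply: filterS => w cw.
have n_gt0 : \forall n \near \oo, (0 < n)%N by exists 1%N.
have -> : sigma02 = sigma02 * (0 + 1) by rewrite add0r mulr1.
have lim := cvgM (@cvg_cst R sigma02 nat \oo _) (cvgD cw (@cvg_cst R 1 nat \oo _)).
apply: cvg_trans; last exact: lim.
apply: near_eq_cvg; near=> n.
have n0 : n%:R != 0 :> R by rewrite pnatr_eq0 -lt0n; near: n.
have [t_lt t01] : (forall k l, (k < l)%N -> (l < n)%N -> t n k < t n l) /\
  (forall l, (l < n)%N -> 0 <= t n l <= 1) by near: n.
rewrite /= fctE /X (chi2E _ (fun w i => innov (t n) theta0 (y n w) i)); last first.
  by move=> i; exact: (ivar_gt0 theta0_gt0 t_lt (ltn_ord i)).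
rewrite -/(rkhs n (t n) theta0 (y n w)) card_ord.
by field; rewrite n0 gt_eqF.
Unshelve. all: by end_near. Qed.

(* Prediction errors at indices of the same parity are uncorrelated (see
   [kvec_cov]), so the law of large numbers applies to each parity class. *)
Lemma krig_stat_lln : {ae P, forall w,
  krig_stat theta0 n (t n) (y n w) / n%:R @[n --> \oo] --> sigma02}.
Proof.
pose X n (i : 'I_n) w := krig_err n (t n) theta0 (y n w) i /
  Num.sqrt (sigma02 * kvar n (t n) theta0 i).
have mX n i : measurable_fun setT (X n i).
  apply: measurable_funM => //; apply: measurable_funB; last exact: measurable_funM.
  by apply: measurable_funB => //; exact: measurable_funM.
have sX (b : bool) : \forall n \near \oo,
    standard_normals P (@X n) [pred i : 'I_n | odd i == b].
  apply: filterS t_design => n [t_lt t01].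
  apply: (standard_normals_linear (U := \matrix_i kvec (t n) theta0 i)
    (v := fun i => kvar n (t n) theta0 i) (g := fun x i => krig_err n (t n) theta0 x i)) => //.
  - move=> x i; rewrite -(@kvec_mul _ _ _ _ _ (vecn n x)) => [|k]; last by rewrite mxE.
    by rewrite !mxE; apply: eq_bigr => k _; rewrite !mxE.
  - by move=> i; exact: (kvar_gt0 theta0_gt0 t_lt (ltn_ord i)).
  - move=> i j /eqP oi /eqP oj.
    rewrite -(kvec_cov theta0_gt0 t_lt (etrans oi (esym oj))).
    rewrite mxE [RHS]mxE; apply: eq_bigr => k _; rewrite !mxE; congr (_ * _).
    by apply: eq_bigr => l _; rewrite mxE.
have lln b := chi2_lln mX (sX b).
apply: filterS2 (lln true) (lln false) => w c1 c2.
have n_gt0 : \forall n \near \oo, (0 < n)%N by exists 1%N.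
have -> : sigma02 = sigma02 * (0 + 0 + 1) by rewrite !add0r mulr1.
have lim := cvgM (@cvg_cst R sigma02 nat \oo _) (cvgD (cvgD c1 c2) (@cvg_cst R 1 nat \oo _)).
apply: cvg_trans; last exact: lim.
apply: near_eq_cvg; near=> n.
have n0 : n%:R != 0 :> R by rewrite pnatr_eq0 -lt0n; near: n.
have [t_lt t01] : (forall k l, (k < l)%N -> (l < n)%N -> t n k < t n l) /\
  (forall l, (l < n)%N -> 0 <= t n l <= 1) by near: n.
have kv (i : 'I_n) : 0 < kvar n (t n) theta0 i by exact: (kvar_gt0 theta0_gt0 t_lt (ltn_ord i)).
rewrite /= !fctE /X !(chi2E _ (fun w i => krig_err n (t n) theta0 (y n w) i))//.
have -> : krig_stat theta0 n (t n) (y n w) =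
   \sum_(i < n | odd i == true) krig_err n (t n) theta0 (y n w) i ^+ 2 / kvar n (t n) theta0 i +
   \sum_(i < n | odd i == false) krig_err n (t n) theta0 (y n w) i ^+ 2 / kvar n (t n) theta0 i.
  rewrite /krig_stat (bigID (fun i : 'I_n => odd i == true))/=; congr (_ + _).
  by apply: eq_bigl => i; case: (odd i).
have nE : n%:R = #|[pred i : 'I_n | odd i == true]|%:R +
    #|[pred i : 'I_n | odd i == false]|%:R :> R.
  rewrite -natrD -{1}(card_ord n) -(cardC [pred i : 'I_n | odd i == true]).
  congr (_ + _)%:R.
  by apply: eq_card => i; rewrite !inE; case: (odd i).
move: n0; rewrite nE => n0.
by field; rewrite n0 gt_eqF.
Unshelve. all: by end_near. Qed.

End Whitening.

Lemma unif_C2_bounds {R : realType} (p : nat) (f : 'I_p -> R -> R) :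
  (forall k, twice_continuously_differentiable01 (f k)) ->
  exists g1 : 'I_p -> R -> R, exists2 M, 0 <= M &
    forall k x y, 0 <= x <= 1 -> 0 <= y <= 1 ->
    [/\ `|f k x| <= M, `|f k y - f k x| <= M * `|y - x| &
        `|f k y - f k x - g1 k x * (y - x)| <= M * (y - x) ^+ 2].
Proof.
move=> f_C2; have [g1 g1P] := choice (fun k => C2_bounds (f_C2 k)).
have g1M k : exists N, 0 <= N /\ forall x y, 0 <= x <= 1 -> 0 <= y <= 1 ->
    [/\ `|f k x| <= N, `|f k y - f k x| <= N * `|y - x| &
        `|f k y - f k x - g1 k x * (y - x)| <= N * (y - x) ^+ 2].
  by have [N N0 NP] := g1P k; exists N.
have [N NP] := choice g1M.
have N0 k : 0 <= N k by case: (NP k).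
have NM k : N k <= \sum_j N j by rewrite (bigD1 k)//= lerDl sumr_ge0.
exists g1, (\sum_j N j) => [|k x y x01 y01]; first exact: sumr_ge0.
have [_ /(_ x y x01 y01)[h1 h2 h3]] := NP k; split; first exact: le_trans (NM k).
  by apply: le_trans h2 _; rewrite ler_wpM2r.
by apply: le_trans h3 _; rewrite ler_wpM2r// sqr_ge0.
Qed.

(** [C] and [h1] are fixed before [n], the design, the parameters, [beta] and the path [y], so that
    randomness enters the remainder only through [krig_stat] and [rkhs]. *)
Lemma score_asymptotics {R : realType} (p : nat) (f : 'I_p -> R -> R) (theta0 a A b : R) :
  (forall k, twice_continuously_differentiable01 (f k)) ->
  linearly_independent01 f -> 0 < theta0 -> 0 < a -> a <= A -> 0 < b ->
  exists C h1 : R, [/\ 0 <= C, 0 < h1 &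
  forall (n : nat) (t : nat -> R) (h : R), (1 < n)%N ->
    (forall k l, (k < l)%N -> (l < n)%N -> t k < t l) ->
    t 0 = 0 -> t n.-1 = 1 ->
    (forall l, (l.+1 < n)%N -> t l.+1 - t l <= h) -> h <= h1 ->
    (forall theta (i : 'I_n), 0 < theta ->
      loo_gram_mx f (fun i : 'I_n => t i) theta i \in unitmx) /\
    forall theta sigma2 beta y, a <= theta <= A -> b <= sigma2 ->
    `|loo_log_score f (fun i : 'I_n => t i) beta
      (observations f (fun i : 'I_n => t i) beta y) theta sigma2 -
    (score_offset n t + n%:R * ln (theta * sigma2) +
     theta0 * krig_stat theta0 n t (y \o t) / (theta * sigma2))| <=
    C * (n%:R + krig_stat theta0 n t (y \o t) + rkhs n t theta0 (y \o t)) * Num.sqrt h].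
Proof.
move=> f_C2 f_indep th0 a0 aA b0.
have [g1 [M M0 fM]] := unif_C2_bounds f_C2.
have f_lip k x y : 0 <= x <= 1 -> 0 <= y <= 1 -> `|f k y - f k x| <= M * `|y - x|.
  by move=> x01 y01; have [] := fM k x y x01 y01.
have [kappa [h0 [k0 h00 gram]]] := loo_gram_lower_bound f_indep f_lip M0.
(* [theta0] may exceed [A], while the expansion needs a common upper bound for [theta] and
   [theta0]. *)
pose A' := Num.max A theta0.
have A'A : A <= A' by rewrite le_max lexx.
have A'0 : theta0 <= A' by rewrite le_max lexx orbT.
have A'gt0 : 0 < A' by exact: lt_le_trans th0 A'0.
have [Cd [Ce expansion]] : exists Cd Ce : R,
  forall (n : nat) (t : nat -> R) (h theta sigma2 : R) (beta : 'cV[R]_p) (y : R -> R),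
  (1 < n)%N -> (forall k l, (k < l)%N -> (l < n)%N -> t k < t l) ->
  (forall l, (l < n)%N -> 0 <= t l <= 1) ->
  (forall l, (l.+1 < n)%N -> t l.+1 - t l <= h) ->
  h <= 1 -> 8 * A' * h <= 1 -> Cd * h <= 2^-1 ->
  (forall (i : 'I_n) (v : 'cV[R]_p), kappa * \sum_k v k 0 ^+ 2 <=
      quad (loo_gram_mx f (fun i : 'I_n => t i) theta i) v) ->
  a <= theta <= A' -> b <= sigma2 ->
  `|loo_log_score f (fun i : 'I_n => t i) beta
      (observations f (fun i : 'I_n => t i) beta y) theta sigma2 -
    (score_offset n t + n%:R * ln (theta * sigma2) +
     theta0 * krig_stat theta0 n t (y \o t) / (theta * sigma2))| <=
  (2 * Cd * n%:R + (4 * (Cd + 1) * theta0 * krig_stat theta0 n t (y \o t) +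
     8 * Ce * rkhs n t theta0 (y \o t)) / (a * b)) * Num.sqrt h.
  by do 2 eexists; exact: (score_expansion fM M0 k0 th0 A'0 a0 b0).
pose c1 := 2 * Cd; pose c2 := 4 * (Cd + 1) * theta0 / (a * b); pose c3 := 8 * Ce / (a * b).
pose C := `|c1| + `|c2| + `|c3|.
exists C, (Num.min (Num.min 1 h0) (Num.min (8 * A')^-1 (2 * (`|Cd| + 1))^-1)).
have Cd1 : 0 < 2 * (`|Cd| + 1) by rewrite mulr_gt0// ltr_wpDl.
have A8 : 0 < 8 * A' by rewrite mulr_gt0.
split; [by rewrite !addr_ge0|by rewrite !lt_min !invr_gt0 ltr01 h00 A8 Cd1|].
move=> n t h n1 t_lt t0 t1 t_h; rewrite !le_min => /andP[/andP[h_1 h_0] /andP[h_A h_C]].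
have t_le k l : (k <= l)%N -> (l < n)%N -> t k <= t l.
  by rewrite leq_eqVlt => /predU1P[->//|kl ln]; rewrite ltW// t_lt.
have t01 l : (l < n)%N -> 0 <= t l <= 1.
  move=> ln; have n1E : n.-1.+1 = n by rewrite prednK// (ltn_trans _ n1).
  apply/andP; split; first by rewrite -[leLHS]t0 t_le.
  by rewrite -[leRHS]t1; apply: t_le; [rewrite -ltnS n1E|rewrite n1E].
have h_ge0 : 0 <= h.
  by apply: ltW (lt_le_trans _ (t_h 0 n1)); rewrite subr_gt0 t_lt.
have gramH theta (i : 'I_n) : 0 < theta -> forall v : 'cV[R]_p,
   kappa * \sum_k v k 0 ^+ 2 <= quad (loo_gram_mx f (fun i : 'I_n => t i) theta i) v.
  by move=> th; apply: gram n1 t_lt t_h t0 t1 _ th; rewrite h_ge0.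
split=> [theta i th|theta sigma2 beta y /andP[ath thA] bs].
  exact: unitmx_of_quad_ge k0 (gramH theta i th).
have th : 0 < theta by exact: lt_le_trans ath.
apply: le_trans (expansion n t h theta sigma2 beta y n1 t_lt t01 t_h h_1 _ _ _ _ bs) _.
- by rewrite -ler_pdivlMl// mulr1.
- apply: (@le_trans _ _ (2^-1 * (2 * (`|Cd| + 1) * h))).
    have := ler_norm Cd; have : Cd * h <= (`|Cd| + 1) * h; last by lra.
    by rewrite ler_wpM2r// (le_trans (ler_norm _))// lerDl.
  by rewrite ler_piMr// -ler_pdivlMl// mulr1.
- by move=> i v; exact: gramH.
- by rewrite ath (le_trans thA).
rewrite ler_wpM2r ?sqrtr_ge0//.
set V := krig_stat _ _ _ _; set q := rkhs _ _ _ _.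
have V0 : 0 <= V.
  apply: sumr_ge0 => i _; rewrite divr_ge0 ?sqr_ge0//.
  exact/ltW/(kvar_gt0 th0 t_lt).
have q0 : 0 <= q by exact: rkhs_ge0.
have n0 : 0 <= n%:R :> R by [].
have -> : 2 * Cd * n%:R + (4 * (Cd + 1) * theta0 * V + 8 * Ce * q) / (a * b) =
  c1 * n%:R + c2 * V + c3 * q by rewrite /c1 /c2 /c3; ring.
have b1 : c1 * n%:R <= C * n%:R.
  by rewrite ler_wpM2r// (le_trans (ler_norm _))// /C -addrA lerDl addr_ge0.
have b2 : c2 * V <= C * V.
  by rewrite ler_wpM2r// (le_trans (ler_norm _))// /C addrAC lerDr addr_ge0.
have b3 : c3 * q <= C * q.
  by rewrite ler_wpM2r// (le_trans (ler_norm _))// /C lerDr addr_ge0.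
by rewrite 2!mulrDr; apply: lerD => //; exact: lerD.
Qed.

(* [u - 1 - ln u >= (sqrt u - 1) ^+ 2]. *)
Lemma log_excess_bound {R : realType} (u r : R) : 0 < u ->
  u - 1 - ln u <= r -> `|u - 1| <= (u + 2) * Num.sqrt r.
Proof.
move=> u0 ur; pose v := Num.sqrt u.
have v0 : 0 < v by rewrite sqrtr_gt0.
have uE : u = v ^+ 2 by rewrite sqr_sqrtr// ltW.
have lnu : ln u = 2 * ln v by rewrite uE expr2 lnM ?posrE//; ring.
have lnv : ln v <= v - 1.
  by have := expR_ge1Dx (ln v); rewrite lnK ?posrE//; lra.
have r0 : (v - 1) ^+ 2 <= r by apply: le_trans ur; rewrite lnu uE; nra.
have sr : `|v - 1| <= Num.sqrt r by rewrite -sqrtr_sqr ler_wsqrtr.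
have -> : u - 1 = (v + 1) * (v - 1) by rewrite uE; ring.
rewrite normrM ger0_norm; last by lra.
by apply: ler_pM => //; first (by lra); rewrite uE; nra.
Qed.

(** Replacing [W / n] by [x0] costs at most [|W / n - x0| / c] in each of the two quotients, hence
    the factor 2. What remains is [log_excess_bound] at [u = x0 / x]. *)
Lemma minimizer_bound {R : realType} (n : nat) (c C x x0 W e : R) : (0 < n)%N ->
  0 < c -> c <= x -> x <= C -> c <= x0 -> x0 <= C ->
  n%:R * ln x + W / x <= n%:R * ln x0 + W / x0 + n%:R * e ->
  `|x - x0| <= C * (C / c + 2) * Num.sqrt (e + 2 * `|W / n%:R - x0| / c).
Proof.
move=> n0 c0 cx xC cx0 x0C H.
have N0 : 0 < n%:R :> R by rewrite ltr0n.
have xp : 0 < x by exact: lt_le_trans cx.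
have x0p : 0 < x0 by exact: lt_le_trans cx0.
have Cp : 0 < C by exact: lt_le_trans xC.
pose dl := W / n%:R - x0; pose u := x0 / x.
have u0 : 0 < u by rewrite divr_gt0.
have lnu : ln u = ln x0 - ln x by rewrite ln_div ?posrE.
have key : u - 1 - ln u <= e + 2 * `|dl| / c.
  have WE : W = n%:R * (x0 + dl) by rewrite /dl; field; rewrite gt_eqF.
  have H' : ln x + (x0 + dl) / x <= ln x0 + (x0 + dl) / x0 + e.
    rewrite -(ler_pM2l N0); move: H; rewrite WE => H.
    apply: (le_trans (le_trans _ H)); rewrite le_eqVlt; apply/orP; left; apply/eqP; field;
      by rewrite ?gt_eqF.
  have dle z : c <= z -> `|dl / z| <= `|dl| / c.
    move=> cz; have z0 : 0 < z by exact: lt_le_trans cz.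
    by rewrite normrM normfV (gtr0_norm z0) ler_wpM2l// lef_pV2.
  have /andP[d1 _] : - (`|dl| / c) <= dl / x <= `|dl| / c by rewrite -ler_norml dle.
  have d2 : dl / x0 <= `|dl| / c by rewrite (le_trans (ler_norm _))// dle.
  have e1 : (x0 + dl) / x = x0 / x + dl / x by rewrite mulrDl.
  have e2 : (x0 + dl) / x0 = 1 + dl / x0 by rewrite mulrDl divff// gt_eqF.
  rewrite lnu /u -[2 * _ / c]mulrA; move: H'; rewrite e1 e2 => H'.
  lra.
have uC : u <= C / c by rewrite /u ler_pM// ?invr_ge0 ?(ltW x0p) ?(ltW xp)// lef_pV2.
have -> : x - x0 = - (x * (u - 1)) by rewrite /u; field; rewrite gt_eqF.
rewrite normrN normrM (gtr0_norm xp) -[leRHS]mulrA; apply: ler_pM => //; first exact: ltW.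
apply: le_trans (log_excess_bound u0 key) _.
by rewrite ler_wpM2r ?sqrtr_ge0// lerD2r.
Qed.

Lemma max_spacing_ge0 {R : realType} n (s : 'I_n -> R) : 0 <= max_spacing s.
Proof. exact: bigmax_ge_id. Qed.

Lemma spacing_le_max {R : realType} n (t : nat -> R) l : (l.+1 < n)%N ->
  t l.+1 - t l <= max_spacing (fun i : 'I_n => t i).
Proof.
move=> ln; have predE : ord_pred (Ordinal ln) = l :> nat.
  by rewrite -[LHS]/((l + n) %% n)%N modnDr modn_small// ltnW.
have := @le_bigmax_cond _ _ _ 0 (Ordinal ln) (fun i : 'I_n => (0 < i)%N)
  (spacing (fun i : 'I_n => t i)) isT.
by rewrite {1}/spacing predE.
Qed.

Theorem theorem6p1 (R : realType) (d : measure_display) (T : measurableType d)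
    (P : probability T R) (theta0 sigma02 : R)
    (theta0_gt0 : 0 < theta0) (sigma02_gt0 : 0 < sigma02)
    (Y : R -> {RV P >-> R})
    (Y_gauss : gaussian_process01 Y)
    (Y_cov : centered_with_cov01 Y (exp_cov theta0 sigma02))
    (p : nat) (p_gt0 : (0 < p)%N) (f : 'I_p -> R -> R) (beta0 : 'cV[R]_p)
    (s : forall n : nat, 'I_n -> R)
    (s_design : forall n : nat, (1 < n)%N -> is_design (s n))
    (a A b B : R) (a_gt0 : 0 < a) (a_le_A : a <= A)
    (b_gt0 : 0 < b) (b_le_B : b <= B)
    (s_dense : limn_esup (fun n => (max_spacing (s n))%:E) = 0%E)
    (J_microergodic : exists x : R * R,
       (`[a, A] `*` `[b, B]) x /\ x.1 * x.2 = theta0 * sigma02)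
    (f_C2 : forall k, twice_continuously_differentiable01 (f k))
    (f_indep : linearly_independent01 f) :
  let J : set (R * R) := `[a, A] `*` `[b, B] in
  let z (n : nat) (w : T) : 'cV[R]_n :=
    observations f (s n) beta0 (fun t => Y t w) in
  let S (n : nat) (w : T) : R -> R -> R :=
    loo_log_score f (s n) beta0 (z n w) in
  (\forall n \near \oo,
     (forall x, J x -> loo_well_defined f (s n) beta0 x.1 x.2) /\
     (forall w, exists x, is_argmin J (S n w) x)) /\
  (forall thetac sigmac2 : nat -> T -> R,
     (\forall n \near \oo, forall w,
        is_argmin J (S n w) (thetac n w, sigmac2 n w)) ->
     {ae P, forall w,
        (thetac n w * sigmac2 n w) @[n --> \oo] --> theta0 * sigma02}).

Proof.
move=> J z S.
(* Extends the design by 0 to all indices, as the lemmas above take sequences indexed by [nat]. *)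
pose t n l : R := oapp (s n) 0 (insub l : option 'I_n).
have sE n : s n = fun i : 'I_n => t n i by apply/funext => i; rewrite /t valK.
have t_lt n : (1 < n)%N -> forall k l, (k < l)%N -> (l < n)%N -> t n k < t n l.
  move=> n1 k l kl ln; have [_ _ +] := s_design n n1; rewrite sE.
  by move/(_ (Ordinal (ltn_trans kl ln)) (Ordinal ln)); exact.
have t0 n : (1 < n)%N -> t n 0 = 0.
  move=> n1; have [+ _ _] := s_design n n1; rewrite sE.
  by move/(_ (Ordinal (ltnW n1))); exact.
have t1 n : (1 < n)%N -> t n n.-1 = 1.
  move=> n1; have [_ + _] := s_design n n1; rewrite sE.
  have ln : (n.-1 < n)%N by rewrite prednK// ltnW.
  by move/(_ (Ordinal ln)); exact.
have t01 n : (1 < n)%N -> forall l, (l < n)%N -> 0 <= t n l <= 1.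
  move=> n1 l ln; have n1E : n.-1.+1 = n by rewrite prednK// ltnW.
  have t_le k m : (k <= m)%N -> (m < n)%N -> t n k <= t n m.
    by rewrite leq_eqVlt => /predU1P[->//|km mn]; rewrite ltW// t_lt.
  rewrite -{1}(t0 n n1) -(t1 n n1); apply/andP; split; apply: t_le => //.
    by rewrite -ltnS n1E.
  by rewrite n1E.
pose h n := max_spacing (s n).
have t_h n l : (l.+1 < n)%N -> t n l.+1 - t n l <= h n.
  by move=> ln; rewrite /h sE; exact: spacing_le_max.
have h_cvg : h n @[n --> \oo] --> 0.
  have : (fun n => (h n)%:E) @ \oo --> 0%E.
    apply: limn_esup_le_cvg; first by rewrite s_dense.
    by move=> n; rewrite lee_fin max_spacing_ge0.
  by move=> /fine_cvgP[].
have [C [h1 [C0 h10 asymp]]] :=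
  score_asymptotics f_C2 f_indep theta0_gt0 a_gt0 a_le_A b_gt0.
have large : \forall n \near \oo, (1 < n)%N /\ h n <= h1.
  apply: filterI; first by exists 2%N.
  by apply: (cvgr_le _ h_cvg).
split.
  apply: filterS large => n [n1 hn].
  have [Gu _] := asymp n (t n) (h n) n1 (t_lt n n1) (t0 n n1) (t1 n n1) (@t_h n) hn.
  split=> [x [/=]|w].
    rewrite !in_itv/= => /andP[ax _] /andP[bx _]; rewrite sE.
    apply: (loo_well_definedP (t_lt n n1) (t01 n n1) Gu).
      exact: lt_le_trans ax.
    exact: lt_le_trans bx.
  rewrite /S sE.
  exact: (loo_log_score_argmin (t_lt n n1) (t01 n n1) Gu).
move=> thetac sigmac2 argmin.
have t_design : \forall n \near \oo,
    (forall k l, (k < l)%N -> (l < n)%N -> t n k < t n l) /\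
    (forall l, (l < n)%N -> 0 <= t n l <= 1).
  by exists 2%N => // n n1; split; [exact: t_lt|exact: t01].
apply: filterS2
  (rkhs_lln theta0_gt0 sigma02_gt0 Y_gauss Y_cov t_design)
  (krig_stat_lln theta0_gt0 sigma02_gt0 Y_gauss Y_cov t_design) => w.
pose q n := rkhs n (t n) theta0 (fun l => Y (t n l) w).
pose V n := krig_stat theta0 n (t n) (fun l => Y (t n l) w).
rewrite -/(q _) -/(V _) => q_cvg V_cvg.
(* The true parameters may lie outside [J]; the minimizer is compared with a point of [J] having the
   same product. *)
have [[theta1 sigma1] [/= [/=]]] := J_microergodic.
rewrite !in_itv/= => /andP[at1 t1A] /andP[bs1 s1B] x0E.
set x0 := theta0 * sigma02 in x0E *.
(* The remainder of [score_asymptotics] divided by [n], taken twice since two scores are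
   compared. *)
pose e n := 2 * (C * (1 + V n / n%:R + q n / n%:R) * Num.sqrt (h n)).
pose r n := A * B * (A * B / (a * b) + 2) *
  Num.sqrt (e n + 2 * `|theta0 * V n / n%:R - x0| / (a * b)).
have sqrt_cvg (u : nat -> R) : u n @[n --> \oo] --> 0 -> Num.sqrt (u n) @[n --> \oo] --> 0.
  by move=> u0; rewrite -sqrtr0; apply: continuous_cvg => //; exact: sqrt_continuous.
have e_cvg : e n @[n --> \oo] --> 0.
  have -> : 0 = 2 * (C * (1 + sigma02 + sigma02) * 0) by rewrite !mulr0.
  apply: cvgM; first exact: cvg_cst.
  apply: cvgM; last exact: sqrt_cvg.
  apply: cvgM; first exact: cvg_cst.
  by apply: cvgD => //; apply: cvgD => //; exact: cvg_cst.
have r_cvg : r n @[n --> \oo] --> 0.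
  have -> : 0 = A * B * (A * B / (a * b) + 2) * 0 by rewrite mulr0.
  apply: cvgM; first exact: cvg_cst.
  apply: sqrt_cvg.
  have -> : 0 = 0 + 2 * `|theta0 * sigma02 - x0| / (a * b).
    by rewrite subrr normr0 mulr0 mul0r addr0.
  apply: cvgD => //; apply: cvgM; last exact: cvg_cst.
  apply: cvgM; first exact: cvg_cst.
  apply: cvg_norm; apply: cvgB; last exact: cvg_cst.
  under eq_cvg do rewrite -mulrA.
  by apply: cvgM => //; exact: cvg_cst.
suff bound : \forall n \near \oo, x0 - r n <= thetac n w * sigmac2 n w <= x0 + r n.
  apply: (squeeze_cvgr bound).
    by rewrite -[X in _ --> X]subr0; apply: cvgB => //; exact: cvg_cst.
  by rewrite -[X in _ --> X]addr0; apply: cvgD => //; exact: cvg_cst.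
apply: filterS2 large argmin => n [n1 hn] /(_ w) [[/=]].
rewrite !in_itv/= => /andP[act tcA] /andP[bsc scB].
have J1 : J (theta1, sigma1) by split; rewrite /= in_itv/= ?at1 ?bs1.
move=> /(_ _ J1) /=.
rewrite /S /z sE => Sle.
have [_ score] := asymp n (t n) (h n) n1 (t_lt n n1) (t0 n n1) (t1 n n1) (@t_h n) hn.
have n0 : (0 < n)%N by exact: ltnW.
have := score (thetac n w) (sigmac2 n w) beta0 (fun u => Y u w); rewrite act tcA => /(_ isT bsc).
have := score theta1 sigma1 beta0 (fun u => Y u w); rewrite at1 t1A => /(_ isT bs1).
rewrite x0E -/(V n) -/(q n).
move: Sle; set S1 := loo_log_score _ _ _ _ _ _; set S2 := loo_log_score _ _ _ _ _ _.
set x := thetac n w * sigmac2 n w; set o := score_offset _ _.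
set D := C * _ * _ => Sle.
rewrite !ler_norml => /andP[_ b1] /andP[b2 _].
have De : n%:R * e n = 2 * D.
  by rewrite /e /D; field; rewrite pnatr_eq0 -lt0n.
have a0 := a_gt0; have bb0 := b_gt0.
have ab0 : 0 < a * b by rewrite mulr_gt0.
have prod_in u v : a <= u -> u <= A -> b <= v -> v <= B -> a * b <= u * v /\ u * v <= A * B.
  move=> au uA bv vB; split; apply: ler_pM => //; try exact: ltW.
    exact: ltW (lt_le_trans a_gt0 au).
  exact: ltW (lt_le_trans b_gt0 bv).
have [x_ge x_le] := prod_in _ _ act tcA bsc scB.
have [x0_ge x0_le] := prod_in _ _ at1 t1A bs1 s1B; rewrite x0E in x0_ge x0_le.
(* The offset [o] does not depend on the parameters and cancels. *)
have main : n%:R * ln x + theta0 * V n / x <= n%:R * ln x0 + theta0 * V n / x0 + n%:R * e n.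
  by rewrite De; lra.
by rewrite -ler_distl; exact: minimizer_bound n0 ab0 x_ge x_le x0_ge x0_le main.
Qed.
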